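(* For any constant real $\varepsilon>0$ and constant positive integers $d$ and $k$ with $2\le k\le d$, there is a randomized algorithm which, given a set $S$ of $n$ points in $\mathbb{R}^d$ and a point $y\in\mathbb{R}^d$, returns $k$ points of $S$ whose convex hull has Euclidean distance from $y$ at most $(1+\varepsilon)$ times the minimum, over all choices of $k$ points of $S$, of the distance from $y$ to their convex hull. With high probability the algorithm runs in time $O(n^{k-1}\log^d n)$.
   Context: This is the nearest induced simplex problem (equivalently, sparse convex regression: find $x\in\mathbb{R}^n$ with at most $k$ nonzero entries, all entries nonnegative and $\sum_i x_i=1$, minimizing $\|Ax-y\|_2$ where the columns of $A$ are the points of $S$). The distance from a point to a set is the Euclidean distance to its closest point. *)

(* Defs.v *)
From HB Require Import structures.
From mathcomp Require Import all_boot all_order all_algebra.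
From mathcomp Require Import classical_sets reals exp.
Set Implicit Arguments.
Unset Strict Implicit.
Unset Printing Implicit Defensive.
Import Order.TTheory GRing.Theory Num.Theory.
Local Open Scope classical_set_scope.
Local Open Scope ring_scope.

Section Geometry.
Variables (R : realType) (d : nat).
Implicit Types (x y : 'rV[R]_d) (A : set 'rV[R]_d).

(* The norm that the library puts on 'rV[R]_d is the sup norm. *)
Definition eucl_dist x y : R := Num.sqrt (\sum_(i < d) (x 0 i - y 0 i) ^+ 2).

(* Only used for nonempty compact A, where the infimum is attained. *)
Definition dist_to_set y A : R := inf [set eucl_dist y x | x in A].

Definition convex_hull k (p : 'I_k -> 'rV[R]_d) : set 'rV[R]_d :=
  [set x | exists a : 'I_k -> R,
    [/\ forall i, 0 <= a i, \sum_i a i = 1 & x = \sum_i a i *: p i]].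

Definition simplex_dist y k (p : 'I_k -> 'rV[R]_d) : R :=
  dist_to_set y (convex_hull p).

(* A choice of k of the n points is an injection 'I_k -> 'I_n. For k <= n this
   is the infimum of a finite nonempty set, that is, a minimum. *)
Definition nearest_simplex_dist k n (S : 'I_n -> 'rV[R]_d) y : R :=
  inf [set simplex_dist y (S \o J) | J in [set J : 'I_k -> 'I_n | injective J]].

End Geometry.

(* Randomized real RAM. The machine has two kinds of data, w-bit words and exact
   real numbers, each with a register file and a random-access memory; memory is
   addressed by words. Word arithmetic is modulo 2 ^ w. Reals can only be
   combined by field operations and compared: there is no conversion from reals
   to words (in particular no rounding), and programs contain no real literals.
   Every instruction takes one time unit. Instruction operands are register
   indices, except for the literal of WConst and the jump targets.            *)
Inductive instr : Type :=
  | Halt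
  | Jmp   (target : nat)
  | JmpWLe (a b target : nat)  (* jump if word a <= word b *)
  | JmpRLe (a b target : nat)  (* jump if real a <= real b *)
  | WConst (a literal : nat)
  | WRand (a : nat)            (* a := uniformly random word *)
  | WAdd  (a b c : nat)        (* a := b op c *)
  | WSub  (a b c : nat)        (* truncated at 0 *)
  | WMul  (a b c : nat)
  | WDiv  (a b c : nat)
  | WLoad  (a addr : nat)      (* a := memory[addr] *)
  | WStore (a addr : nat)      (* memory[addr] := a *)
  | RofW  (a b : nat)          (* real a := word b *)
  | RAdd  (a b c : nat)
  | RSub  (a b c : nat)
  | RMul  (a b c : nat)
  | RDiv  (a b c : nat)
  | RLoad  (a addr : nat)      (* addr is a word register *)
  | RStore (a addr : nat).

Definition program := seq instr.

Record state (R : Type) := State {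
  pc : nat;
  wreg : nat -> nat;
  wmem : nat -> nat;
  rreg : nat -> R;
  rmem : nat -> R }.

Section Semantics.
Variables (R : realType) (w : nat) (P : program).
Implicit Types s : state R.

Definition fetch s : instr := nth Halt P (pc s).

Definition halted s : bool := if fetch s is Halt then true else false.

Definition goto s i : state R :=
  State i (wreg s) (wmem s) (rreg s) (rmem s).

Definition set_wreg s (a v : nat) : state R :=
  State (pc s).+1 [eta wreg s with a |-> (v %% 2 ^ w)%N]
        (wmem s) (rreg s) (rmem s).

Definition set_wmem s (a v : nat) : state R :=
  State (pc s).+1 (wreg s) [eta wmem s with a |-> v] (rreg s) (rmem s).

Definition set_rreg s (a : nat) (v : R) : state R :=
  State (pc s).+1 (wreg s) (wmem s) [eta rreg s with a |-> v] (rmem s).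

Definition set_rmem s (a : nat) (v : R) : state R :=
  State (pc s).+1 (wreg s) (wmem s) (rreg s) [eta rmem s with a |-> v].

(* r is a fresh random word, supplied at each step and only used by WRand. *)
Definition step s (r : 'I_(2 ^ w)) : state R :=
  match fetch s with
  | Halt => s
  | Jmp t => goto s t
  | JmpWLe a b t =>
      goto s (if (wreg s a <= wreg s b)%N then t else (pc s).+1)
  | JmpRLe a b t =>
      goto s (if rreg s a <= rreg s b then t else (pc s).+1)
  | WConst a v => set_wreg s a v
  | WRand a => set_wreg s a r
  | WAdd a b c => set_wreg s a (wreg s b + wreg s c)%N
  | WSub a b c => set_wreg s a (wreg s b - wreg s c)%N
  | WMul a b c => set_wreg s a (wreg s b * wreg s c)%N
  | WDiv a b c => set_wreg s a (wreg s b %/ wreg s c)%N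
  | WLoad a addr => set_wreg s a (wmem s (wreg s addr))
  | WStore a addr => set_wmem s (wreg s addr) (wreg s a)
  | RofW a b => set_rreg s a (wreg s b)%:R
  | RAdd a b c => set_rreg s a (rreg s b + rreg s c)
  | RSub a b c => set_rreg s a (rreg s b - rreg s c)
  | RMul a b c => set_rreg s a (rreg s b * rreg s c)
  | RDiv a b c => set_rreg s a (rreg s b / rreg s c)
  | RLoad a addr => set_rreg s a (rmem s (wreg s addr))
  | RStore a addr => set_rmem s (wreg s addr) (rreg s a)
  end.

Definition run s (rs : seq 'I_(2 ^ w)) : state R := foldl step s rs.

Lemma run_halted s rs : halted s -> run s rs = s.
Proof.
elim: rs => //= r rs IH hs; rewrite -[RHS]IH //; congr run.
by move: hs; rewrite /halted /step; case: (fetch s).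
Qed.

(* By run_halted, the event below is "the running time is at most T": the first
   T random words determine the first T steps. They are independent and uniform.
*)
Definition prob_halt_within s (T : nat) : R :=
  #|[pred rs : T.-tuple 'I_(2 ^ w) | halted (run s rs)]|%:R
  / #|{: T.-tuple 'I_(2 ^ w)}|%:R.

End Semantics.

Section InputOutput.
Variables (R : realType) (d n : nat).

(* n is in word register 0; real memory holds the coordinates of the n points,
   one point after the other, followed by those of y; all other cells are 0. *)
Definition input (S : 'I_n -> 'rV[R]_d) (y : 'rV[R]_d) : state R :=
  let cells := flatten [seq [seq p 0 j | j <- enum 'I_d]
                       | p : 'rV[R]_d <- rcons [seq S i | i <- enum 'I_n] y] in
  State 0 [eta fun=> 0%N with 0%N |-> n] (fun=> 0%N) (fun=> 0) (nth 0 cells).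

(* The answer is in word memory cells 0, ..., k-1, as indices of points. *)
Definition outputs k (s : state R) (J : 'I_k -> 'I_n) : Prop :=
  forall i : 'I_k, wmem s i = J i :> nat.

End InputOutput.

(* Words of O(log n) bits. *)
Definition word_size (b n : nat) : nat := (b * up_log 2 n)%N.

(* All runs, whatever the random words, halt with an admissible answer. *)
Definition approximates_nearest_simplex (R : realType) (d k : nat) (eps : R)
    (P : program) (b : nat) : Prop :=
  forall (n : nat) (S : 'I_n -> 'rV[R]_d) (y : 'rV[R]_d),
    (k <= n)%N -> injective S ->
    forall rs : nat -> 'I_(2 ^ word_size b n),
    exists T, let s := run P (input S y) (mkseq rs T) in
      halted P s /\
      exists J : 'I_k -> 'I_n,
        [/\ outputs s J, injective J &
            simplex_dist y (S \o J)
            <= (1 + eps) * nearest_simplex_dist k S y].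

(* "With high probability": for each constant c the bound holds, with a hidden
   constant depending on c, with probability at least 1 - n ^ -c. *)
Definition runs_whp_in_O (R : realType) (d k : nat) (P : program) (b : nat)
    (f : nat -> R) : Prop :=
  forall c : nat, exists C : R,
  forall (n : nat) (S : 'I_n -> 'rV[R]_d) (y : 'rV[R]_d),
    (k <= n)%N -> injective S ->
    1 - n%:R ^- c
    <= prob_halt_within (word_size b n) P (input S y) (Num.truncn (C * f n)).

(* Main.v *)
(* The algorithm is deterministic. Fix a center Y. If the points v_i - Y span a
   simplex containing x - Y, then, up to a factor k, the l1 norm of x - Y is matched
   by a basic solution of a linear program: k - 2 of the points, completed by signed
   coordinate axes to a basis, and two more points p, q on opposite sides of its last
   coordinate, such that the segment from p to q, moved along the first points, comes
   close to Y as soon as the d - 1 keys (slopes of the remaining coordinates) of p are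
   at most those of q. For each of the n^(k-2) choices of the first points, the best q
   for every p is found by dominance searching: a range tree over the d - 1 ranks, in
   time O(n log^(d-1) n), keeps at every node the point with the least sum of keys.
   With Y = y this gives a constant factor approximation z. Rerunning the search from
   each center of a grid of constant size around y, whose mesh is proportional to
   |z - y|, improves the factor to 1 + eps, because some grid center is within
   eps |z - y| of the optimal point. Only the differences z_c - y_c are used as mesh
   sizes, so that no rounding of reals is needed. *)
Require Import Defs.
From mathcomp Require Import all_boot all_order all_algebra all_fingroup.
From mathcomp Require Import classical_sets reals exp.
From mathcomp Require Import zify ring lra.
Set Implicit Arguments.
Unset Strict Implicit.
Unset Printing Implicit Defensive.
Import Order.TTheory GRing.Theory Num.Theory.


(** * A structured language with bounded loops *)

(** Behind the search is an elimination. In [coo p] times [q - Y] minus [coo q] times [p - Y] the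
    last coordinate cancels, and the first points can cancel theirs with nonnegative weights as soon
    as the corresponding keys do not decrease from [p] to [q]. The residue lies on the axes and,
    after normalization, has l1 norm at most [coo p] times the growth of the key sum. For fixed [p]
    the quality of [q] is thus a single number, which is why nodes that store a minimum suffice. The
    factor k arises because a vertex of the linear program controls this bound only after
    multiplication by its largest weight, which is at least 1 / k. Axes, signs and the direction of
    ties are unknown, but have constantly many values, and all are tried. The tree has no pointers:
    a node is a cell whose address spells the first points, the levels and the node numbers in base
    n + 1, and words of O(log n) bits can hold it. Memory starts at 0, so empty cells are
    recognizable; clearing is too expensive, hence a fresh array for each coordinate system and each
    center. The program is written in a language of bounded loops, whose cost is read off the
    syntax. *)

Definition var := (nat * nat)%type.

Inductive binop := OAdd | OSub | OMul | ODiv.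

(* [WN] is the number of points, [WM id e] the cell [e] of the word array [id],
   [RI e] the cell [e] of the (read-only) real input. *)
Inductive wexp :=
  WN | WV of var | WL of nat | WB of binop & wexp & wexp | WM of nat & wexp.

Inductive rexp := RV of var | RL of nat | RI of wexp | RB of binop & rexp & rexp.

(* [CIfW] and [CIfR] test [e1 <= e2]. The loop [CFor false x] runs x through
   0, 1, ..., n-1, the loop [CFor true x] through the powers 2 ^ i < n. *)
Inductive cmd :=
  | CSkip
  | CW of var & wexp
  | CM of nat & wexp & wexp
  | CR of var & rexp
  | CSeq of cmd & cmd
  | CIfW of wexp & wexp & cmd & cmd
  | CIfR of rexp & rexp & cmd & cmd
  | CFor of bool & var & cmd.

Record store (R : Type) := Store {
  wv : var -> nat;
  wm : nat -> nat -> nat;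
  rv : var -> R }.

Section StoreOps.
Variable R : Type.
Implicit Types s : store R.
Definition wset s x v := Store (fun y => if y == x then v else wv s y) (wm s) (rv s).
Definition mset s id a v :=
  Store (wv s) (fun i b => if (i == id) && (b == a) then v else wm s i b) (rv s).
Definition rset s x v := Store (wv s) (wm s) (fun y => if y == x then v else rv s y).
End StoreOps.

Definition wapply (o : binop) : nat -> nat -> nat :=
  match o with OAdd => addn | OSub => subn | OMul => muln | ODiv => divn end.

Definition rapply (R : realType) (o : binop) : R -> R -> R :=
  match o with
  | OAdd => fun x y => x + y | OSub => fun x y => x - y
  | OMul => fun x y => x * y | ODiv => fun x y => x / y
  end%R.

Definition loop_range n (lg : bool) : seq nat :=
  if lg then [seq 2 ^ i | i <- iota 0 (up_log 2 n)] else iota 0 n.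

Fixpoint loop_safe T (P : nat -> T -> Prop) (f : nat -> T -> T) (l : seq nat) (s : T) :=
  if l is i :: l' then P i s /\ loop_safe P f l' (f i s) else True.

Section Semantics.
Variables (R : realType) (n w K : nat) (inp : nat -> R).
Implicit Types (s : store R) (c : cmd).
Local Notation W := (2 ^ w).

Fixpoint weval s e : nat :=
  match e with
  | WN => n
  | WV x => wv s x
  | WL m => m
  | WB o a b => wapply o (weval s a) (weval s b)
  | WM id a => wm s id (weval s a)
  end.

Fixpoint reval s e : R :=
  match e with
  | RV x => rv s x
  | RL m => m%:R
  | RI a => inp (weval s a)
  | RB o a b => rapply o (reval s a) (reval s b)
  end.

(** Every intermediate value fits in a word, so machine arithmetic modulo [W] agrees with arithmetic
    in [nat]. Arrays are interleaved: cell [a] of array [id] has address [a * K + id], so that no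
    array has a declared length. *)
Fixpoint wsafe s e : bool :=
  (weval s e < W) &&
  match e with
  | WB _ a b => wsafe s a && wsafe s b
  | WM id a => [&& wsafe s a, id < K & weval s a * K + id < W]
  | _ => true
  end.

Fixpoint rsafe s e : bool :=
  match e with
  | RV x => true
  | RL m => m < W
  | RI a => wsafe s a
  | RB _ a b => rsafe s a && rsafe s b
  end.

Fixpoint exec c s : store R :=
  match c with
  | CSkip => s
  | CW x e => wset s x (weval s e)
  | CM id a e => mset s id (weval s a) (weval s e)
  | CR x e => rset s x (reval s e)
  | CSeq a b => exec b (exec a s)
  | CIfW e1 e2 a b => if weval s e1 <= weval s e2 then exec a s else exec b s
  | CIfR e1 e2 a b => if (reval s e1 <= reval s e2)%R then exec a s else exec b s
  | CFor lg x a => foldl (fun s i => exec a (wset s x i)) s (loop_range n lg)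
  end.

Fixpoint safe c s : Prop :=
  match c with
  | CSkip => True
  | CW x e => wsafe s e
  | CM id a e => [&& wsafe s a, wsafe s e, id < K & weval s a * K + id < W]
  | CR x e => rsafe s e
  | CSeq a b => safe a s /\ safe b (exec a s)
  | CIfW e1 e2 a b => wsafe s e1 && wsafe s e2 /\
     (if weval s e1 <= weval s e2 then safe a s else safe b s)
  | CIfR e1 e2 a b => rsafe s e1 && rsafe s e2 /\
     (if (reval s e1 <= reval s e2)%R then safe a s else safe b s)
  | CFor lg x a =>
     loop_safe (fun i s => safe a (wset s x i)) (fun i s => exec a (wset s x i))
       (loop_range n lg) s
  end.

Fixpoint wlen e : nat :=
  match e with
  | WN | WV _ => 2
  | WL _ => 1
  | WB _ a b => wlen a + wlen b + 1
  | WM _ a => wlen a + 5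
  end.

Fixpoint rlen e : nat :=
  match e with
  | RV _ | RL _ => 2
  | RI a => wlen a + 1
  | RB _ a b => rlen a + rlen b + 1
  end.

Fixpoint clen c : nat :=
  match c with
  | CSkip => 0
  | CW _ e => wlen e + 2
  | CM _ a e => wlen a + wlen e + 5
  | CR _ e => rlen e + 2
  | CSeq a b => clen a + clen b
  | CIfW e1 e2 a b => wlen e1 + wlen e2 + clen a + clen b + 2
  | CIfR e1 e2 a b => rlen e1 + rlen e2 + clen a + clen b + 2
  | CFor _ _ a => clen a + 7
  end.

(** Both branches of a conditional are charged. The bound depends on [n] but not on the store, so
    running time is estimated separately from correctness. *)
Fixpoint cost c : nat :=
  match c with
  | CSkip => 0
  | CW _ e => wlen e + 2
  | CM _ a e => wlen a + wlen e + 5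
  | CR _ e => rlen e + 2
  | CSeq a b => cost a + cost b
  | CIfW e1 e2 a b => wlen e1 + wlen e2 + cost a + cost b + 2
  | CIfR e1 e2 a b => rlen e1 + rlen e2 + cost a + cost b + 2
  | CFor lg _ a => size (loop_range n lg) * (cost a + 6) + 2
  end.

End Semantics.

(** * Compilation to the random access machine *)

(* Register 0 holds n; the other word registers are split between temporaries,
   program variables and hidden loop counters. *)
Definition Tm t := 3 * t + 1.
Definition VR (x : var) := 3 * pickle x + 2.
Definition Hd t := 3 * t + 3.
Definition RT t := 2 * t.
Definition RVR (x : var) := 2 * pickle x + 1.

Definition winstr o : nat -> nat -> nat -> instr :=
  match o with OAdd => WAdd | OSub => WSub | OMul => WMul | ODiv => WDiv end.
Definition rinstr o : nat -> nat -> nat -> instr :=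
  match o with OAdd => RAdd | OSub => RSub | OMul => RMul | ODiv => RDiv end.

Section Compile.
Variable K : nat.

(** The value lands in [Tm t], and temporaries below [t] are preserved, which keeps the left operand
    alive while the right one is computed. The machine has no move instruction: a register is copied
    by adding 0. *)
Fixpoint cw e t : seq instr :=
  match e with
  | WN => [:: WConst (Tm t.+1) 0; WAdd (Tm t) 0 (Tm t.+1)]
  | WV x => [:: WConst (Tm t.+1) 0; WAdd (Tm t) (VR x) (Tm t.+1)]
  | WL m => [:: WConst (Tm t) m]
  | WB o a b => cw a t ++ cw b t.+1 ++ [:: winstr o (Tm t) (Tm t) (Tm t.+1)]
  | WM id a => cw a t ++ [:: WConst (Tm t.+1) K; WMul (Tm t) (Tm t) (Tm t.+1);
      WConst (Tm t.+1) id; WAdd (Tm t) (Tm t) (Tm t.+1); WLoad (Tm t) (Tm t)]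
  end.

(** There are no real literals, so the 0 added in a copy is produced as a difference [x - x], and an
    integer constant is converted from a word. *)
Fixpoint cr e t : seq instr :=
  match e with
  | RV x => [:: RSub (RT t.+1) (RT t.+1) (RT t.+1); RAdd (RT t) (RVR x) (RT t.+1)]
  | RL m => [:: WConst (Tm 0) m; RofW (RT t) (Tm 0)]
  | RI a => cw a 0 ++ [:: RLoad (RT t) (Tm 0)]
  | RB o a b => cr a t ++ cr b t.+1 ++ [:: rinstr o (RT t) (RT t) (RT t.+1)]
  end.

(** Jump targets are absolute, hence the address [start]. A loop at nesting depth [lv] counts in the
    hidden register [Hd lv], which starts at [lg], that is 1 for powers of two and 0 otherwise. It
    is copied to the program variable in every round, so the body cannot disturb the count. *)
Fixpoint cc c (lv start : nat) : seq instr :=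
  match c with
  | CSkip => [::]
  | CW x e => cw e 0 ++ [:: WConst (Tm 1) 0; WAdd (VR x) (Tm 0) (Tm 1)]
  | CM id a e => cw a 0 ++ cw e 1 ++
      [:: WConst (Tm 2) K; WMul (Tm 0) (Tm 0) (Tm 2); WConst (Tm 2) id;
          WAdd (Tm 0) (Tm 0) (Tm 2); WStore (Tm 1) (Tm 0)]
  | CR x e => cr e 0 ++
      [:: RSub (RT 1) (RT 1) (RT 1); RAdd (RVR x) (RT 0) (RT 1)]
  | CSeq a b => cc a lv start ++ cc b lv (start + clen a)
  | CIfW e1 e2 a b =>
      let p := start + (wlen e1 + wlen e2) in
      let q := p.+1 + clen b in
      cw e1 0 ++ cw e2 1 ++ JmpWLe (Tm 0) (Tm 1) q.+1 ::
      cc b lv p.+1 ++ Jmp (q.+1 + clen a) :: cc a lv q.+1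
  | CIfR e1 e2 a b =>
      let p := start + (rlen e1 + rlen e2) in
      let q := p.+1 + clen b in
      cr e1 0 ++ cr e2 1 ++ JmpRLe (RT 0) (RT 1) q.+1 ::
      cc b lv p.+1 ++ Jmp (q.+1 + clen a) :: cc a lv q.+1
  | CFor lg x a =>
      let h := Hd lv in
      [:: WConst h lg; JmpWLe 0 h (start + (clen a + 7)); WConst (Tm 0) 0;
          WAdd (VR x) h (Tm 0)] ++ cc a lv.+1 (start + 4) ++
      [:: WConst (Tm 0) 1; WAdd h h (if lg then h else Tm 0); Jmp start.+1]
  end.

Lemma size_cw e t : size (cw e t) = wlen e.
Proof.
elim: e t => //= [o a IHa b IHb|i a IHa] t; rewrite !size_cat ?IHa ?IHb /=; lia.
Qed.

Lemma size_cr e t : size (cr e t) = rlen e.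
Proof.
elim: e t => //= [a|o a IHa b IHb] t; rewrite !size_cat ?size_cw ?IHa ?IHb //=; lia.
Qed.

Lemma size_cc c lv p : size (cc c lv p) = clen c.
Proof.
elim: c lv p => //=
  [x e|i a e|x e|a IHa b IHb|e1 e2 a IHa b IHb|e1 e2 a IHa b IHb|lg x a IHa] lv p.
- by rewrite size_cat size_cw.
- by rewrite !size_cat !size_cw addnA.
- by rewrite size_cat size_cr.
- by rewrite size_cat IHa IHb.
- by rewrite !size_cat !size_cw /= size_cat /= IHa IHb; lia.
- by rewrite !size_cat !size_cr /= size_cat /= IHa IHb; lia.
- by rewrite !size_cat /= IHa; lia.
Qed.

Definition code_at (P : program) i (code : seq instr) :=
  forall j, j < size code -> nth Halt P (i + j) = nth Halt code j.

Lemma code_at_cat P i a b : code_at P i (a ++ b) <->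
  code_at P i a /\ code_at P (i + size a) b.
Proof.
split=> [H|[Ha Hb] j].
  split=> j Hj; first by rewrite H ?size_cat ?nth_cat ?Hj //; lia.
  rewrite -addnA H ?size_cat ?nth_cat; last by lia.
  by rewrite ltnNge leq_addr /= addKn.
rewrite size_cat nth_cat => Hj; case: ltnP => Hja; first exact: Ha.
rewrite -Hb; last by lia.
by congr nth; lia.
Qed.

Lemma code_at_cons P i a b : code_at P i (a :: b) <->
  nth Halt P i = a /\ code_at P i.+1 b.
Proof.
rewrite -cat1s code_at_cat /= addn1; split=> -[H1 H2]; split=> //.
  by rewrite -[i]addn0 H1.
by case=> // _; rewrite addn0.
Qed.

End Compile.

(** * Correctness of the compiler *)

Section Simulation.
Variables (R : realType) (n w K : nat) (inp : nat -> R) (P : program).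
Implicit Types (s : store R) (m : state R) (c : cmd).
Local Notation W := (2 ^ w).
Hypotheses (nW : n.*2 <= W) (W1 : 1 < W) (n1 : 1 < n) (KW : K < W).

(** One [m'] for all random words: compiled code contains no [WRand]. *)
Definition steps m t m' := forall rs : seq 'I_W, size rs = t -> run P m rs = m'.

Lemma steps0 m : steps m 0 m.
Proof. by move=> rs /size0nil ->. Qed.

Lemma steps_trans m1 m2 m3 t u : steps m1 t m2 -> steps m2 u m3 -> steps m1 (t + u) m3.
Proof.
move=> H1 H2 rs Hrs; rewrite -[rs](cat_take_drop t) /run foldl_cat.
rewrite -/(run P m1 _) (H1 (take t rs)); last by rewrite size_takel // Hrs leq_addr.
by rewrite -/(run P m2 _) H2 // size_drop Hrs addKn.
Qed.

Lemma steps_cons m1 m2 m3 t :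
  (forall r : 'I_W, step P m1 r = m2) -> steps m2 t m3 -> steps m1 t.+1 m3.
Proof.
move=> H1 H2; rewrite -add1n; apply: steps_trans H2.
by case=> // r [|//] _ /=; rewrite H1.
Qed.

Local Ltac step_by H := apply: steps_cons; first by [move=> ?; rewrite /step /fetch /= H].

Definition represents s m := [/\ wreg m 0 = n, forall x, wreg m (VR x) = wv s x,
  forall id a, id < K -> a * K + id < W -> wmem m (a * K + id) = wm s id a,
  forall x, rreg m (RVR x) = rv s x & forall a, rmem m a = inp a].

Lemma VR_inj x y : VR x = VR y -> x = y.
Proof. by rewrite /VR => H; apply: (pcan_inj pickleK); lia. Qed.

Lemma RVR_inj x y : RVR x = RVR y -> x = y.
Proof. by rewrite /RVR => H; apply: (pcan_inj pickleK); lia. Qed.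

Definition temps_only t m m' :=
  [/\ forall r, (forall u, t <= u -> r <> Tm u) -> wreg m' r = wreg m r,
      wmem m' = wmem m & rmem m' = rmem m].

Lemma wsafe_lt s e : wsafe n w K s e -> weval n s e < W.
Proof. by case: e => [|x|m|o a b|id a] /= /andP[]. Qed.

Lemma cw_sound e t s m : represents s m -> wsafe n w K s e -> code_at P (pc m) (cw K e t) ->
  exists m', [/\ steps m (wlen e) m', pc m' = pc m + wlen e,
    wreg m' (Tm t) = weval n s e, temps_only t m m' & rreg m' = rreg m].
Proof.
elim: e t m => [|x|v|o a IHa b IHb|id a IHa] t m Hrel /=.
- move=> _ /code_at_cons[H1 /code_at_cons[H2 _]].
  eexists; split.
  + step_by H1.
    by step_by H2; exact: steps0.
  + by rewrite /= addn2.
  + case: Hrel => H0 _ _ _ _; rewrite /= eqxx H0.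
    by rewrite eqxx mod0n addn0 modn_small //; lia.
  + split=> //= r Hr; case: eqP => [/(Hr t (leqnn _))//|_].
    by case: eqP => [/(Hr t.+1 (leqnSn _))//|_].
  + by [].
- move=> /andP[Hx _] /code_at_cons[H1 /code_at_cons[H2 _]].
  eexists; split.
  + step_by H1.
    by step_by H2; exact: steps0.
  + by rewrite /= addn2.
  + case: Hrel => _ H0 _ _ _; rewrite /= eqxx /Tm.
    case: eqP => [|_]; first by rewrite /VR; lia.
    by rewrite eqxx mod0n addn0 H0 modn_small.
  + split=> //= r Hr; case: eqP => [/(Hr t (leqnn _))//|_].
    by case: eqP => [/(Hr t.+1 (leqnSn _))//|_].
  + by [].
- move=> /andP[Hx _] /code_at_cons[H1 _]; eexists; split.
  + by step_by H1; exact: steps0.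
  + by rewrite /= addn1.
  + by rewrite /= eqxx modn_small.
  + by split=> //= r Hr; case: eqP => [/(Hr t (leqnn _))//|_].
  + by [].
- move=> /andP[Hx /andP[sa sb]] /code_at_cat[ca /code_at_cat[cb /code_at_cons[H1 _]]].
  have [m1 [st1 pc1 v1 [T1 M1 I1] R1]] := IHa t m Hrel sa ca.
  have Hrel1 : represents s m1.
    case: Hrel => h1 h2 h3 h4 h5; split=> //.
    + by rewrite T1 // /Tm; lia.
    + by move=> x; rewrite T1 // /Tm /VR; lia.
    + by rewrite M1.
    + by rewrite R1.
    + by rewrite I1.
  rewrite size_cw -pc1 in cb.
  have [m2 [st2 pc2 v2 [T2 M2 I2] R2]] := IHb t.+1 m1 Hrel1 sb cb.
  rewrite !size_cw -pc1 -pc2 in H1.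
  have v1' : wreg m2 (Tm t) = weval n s a.
    by rewrite T2 // /Tm; lia.
  exists (set_wreg w m2 (Tm t) (wapply o (wreg m2 (Tm t)) (wreg m2 (Tm t.+1)))); split.
  + apply: steps_trans; first by apply: (steps_trans st1 st2).
    apply: steps_cons; last exact: steps0.
    by move=> r; rewrite /step /fetch H1; case: (o).
  + by case: (o) => /=; rewrite pc2 pc1; lia.
  + by case: (o) Hx => /= Hx; rewrite eqxx v1' v2 modn_small.
  + split; last by case: (o) => /=; rewrite I2.
    * move=> r Hr.
      have E : (r == Tm t) = false by apply/eqP; apply: Hr.
      have {}Hr u : t < u -> r <> Tm u by move=> tu; apply: Hr; lia.
      have {}T2 := T2 _ Hr.
      rewrite -T1 -?T2; first by case: (o) => /=; rewrite E.
      by move=> u tu; case: (ltngtP t u) tu => // [/Hr //|<- _]; apply/eqP; rewrite E.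
    * by case: (o) => /=; rewrite M2.
  + by case: (o) => /=; rewrite R2.
- move=> /andP[Hx /and3P[sa idK aW]] /code_at_cat[ca].
  move=> /code_at_cons[H1 /code_at_cons[H2 /code_at_cons[H3 /code_at_cons[H4 /code_at_cons[H5 _]]]]].
  have [m1 [st1 pc1 v1 [T1 M1 I1] R1]] := IHa t m Hrel sa ca.
  rewrite size_cw -pc1 in H1 H2 H3 H4 H5.
  have E : (Tm t == Tm t.+1) = false by apply/eqP; rewrite /Tm; lia.
  have E' : (Tm t.+1 == Tm t) = false by rewrite eq_sym.
  eexists; split.
  + apply: (steps_trans st1).
    step_by H1.
    step_by H2.
    step_by H3.
    step_by H4.
    by step_by H5; exact: steps0.
  + by rewrite /= pc1; lia.
  + have idW : id < W by lia.
    have aKW : weval n s a * K < W by lia.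
    rewrite /= !eqxx ?E ?E' v1 ?eqxx (modn_small KW) (modn_small aKW) (modn_small idW).
    rewrite (modn_small aW) M1; case: Hrel => _ _ h3 _ _; rewrite h3 // modn_small //.
  + split=> //= r Hr; rewrite !(introF eqP (Hr t (leqnn _))) !(introF eqP (Hr t.+1 (leqnSn _))).
    exact: T1.
  + by [].
Qed.

Lemma rel_temps t s m m' : represents s m -> temps_only t m m' ->
  (forall x, rreg m' (RVR x) = rreg m (RVR x)) -> represents s m'.
Proof.
move=> [h1 h2 h3 h4 h5] [T1 M1 I1] R1; split.
- by rewrite T1 // /Tm; lia.
- by move=> x; rewrite T1 // /Tm /VR; lia.
- by rewrite M1.
- by move=> x; rewrite R1.
- by rewrite I1.
Qed.

Lemma temps_only_trans m1 m2 m3 t u : temps_only t m1 m2 -> temps_only u m2 m3 ->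
  temps_only (minn t u) m1 m3.
Proof.
move=> [A1 A2 A3] [B1 B2 B3]; split; last by rewrite B3.
- move=> r Hr; rewrite B1 ?A1 // => v Hv; apply: Hr; lia.
- by rewrite B2.
Qed.

Lemma cr_sound e t s m : represents s m -> rsafe n w K s e -> code_at P (pc m) (cr K e t) ->
  exists m', [/\ steps m (rlen e) m', pc m' = pc m + rlen e,
    rreg m' (RT t) = reval n inp s e, temps_only 0 m m' &
    forall r, (forall u, t <= u -> r <> RT u) -> rreg m' r = rreg m r].
Proof.
elim: e t m => [x|v|a|o a IHa b IHb] t m Hrel /=.
- move=> _ /code_at_cons[H1 /code_at_cons[H2 _]]; eexists; split.
  + step_by H1.
    by step_by H2; exact: steps0.
  + by rewrite /= addn2.
  + rewrite /= eqxx; case: eqP => [|_]; first by rewrite /RT /RVR; lia.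
    by rewrite eqxx subrr addr0; case: Hrel.
  + by split.
  + move=> r Hr /=; rewrite !(introF eqP (Hr t (leqnn _))).
    by rewrite !(introF eqP (Hr t.+1 (leqnSn _))).
- move=> vW /code_at_cons[H1 /code_at_cons[H2 _]]; eexists; split.
  + step_by H1.
    by step_by H2; exact: steps0.
  + by rewrite /= addn2.
  + by rewrite /= !eqxx modn_small.
  + by split=> //= r Hr; rewrite !(introF eqP (Hr 0 (leqnn _))).
  + by move=> r Hr /=; rewrite !(introF eqP (Hr t (leqnn _))).
- move=> sa /code_at_cat[ca /code_at_cons[H1 _]].
  have [m1 [st1 pc1 v1 T1 R1]] := cw_sound Hrel sa ca.
  rewrite size_cw -pc1 in H1; eexists; split.
  + apply: (steps_trans st1); by step_by H1; exact: steps0.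
  + by rewrite /= pc1 addn1 addnS.
  + by rewrite /= eqxx v1; case: T1 => _ _ ->; case: Hrel.
  + by case: T1.
  + by move=> r Hr /=; rewrite !(introF eqP (Hr t (leqnn _))) R1.
- move=> /andP[sa sb] /code_at_cat[ca /code_at_cat[cb /code_at_cons[H1 _]]].
  have [m1 [st1 pc1 v1 T1 R1]] := IHa t m Hrel sa ca.
  have Hrel1 : represents s m1.
    by apply: (rel_temps Hrel T1) => x; apply: R1 => u _; rewrite /RVR /RT; lia.
  rewrite size_cr -pc1 in cb.
  have [m2 [st2 pc2 v2 T2 R2]] := IHb t.+1 m1 Hrel1 sb cb.
  rewrite !size_cr -pc1 -pc2 in H1.
  have T12 := temps_only_trans T1 T2.
  have v1' : rreg m2 (RT t) = reval n inp s a.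
    by rewrite R2 // /RT; lia.
  exists (set_rreg m2 (RT t) (rapply o (rreg m2 (RT t)) (rreg m2 (RT t.+1)))); split.
  + apply: steps_trans; first by apply: (steps_trans st1 st2).
    apply: steps_cons; last exact: steps0.
    by move=> r; rewrite /step /fetch H1; case: (o).
  + by case: (o) => /=; rewrite pc2 pc1; lia.
  + by case: (o) => /=; rewrite eqxx v1' v2.
  + by case: (o).
  + move=> r Hr.
    have E : (r == RT t) = false by apply/eqP; apply: Hr.
    have {}Hr u : t < u -> r <> RT u by move=> tu; apply: Hr; lia.
    have {}R2 := R2 _ Hr.
    rewrite -R1 -?R2; first by case: (o) => /=; rewrite E.
    by move=> u tu; case: (ltngtP t u) tu => // [/Hr //|<- _]; apply/eqP; rewrite E.
Qed.

(** Counters of depth below [lv] belong to the enclosing loops; preserving them is what carries the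
    induction through [CFor]. *)
Definition simulates c := forall lv s m, represents s m -> safe n w K inp c s ->
  code_at P (pc m) (cc K c lv (pc m)) ->
  exists t m', [/\ t <= cost n c, steps m t m', pc m' = pc m + clen c,
    represents (exec n inp c s) m' & forall u, u < lv -> wreg m' (Hd u) = wreg m (Hd u)].

Lemma loop_step c x lg lv s m start v : simulates c ->
  code_at P start (cc K (CFor lg x c) lv start) -> represents s m ->
  pc m = start.+1 -> wreg m (Hd lv) = v -> v < n -> safe n w K inp c (wset s x v) ->
  exists t m', [/\ t <= cost n c + 6, steps m t m', pc m' = start.+1,
    wreg m' (Hd lv) = (if lg then v.*2 else v.+1) /\
    represents (exec n inp c (wset s x v)) m' &
    forall u, u < lv -> wreg m' (Hd u) = wreg m (Hd u)].
Proof.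
move=> sim /code_at_cat[/code_at_cons[_]].
move=> /code_at_cons[H1 /code_at_cons[H2 /code_at_cons[H3 _]]] /code_at_cat[cb].
rewrite size_cc => /code_at_cons[E1 /code_at_cons[E2 /code_at_cons[E3 _]]].
move=> Hrel pcm hv vn sc.
pose m1 := State (start + 4) [eta [eta wreg m with Tm 0 |-> 0 %% W] with VR x |-> v]
   (wmem m) (rreg m) (rmem m).
have st1 : steps m 3 m1.
  apply: steps_cons.
    move=> r; rewrite /step /fetch pcm H1; case: Hrel => -> _ _ _ _.
    by rewrite hv leqNgt vn.
  step_by H2.
  apply: steps_cons; last exact: steps0.
  move=> r; rewrite /step /fetch /= H3 /m1 addn4 /set_wreg /=.
  rewrite ifN; last by apply/eqP; rewrite /Hd /Tm; lia.
  by rewrite hv mod0n addn0 modn_small //; lia.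
have Hrel1 : represents (wset s x v) m1.
  case: Hrel => h1 h2 h3 h4 h5; split=> //=; first (by rewrite /VR addn2 /Tm ?addn1); move=> y.
  case: eqP => [/VR_inj -> //|ne]; first by rewrite eqxx.
  rewrite ifN; last by apply/eqP; rewrite /VR /Tm; lia.
  by case: eqP ne => // ->.
have [t [m2 [le_t st2 pc2 rel2 hd2]]] := sim lv.+1 _ m1 Hrel1 sc cb.
rewrite /= in E1 pc2; rewrite -pc2 in E1 E2 E3.
have hv2 : wreg m2 (Hd lv) = v.
  rewrite hd2 //= ifN; last by apply/eqP; rewrite /VR /Hd; lia.
  by rewrite ifN //; apply/eqP; rewrite /Tm /Hd; lia.
exists (3 + (t + 3)); eexists; split.
- by rewrite addnCA leq_add.
- apply: (steps_trans st1); apply: (steps_trans st2).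
  apply: steps_cons; first by move=> r; rewrite /step /fetch E1.
  apply: steps_cons; first by move=> r; rewrite /step /fetch /= E2.
  apply: steps_cons; last exact: steps0.
  by move=> r; rewrite /step /fetch /= E3.
- by [].
- have F : (Hd lv == Tm 0) = false by apply/eqP; rewrite /Tm /Hd; lia.
  split.
    rewrite /= eqxx F hv2; case: (lg); rewrite ?F ?eqxx ?hv2.
      (* The doubled counter stays below [2 * n], so by [nW] it does not wrap. *)
      by rewrite modn_small; lia.
    by rewrite (modn_small W1) modn_small; lia.
  case: rel2 => h1 h2 h3 h4 h5; split=> //=; first (by rewrite /Hd addn3 /Tm ?addn1); move=> y.
  rewrite ifN; last by apply/eqP; rewrite /VR /Hd; lia.
  by rewrite ifN //; apply/eqP; rewrite /VR /Tm; lia.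
- move=> u ulv /=; rewrite ifN; last by apply/eqP; rewrite /Hd; lia.
  rewrite ifN; last by apply/eqP; rewrite /Tm /Hd; lia.
  rewrite hd2 /=; last by lia.
  rewrite ifN; last by apply/eqP; rewrite /VR /Hd; lia.
  by rewrite ifN //; apply/eqP; rewrite /Tm /Hd; lia.
Qed.

Lemma simulates_for c x lg : simulates c -> simulates (CFor lg x c).
Proof.
move=> sim lv s m Hrel /= sf cP.
have [H0 [H1 _]] : nth Halt P (pc m) = WConst (Hd lv) lg /\
   nth Halt P (pc m).+1 = JmpWLe 0 (Hd lv) (pc m + (clen c + 7)) /\ True.
  by move: cP => /code_at_cons[-> /code_at_cons[-> _]].
pose val i := if lg then 2 ^ i else i.
pose cnt := size (loop_range n lg).
have rangeE : loop_range n lg = [seq val i | i <- iota 0 cnt].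
  rewrite /loop_range /cnt /loop_range /val; case: (lg); first by rewrite size_map size_iota.
  by rewrite size_iota map_id.
have val_lt i : i < cnt -> val i < n.
  rewrite /cnt /loop_range /val; case: (lg); rewrite ?size_map size_iota // => ilt.
  rewrite ltnNge; apply/negP => /(up_log_min (isT : 1 < 2)); lia.
have val_end : n <= val cnt.
  rewrite /cnt /loop_range /val; case: (lg); rewrite ?size_map size_iota //.
  exact: up_logP.
have valS i : val i.+1 = if lg then (val i).*2 else (val i).+1.
  by rewrite /val; case: (lg); rewrite // expnS mul2n.
rewrite {}rangeE in sf *.
(* Induction on the number [k] of remaining rounds; the final 1 pays for the exit test. *)
have main : forall k i s m', i + k = cnt -> represents s m' -> pc m' = (pc m).+1 ->
   wreg m' (Hd lv) = val i ->
   loop_safe (fun i s => safe n w K inp c (wset s x i))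
     (fun i s => exec n inp c (wset s x i)) [seq val i | i <- iota i k] s ->
   exists t m'', [/\ t <= k * (cost n c + 6) + 1, steps m' t m'', pc m'' = pc m + (clen c + 7),
     represents (foldl (fun s i => exec n inp c (wset s x i)) s [seq val i | i <- iota i k]) m'' &
     forall u, u < lv -> wreg m'' (Hd u) = wreg m' (Hd u)].
  elim=> [|k IH] i s' m' Hik Hrel' pcm' hv /=.
    move=> _; exists 1, (goto m' (pc m + (clen c + 7))); split=> //.
    apply: steps_cons; last exact: steps0.
    move=> r; rewrite /step /fetch pcm' H1 hv; case: Hrel' => -> _ _ _ _.
    by rewrite -[i]addn0 Hik val_end.
  case=> sc sl.
  have [|t1 [m1 [le_t1 st1 pc1 [hd1 rel1] H1']]] :=
    @loop_step c x lg lv s' m' (pc m) (val i) sim cP Hrel' pcm' hv _ sc.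
    by apply: val_lt; lia.
  rewrite -valS in hd1.
  have [|t2 [m2 [le_t2 st2 pc2 rel2 H2']]] := IH i.+1 _ m1 _ rel1 pc1 hd1 sl.
    by lia.
  exists (t1 + t2), m2; split=> //.
  - rewrite mulSn -addnA; exact: leq_add.
  - exact: steps_trans st1 st2.
  - by move=> u ulv; rewrite H2' // H1'.
pose m0 := set_wreg w m (Hd lv) lg.
have rel0 : represents s m0.
  case: Hrel => h1 h2 h3 h4 h5; split=> //=; first (by rewrite /Hd addn3); move=> y.
  by rewrite ifN //; apply/eqP; rewrite /VR /Hd; lia.
have [|t [m' [le_t st pc' represents' H']]] := main cnt 0 s m0 erefl rel0 erefl _ sf.
  rewrite /= eqxx /val; case: (lg) => /=; first by rewrite modn_small.
  by rewrite mod0n.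
exists t.+1, m'; split=> //.
- by move: le_t; rewrite size_map size_iota addn1 addn2 ltnS.
- by apply: (steps_cons _ st) => r; rewrite /step /fetch H0.
- move=> u ulv; rewrite H' //= ifN //; apply/eqP; rewrite /Hd; lia.
Qed.

Lemma branch_sound a b (t : bool) lv s m : simulates a -> simulates b -> represents s m ->
  (if t then safe n w K inp a s else safe n w K inp b s) ->
  let p := (pc m).+1 in let q := p + clen b in
  (forall r : 'I_W, step P m r = goto m (if t then q.+1 else p)) ->
  code_at P p (cc K b lv p) -> nth Halt P q = Jmp (q.+1 + clen a) -> code_at P q.+1 (cc K a lv q.+1) ->
  exists u m', [/\ u <= cost n a + cost n b + 2, steps m u m', pc m' = q.+1 + clen a,
    represents (if t then exec n inp a s else exec n inp b s) m'
    & forall v, v < lv -> wreg m' (Hd v) = wreg m (Hd v)].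
Proof.
move=> IHa IHb Hrel sc p q; case: t sc => sc st cb H2 ca.
  have rel3 : represents s (goto m q.+1) by case: Hrel; split.
  have [u [m4 [le4 st4 pc4 rel4 hd4]]] := IHa lv s _ rel3 sc ca.
  by exists u.+1, m4; split=> //; [lia | exact: steps_cons st st4].
have rel3 : represents s (goto m p) by case: Hrel; split.
have [u [m4 [le4 st4 pc4 [h1 h2 h3 h4 h5] hd4]]] := IHb lv s _ rel3 sc cb.
exists (u + 1).+1, (goto m4 (q.+1 + clen a)); split=> //; first by lia.
apply: (steps_cons st); apply: (steps_trans st4); apply: steps_cons; last exact: steps0.
by move=> r; rewrite /step /fetch pc4 /= H2.
Qed.

Theorem compile_sound c : simulates c.
Proof.
elim: c => [|x e|id a e|x e|a IHa b IHb|e1 e2 a IHa b IHb|e1 e2 a IHa b IHb|lg x a IHa] lv s m.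
- by move=> Hrel _ _; exists 0, m; split=> //; [exact: steps0 | rewrite addn0].
- move=> Hrel /= se /code_at_cat[ce /code_at_cons[H1 /code_at_cons[H2 _]]].
  have [m1 [st1 pc1 v1 T1 R1]] := cw_sound Hrel se ce.
  rewrite size_cw -pc1 in H1 H2.
  have rel1 : represents s m1 by apply: (rel_temps Hrel T1); rewrite R1.
  have eW : weval n s e < W by exact: wsafe_lt se.
  exists (wlen e + 2); eexists; split; first by [].
  + apply: (steps_trans st1).
    step_by H1.
    by step_by H2; exact: steps0.
  + by rewrite /= pc1; lia.
  + case: rel1 => h1 h2 h3 h4 h5; split=> //=; first (by rewrite /VR addn2 /Tm ?addn1); move=> y.
    rewrite v1 mod0n addn0 modn_small //; case: eqP => [/VR_inj -> |ne]; first by rewrite eqxx.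
    rewrite ifN; last by apply/eqP; rewrite /VR /Tm; lia.
    by case: eqP ne => // ->.
  + move=> u _ /=; rewrite ifN; last by apply/eqP; rewrite /VR /Hd; lia.
    rewrite ifN; last by apply/eqP; rewrite /Tm /Hd; lia.
    by case: T1 => -> // v _; rewrite /Tm /Hd; lia.
- move=> Hrel /= /and4P[sa se idK aW] /code_at_cat[ca /code_at_cat[ce]].
  move=> /code_at_cons[H1 /code_at_cons[H2 /code_at_cons[H3 /code_at_cons[H4 /code_at_cons[H5 _]]]]].
  have [m1 [st1 pc1 v1 T1 R1]] := cw_sound Hrel sa ca.
  have rel1 : represents s m1 by apply: (rel_temps Hrel T1); rewrite R1.
  rewrite size_cw -pc1 in ce H1 H2 H3 H4 H5.
  have [m2 [st2 pc2 v2 T2 R2]] := cw_sound rel1 se ce.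
  have rel2 : represents s m2 by apply: (rel_temps rel1 T2); rewrite R2.
  rewrite size_cw -pc2 in H1 H2 H3 H4 H5.
  have v1' : wreg m2 (Tm 0) = weval n s a.
    by rewrite -v1; case: T2 => -> // u; rewrite /Tm; lia.
  have E01 : (Tm 0 == Tm 2) = false by apply/eqP; rewrite /Tm; lia.
  have eW : weval n s e < W by exact: wsafe_lt se.
  exists (wlen a + (wlen e + 5)); eexists; split.
  + by rewrite addnA.
  + apply: (steps_trans st1); apply: (steps_trans st2).
    step_by H1.
    step_by H2.
    step_by H3.
    step_by H4.
    by step_by H5; exact: steps0.
  + by rewrite /= pc2 pc1; lia.
  + have idW : id < W by lia.
    have aKW : weval n s a * K < W by lia.
    case: rel2 => h1 h2 h3 h4 h5; split=> //=.
      move=> x; rewrite !ifN //; apply/eqP; rewrite /VR /Tm; lia.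
    move=> id' a' idK' aW'.
    rewrite /= v1' v2 (modn_small KW) (modn_small aKW) (modn_small idW) (modn_small aW).
    (* Division by [K] with remainder recovers the cell and the array from an address. *)
    have -> : (a' * K + id' == weval n s a * K + id) = (id' == id) && (a' == weval n s a).
      apply/eqP/andP => [E|[/eqP -> /eqP -> //]].
      have := congr1 (modn^~ K) E; have := congr1 (divn^~ K) E.
      rewrite /= !modnMDl !divnMDl ?(modn_small idK) ?(modn_small idK') //; try lia.
      by rewrite !divn_small // !addn0 => -> ->; rewrite !eqxx.
    by case: ifP => // _; exact: h3.
  + move=> u _ /=; rewrite !ifN; try by apply/eqP; rewrite /Tm /Hd; lia.
    case: T2 => T2 _ _; rewrite T2; last by move=> v _; rewrite /Tm /Hd; lia.
    by case: T1 => -> // v _; rewrite /Tm /Hd; lia.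
- move=> Hrel /= se /code_at_cat[ce /code_at_cons[H1 /code_at_cons[H2 _]]].
  have [m1 [st1 pc1 v1 T1 R1]] := cr_sound Hrel se ce.
  have rel1 : represents s m1.
    by apply: (rel_temps Hrel T1) => y; apply: R1 => u _; rewrite /RVR /RT; lia.
  rewrite size_cr -pc1 in H1 H2.
  exists (rlen e + 2); eexists; split; first by [].
  + apply: (steps_trans st1).
    step_by H1.
    by step_by H2; exact: steps0.
  + by rewrite /= pc1; lia.
  + case: rel1 => h1 h2 h3 h4 h5; split=> //= y.
    rewrite v1 subrr addr0; case: eqP => [/RVR_inj -> |ne]; first by rewrite eqxx.
    rewrite ifN; last by apply/eqP; rewrite /RVR /RT; lia.
    by case: eqP ne => // ->.
  + by move=> u _ /=; case: T1 => -> // v _; rewrite /Tm /Hd; lia.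
- move=> Hrel /= [sa sb] /code_at_cat[ca]; rewrite size_cc => cb.
  have [t1 [m1 [le1 st1 pc1 rel1 hd1]]] := IHa lv s m Hrel sa ca.
  rewrite -pc1 in cb.
  have [t2 [m2 [le2 st2 pc2 rel2 hd2]]] := IHb lv _ m1 rel1 sb cb.
  exists (t1 + t2), m2; split=> //.
  + exact: leq_add.
  + exact: steps_trans st1 st2.
  + by rewrite pc2 pc1 addnA.
  + by move=> u ulv; rewrite hd2 // hd1.
- move=> Hrel /= [/andP[s1 s2] sc] /code_at_cat[c1 /code_at_cat[c2 /code_at_cons[H1]]].
  move=> /code_at_cat[cb /code_at_cons[H2 ca]].
  have [m1 [st1 pc1 v1 T1 R1]] := cw_sound Hrel s1 c1.
  have rel1 : represents s m1 by apply: (rel_temps Hrel T1); rewrite R1.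
  rewrite !size_cw -pc1 in c2 H1 H2 ca cb.
  have [m2 [st2 pc2 v2 T2 R2]] := cw_sound rel1 s2 c2.
  have rel2 : represents s m2 by apply: (rel_temps rel1 T2); rewrite R2.
  have v1' : wreg m2 (Tm 0) = weval n s e1.
    by rewrite -v1; case: T2 => -> // u; rewrite /Tm; lia.
  rewrite !addnA -pc1 -pc2 in H1 H2 ca cb.
  have hd2 u : wreg m2 (Hd u) = wreg m (Hd u).
    case: T2 => T2 _ _; rewrite T2; last by move=> v _; rewrite /Tm /Hd; lia.
    by case: T1 => -> // v _; rewrite /Tm /Hd; lia.
  rewrite size_cc in H2 ca.
  have [u [m4 [le4 st4 pc4 rel4 hd4]]] := branch_sound IHa IHb rel2 sc
    (fun r => ltac:(by rewrite /step /fetch H1 v1' v2)) cb H2 ca.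
  exists (wlen e1 + (wlen e2 + u)), m4; split.
  + lia.
  + by apply: (steps_trans st1); apply: (steps_trans st2).
  + by rewrite pc4 /= pc2 pc1; lia.
  + by case: ifP rel4.
  + by move=> v vlv; rewrite hd4 // hd2.
- move=> Hrel /= [/andP[s1 s2] sc] /code_at_cat[c1 /code_at_cat[c2 /code_at_cons[H1]]].
  move=> /code_at_cat[cb /code_at_cons[H2 ca]].
  have [m1 [st1 pc1 v1 T1 R1]] := cr_sound Hrel s1 c1.
  have rel1 : represents s m1.
    by apply: (rel_temps Hrel T1) => y; apply: R1 => u _; rewrite /RVR /RT; lia.
  rewrite !size_cr -pc1 in c2 H1 H2 ca cb.
  have [m2 [st2 pc2 v2 T2 R2]] := cr_sound rel1 s2 c2.
  have rel2 : represents s m2.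
    by apply: (rel_temps rel1 T2) => y; apply: R2 => u _; rewrite /RVR /RT; lia.
  have v1' : rreg m2 (RT 0) = reval n inp s e1.
    by rewrite -v1; apply: R2 => u; rewrite /RT; lia.
  rewrite !addnA -pc1 -pc2 in H1 H2 ca cb.
  have hd2 u : wreg m2 (Hd u) = wreg m (Hd u).
    case: T2 => T2 _ _; rewrite T2; last by move=> v _; rewrite /Tm /Hd; lia.
    by case: T1 => -> // v _; rewrite /Tm /Hd; lia.
  rewrite size_cc in H2 ca.
  have [u [m4 [le4 st4 pc4 rel4 hd4]]] := branch_sound IHa IHb rel2 sc
    (fun r => ltac:(by rewrite /step /fetch H1 v1' v2)) cb H2 ca.
  exists (rlen e1 + (rlen e2 + u)), m4; split.
  + lia.
  + by apply: (steps_trans st1); apply: (steps_trans st2).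
  + by rewrite pc4 /= pc2 pc1; lia.
  + by case: ifP rel4.
  + by move=> v vlv; rewrite hd4 // hd2.
- exact: simulates_for.
Qed.

End Simulation.

Local Open Scope ring_scope.

(** * The l1 norm *)

Section L1.
Variables (R : realType) (d : nat).
Implicit Types x y : 'rV[R]_d.

Definition l1 x : R := \sum_c `|x 0 c|.

Lemma l1_ge0 x : 0 <= l1 x.
Proof. by apply: sumr_ge0. Qed.

Lemma l1D x y : l1 (x + y) <= l1 x + l1 y.
Proof.
by rewrite /l1 -big_split; apply: ler_sum => c _ /=; rewrite mxE ler_normD.
Qed.

Lemma l1Z a x : l1 (a *: x) = `|a| * l1 x.
Proof. by rewrite /l1 mulr_sumr; apply: eq_bigr => c _; rewrite mxE normrM. Qed.

Lemma l1_0 : l1 0 = 0.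
Proof. by rewrite /l1 big1 // => c _; rewrite mxE normr0. Qed.

Lemma l1_sum (I : finType) (P : pred I) (F : I -> 'rV[R]_d) :
  l1 (\sum_(i | P i) F i) <= \sum_(i | P i) l1 (F i).
Proof.
apply: (big_ind2 (fun x r => l1 x <= r)) => // [|x r y s hx hy].
  by rewrite l1_0.
exact: le_trans (l1D _ _) (lerD hx hy).
Qed.
End L1.

(** * The coordinate system attached to a family of points and axes *)

Section Pair.
Variables (R : realType) (D' : nat).
Notation D := D'.+1.
Variables (pt : nat -> 'rV[R]_D) (Y : 'rV[R]_D).
Variables (np : nat) (f : 'I_D -> 'I_D) (e : 'I_D -> bool) (pi : nat -> nat).

Definition basis : 'M[R]_D := \matrix_(i, c)
  if (i < np)%N then pt (pi i) 0 c - Y 0 c else (-1) ^+ e i * (c == f i)%:R.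

Definition basis_with i0 z : 'M[R]_D := \matrix_(i, c)
  if i == i0 then pt z 0 c - Y 0 c else basis i c.

(* By Cramer's rule, the [i]-th coordinate of [pt z - Y] in the row basis
   [basis], and 0 if that matrix is singular. *)
Definition coo i z : R := \det (basis_with i z) / \det basis.

Definition key i z : R := coo i z / coo ord_max z.

Definition ksum z : R := \sum_(i < D | (np <= i)%N && (i != ord_max)) key i z.

(** The bound for the distance of [cand p q] to [Y], with the factor [- coo ord_max q / mass p q]
    replaced by 1. What remains depends on [q] only through [ksum q]. *)
Definition est p q : R := coo ord_max p * (ksum q - ksum p).

(** Minus the [i]-th coordinate of [coo ord_max p *: (pt q - Y) - coo ord_max q *: (pt p - Y)], a
    vector whose last coordinate is 0. Adding [wt p q i] times row [i] cancels that coordinate. *)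
Definition wt p q (i : 'I_D) : R :=
  coo ord_max q * coo i p - coo ord_max p * coo i q.

Definition mass p q : R :=
  coo ord_max p - coo ord_max q + \sum_(i < D | (i < np)%N) wt p q i.

Definition cand p q : 'rV[R]_D := (mass p q)^-1 *:
  (coo ord_max p *: pt q - coo ord_max q *: pt p +
   \sum_(i < D | (i < np)%N) wt p q i *: pt (pi i)).

(** Row [i] does not enter its own cofactors, so expansion along it produces an entry of the
    adjugate of [basis]. *)
Lemma coo_mul i z : \det basis != 0 -> coo i z = ((pt z - Y) *m invmx basis) 0 i.
Proof.
move=> nz; have Bu : basis \in unitmx by rewrite unitmxE unitfE.
rewrite /coo (expand_det_row _ i) /invmx Bu -scalemxAr mxE mulrC; congr (_ * _).
rewrite mxE; apply: eq_bigr => c _; rewrite !mxE eqxx; congr (_ * _).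
rewrite /cofactor; congr (_ * \det _); apply/matrixP => a b; rewrite !mxE.
by rewrite eq_sym (negbTE (neq_lift _ _)).
Qed.

Lemma coo_decomp z : \det basis != 0 ->
  pt z - Y = \sum_i coo i z *: row i basis.
Proof.
move=> nz; have Bu : basis \in unitmx by rewrite unitmxE unitfE.
rewrite -[LHS](mulmxKV Bu) mulmx_sum_row; apply: eq_bigr => i _.
by rewrite coo_mul.
Qed.

Lemma row_basis_axis (i : 'I_D) : (np <= i)%N -> l1 (row i basis) = 1.
Proof.
move=> npi; rewrite /l1 (bigD1 (f i)) //= big1 ?addr0 => [|c ne].
  by rewrite !mxE ltnNge npi /= eqxx mulr1 normr_sign.
by rewrite !mxE ltnNge npi /= (negbTE ne) mulr0 normr0.
Qed.

Lemma row_basis_pt (i : 'I_D) : (i < np)%N -> row i basis = pt (pi i) - Y.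
Proof. by move=> npi; apply/rowP => c; rewrite !mxE npi. Qed.

Section Candidate.
Variables (p q : nat).
Hypotheses (npD : (np <= D')%N) (pP : 0 < coo ord_max p) (qN : coo ord_max q < 0).
Hypothesis key_le : forall i, i != ord_max -> key i p <= key i q.

(** The sign test on [coo] also tests regularity: for a singular basis division by 0 makes every
    [coo] equal to 0, so such a frame offers no pair. *)
Lemma det_basis_neq0 : \det basis != 0.
Proof. by apply: contraTneq pP => h; rewrite /coo h invr0 mulr0 ltxx. Qed.

Lemma wtE i : wt p q i = (- coo ord_max q) * coo ord_max p * (key i q - key i p).
Proof. by rewrite /wt /key; field; rewrite (gt_eqF pP) (lt_eqF qN). Qed.

Lemma wt_ge0 i : i != ord_max -> 0 <= wt p q i.
Proof.
move=> im; rewrite wtE; apply: mulr_ge0; last by rewrite subr_ge0 key_le.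
by apply: mulr_ge0; rewrite ?oppr_ge0 ltW.
Qed.

Lemma pt_neq_max (i : 'I_D) : (i < np)%N -> i != ord_max.
Proof. by move=> inp; rewrite -val_eqE /= ltn_eqF // (leq_trans inp). Qed.

Lemma mass_gt : - coo ord_max q < mass p q.
Proof.
have S0 : 0 <= \sum_(i < D | (i < np)%N) wt p q i.
  by apply: sumr_ge0 => i /pt_neq_max; apply: wt_ge0.
by rewrite /mass; move: pP S0; lra.
Qed.

Lemma mass_gt0 : 0 < mass p q.
Proof. by apply: lt_trans mass_gt; rewrite oppr_gt0. Qed.

(** After the cancellation only the axes other than the last carry a deviation, [- wt p q i] each,
    and these add up in absolute value to [- coo ord_max q] times [est p q]. Normalization divides
    by [mass p q], which exceeds [- coo ord_max q]. *)
Lemma cand_l1 : l1 (cand p q - Y) <= est p q.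
Proof.
have nz := det_basis_neq0; have M0 := mass_gt0.
have -> : cand p q - Y = (mass p q)^-1 *:
    \sum_(i < D | (np <= i)%N && (i != ord_max)) - wt p q i *: row i basis.
  rewrite /cand; apply: (scalerI (lt0r_neq0 M0)); rewrite scalerBr !scalerA.
  rewrite mulfV ?lt0r_neq0 // !scale1r.
  (* [Y] can be moved inside because the weights add up to [mass p q]. *)
  have <- : coo ord_max p *: (pt q - Y) - coo ord_max q *: (pt p - Y) +
      \sum_(i < D | (i < np)%N) wt p q i *: row i basis =
      coo ord_max p *: pt q - coo ord_max q *: pt p +
      \sum_(i < D | (i < np)%N) wt p q i *: pt (pi i) - mass p q *: Y.
    rewrite [X in _ + X = _](eq_bigr (fun i : 'I_D => wt p q i *: pt (pi i) - wt p q i *: Y)).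
      rewrite sumrB -scaler_suml /mass; apply/rowP => c; rewrite !mxE; ring.
    by move=> i ip; rewrite row_basis_pt // scalerBr.
  rewrite !coo_decomp // !scaler_sumr -sumrB.
  rewrite (eq_bigr (fun i : 'I_D => - wt p q i *: row i basis)); last first.
    by move=> i _; rewrite !scalerA -scalerBl /wt opprB.
  rewrite (bigID (fun i : 'I_D => (i < np)%N)) /= addrAC -big_split /=.
  rewrite big1 ?add0r => [|i _]; last by rewrite scaleNr addNr.
  rewrite (bigD1 ord_max) -?leqNgt //= /wt mulrC subrr oppr0 scale0r add0r.
  by apply: eq_bigl => i; rewrite -leqNgt.
rewrite l1Z ger0_norm ?invr_ge0 ?(ltW M0) // ler_pdivrMl //.
apply: le_trans (l1_sum _ _) _.
rewrite (eq_bigr (fun i => (- coo ord_max q) * coo ord_max p * (key i q - key i p))); last first.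
  move=> i /andP[npi im]; rewrite l1Z row_basis_axis // mulr1 normrN -wtE.
  by rewrite ger0_norm ?wt_ge0.
rewrite -mulr_sumr sumrB -/(ksum q) -/(ksum p) -mulrA -/(est p q).
apply: ler_wpM2r; last exact: ltW mass_gt.
rewrite mulr_ge0 ?(ltW pP) // subr_ge0.
by apply: ler_sum => i /andP[_]; exact: key_le.
Qed.

End Candidate.
End Pair.

(** * Basic solutions *)

Section Reduction.
Variables (R : realType) (k d : nat) (v : 'I_k -> 'rV[R]_d).
Implicit Types l m : 'I_k -> R.

Definition comb l : 'rV[R]_d := \sum_i l i *: v i.

(** A vertex condition. The hyperplanes on which a coordinate of [comb l] vanishes subdivide the
    simplex, and the cell with [l] in its relative interior is a single point. *)
Definition rigid l := forall m, (forall i, l i = 0 -> m i = 0) ->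
  (forall c, comb l 0 c = 0 -> comb m 0 c = 0) -> \sum_i m i = 0 ->
  forall i, m i = 0.

Lemma combD l m t : comb (fun i => l i + t * m i) = comb l + t *: comb m.
Proof.
rewrite /comb scaler_sumr -big_split /=.
by apply: eq_bigr => i _; rewrite scalerDl scalerA.
Qed.

(** As in the simplex method, the smallest ratio [a x / - b x] is the time at which the first new
    zero appears. *)
Lemma ratio_test (T : finType) (a b : T -> R) : (forall x, 0 <= a x) ->
  (forall x, a x = 0 -> b x = 0) -> (exists x, b x < 0) ->
  exists2 t, 0 <= t & (forall x, 0 <= a x + t * b x) /\
    exists2 x, a x != 0 & a x + t * b x = 0.
Proof.
move=> a0 ab [x0 bx0].
case: (@arg_minP _ _ _ x0 (fun x => b x < 0) (fun x => a x / - b x)) => // x bx min.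
have bx' : 0 < - b x by rewrite oppr_gt0.
exists (a x / - b x); first by rewrite divr_ge0 // ltW.
split=> [y|].
  have [by0|by0] := leP 0 (b y); first by rewrite addr_ge0 // mulr_ge0 // divr_ge0 // ltW.
  have := min y by0; rewrite ler_pdivlMr ?oppr_gt0 // => h; move: h; rewrite mulrN; lra.
exists x; first by apply: contraTneq bx => /ab ->; rewrite ltxx.
by field; rewrite (lt_eqF bx).
Qed.

(* Moving along a direction that keeps all the zeros creates a new zero before
   the norm increases. *)
Lemma exists_rigid l : (forall i, 0 <= l i) -> \sum_i l i = 1 ->
  exists l', [/\ forall i, 0 <= l' i, \sum_i l' i = 1,
    l1 (comb l') <= l1 (comb l) & rigid l'].
Proof.
(* The quantities whose zeros count; the induction is on the number of nonzero ones. *)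
pose al l (x : 'I_k + 'I_d) : R :=
  match x with inl i => l i | inr c => `|comb l 0 c| end.
have [N] := ubnP #|[set x | al l x != 0]|.
elim: N l => // N IH l; rewrite ltnS => leN l0 l1E.
have [rig|nrig] := boolp.pselect (rigid l); first by exists l.
have {nrig} [m [m1 m2 m3 [i0 mi0]]] : exists m, [/\ forall i, l i = 0 -> m i = 0,
   forall c, comb l 0 c = 0 -> comb m 0 c = 0, \sum_i m i = 0 & exists i, m i <> 0].
  apply: boolp.contrapT => H; apply: nrig => m m1 m2 m3 i; apply: boolp.contrapT => mi.
  by apply: H; exists m; split=> //; exists i.
(* The rate of change of the l1 norm along [m] until a coordinate changes sign; coordinates that are
   0 stay 0. Replacing [m] by its negative makes it nonpositive. *)
pose slope m := \sum_c Num.sg (comb l 0 c) * comb m 0 c.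
wlog sl : m m1 m2 m3 mi0 / slope m <= 0.
  move=> W; have [|sl] := leP (slope m) 0; first exact: W.
  have cN : comb (fun i => - m i) = - comb m.
    by rewrite /comb -sumrN; apply: eq_bigr => i _; rewrite scaleNr.
  apply: (W (fun i => - m i)).
  - by move=> i /m1 ->; rewrite oppr0.
  - by move=> c /m2; rewrite cN mxE => ->; rewrite oppr0.
  - by rewrite sumrN m3 oppr0.
  - by move/eqP; rewrite oppr_eq0 => /eqP.
  - rewrite /slope (eq_bigr (fun c => - (Num.sg (comb l 0 c) * comb m 0 c))).
      by rewrite sumrN oppr_le0 ltW.
    by move=> c _; rewrite cN mxE mulrN.
pose be (x : 'I_k + 'I_d) : R :=
  match x with inl i => m i | inr c => Num.sg (comb l 0 c) * comb m 0 c end.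
have [t t0 [tpos [x0 ax0 bx0]]] : exists2 t, 0 <= t &
   (forall x, 0 <= al l x + t * be x) /\ exists2 x, al l x != 0 & al l x + t * be x = 0.
  apply: ratio_test.
  - by case=> [i|c] /=.
  - case=> [i|c] /=; first exact: m1.
    by move/normr0_eq0 => ->; rewrite sgr0 mul0r.
  - apply: boolp.contrapT => H; apply: mi0.
    have mge0 i : 0 <= m i.
      by rewrite leNgt; apply/negP => h; apply: H; exists (inl i).
    have /eqP := m3; rewrite psumr_eq0 // => /allP /(_ i0).
    by rewrite mem_index_enum => /(_ isT) /eqP.
pose l' i := l i + t * m i.
(* Up to time [t] no coordinate has crossed 0, so its absolute value is still affine. *)
have alE x : al l' x = al l x + t * be x.
  case: x => [i|c] //=; rewrite combD mxE mxE.
  have := tpos (inr c); rewrite /=.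
  have [E|nz] := eqVneq (comb l 0 c) 0.
    by rewrite (m2 c E) E sgr0 mul0r mulr0 normr0 !addr0 normr0.
  move=> h; rewrite -[LHS]mul1r; have <- : `|Num.sg (comb l 0 c)| = 1.
    by rewrite normr_sg nz.
  by rewrite -normrM mulrDr -normrEsg mulrCA ger0_norm.
have lt : (#|[set x | al l' x != 0%R]| < N)%N.
  apply: leq_trans leN; apply: proper_card; apply/properP; split.
    apply/fintype.subsetP => x; rewrite !inE alE; apply: contra_neq => ax.
    rewrite ax add0r; suff -> : be x = 0 by rewrite mulr0.
    case: x ax => [i|c] /=; first exact: m1.
    by move/normr0_eq0 => ->; rewrite sgr0 mul0r.
  by exists x0; rewrite !inE // alE bx0 eqxx.
have [||l2 [H1 H2 H3 H4]] := IH l' lt.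
- by move=> i; have := tpos (inl i).
- by rewrite big_split /= -mulr_sumr m3 mulr0 addr0.
exists l2; split=> //; apply: (le_trans H3).
rewrite /l1 (eq_bigr (fun c => `|comb l 0 c| + t * (Num.sg (comb l 0 c) * comb m 0 c))).
  by rewrite big_split /= -mulr_sumr gerDl mulr_ge0_le0.
by move=> c _; have := alE (inr c).
Qed.
End Reduction.

Lemma pivot_index_lt a m i D' : (a + m.+1 = D'.+1)%N -> (m <= i)%N -> (i < D')%N ->
  (i - m < a)%N.
Proof. lia. Qed.

Lemma pivot_index_gt a m i D' : (a + m.+1 = D'.+1)%N -> (i < a)%N -> (m + i < D')%N.
Proof. lia. Qed.

Section Basic.
Variables (R : realType) (D' k : nat).
Notation D := D'.+1.
Variables (pt : nat -> 'rV[R]_D) (Y : 'rV[R]_D) (F : 'I_k -> nat).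
Notation v := (fun i : 'I_k => pt (F i) - Y).

(** [r] lists all points other than [p] and [q], of which only the first [np] enter the basis. The
    others fill up the choice of k points that the search loops over. *)
Definition basic_spec (l : 'I_k -> R) (p q : 'I_k) := exists np f e (r : seq 'I_k),
  let pi i := F (nth p r i) in
  [/\ perm_eq [:: p, q & r] (enum 'I_k), (np <= size r)%N /\ (np <= D')%N,
      0 < coo pt Y np f e pi ord_max (F p) /\ coo pt Y np f e pi ord_max (F q) < 0,
      forall i, i != ord_max -> key pt Y np f e pi i (F p) <= key pt Y np f e pi i (F q)
    & l p * est pt Y np f e pi (F p) (F q) <= l1 (comb v l)].

Section Support.
Variables (l : 'I_k -> R) (p q : 'I_k).
Hypotheses (l_ge0 : forall i, 0 <= l i) (l_sum : \sum_i l i = 1) (l_rigid : rigid v l).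
Hypotheses (p_max : forall i, l i <= l p) (lq : 0 < l q) (pq : q != p).

Let x := comb v l.
Let A := [set i | l i != 0].
Let P' := enum (A :\ p :\ q).
Let np := size P'.
Let n := np.+1.
(** Enumerates the support without [q]: at [ord_max] the list [P'] is exhausted and the default [p]
    is returned. *)
Let ix (a : 'I_n) := nth p P' a.

Let lp : 0 < l p. Proof. exact: lt_le_trans (p_max q). Qed.

Let ix_max : ix ord_max = p. Proof. by rewrite /ix nth_default. Qed.

Let ix_lt (a : 'I_n) : (a < np)%N -> ix a \in A :\ p :\ q.
Proof. by move=> h; rewrite -mem_enum mem_nth. Qed.

Let ix_inj : injective ix.
Proof.
have U : uniq (rcons P' p).
  by rewrite rcons_uniq enum_uniq mem_enum !inE eqxx /= andbF.
move=> a b; rewrite /ix => h; apply: val_inj; apply/eqP.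
suff : nth p (rcons P' p) a == nth p (rcons P' p) b.
  by rewrite nth_uniq ?size_rcons // ltn_ord.
rewrite !nth_rcons.
have E (c : 'I_n) : nth p P' c = if (c < size P')%N then nth p P' c
    else if c == size P' :> nat then p else p.
  by case: ltnP => // ge; rewrite nth_default //; case: ifP.
by rewrite -!E h.
Qed.

Let ix_supp i : i \in A :\ q -> exists a, ix a = i.
Proof.
rewrite !inE => /andP[iq li]; have [->|ip] := eqVneq i p; first by exists ord_max.
have iP : i \in P' by rewrite mem_enum !inE ip iq.
have h : (index i P' < n)%N by rewrite ltnS ltnW // index_mem.
by exists (Ordinal h); rewrite /ix nth_index.
Qed.

Let ix_in a : ix a \in A :\ q.
Proof.
have [h|h] := ltnP a np; first by have := ix_lt h; rewrite !inE => /and3P[-> _ ->].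
by rewrite /ix nth_default // !inE eq_sym pq lt0r_neq0.
Qed.

Let spread (u : 'rV[R]_n) i := \sum_a u 0 a * (ix a == i)%:R.

Let spread_ix u a : spread u (ix a) = u 0 a.
Proof.
rewrite /spread (bigD1 a) //= eqxx mulr1 big1 ?addr0 // => b ba.
by rewrite (inj_eq ix_inj) (negbTE ba) mulr0.
Qed.

Let spread0 u i : i \notin A :\ q -> spread u i = 0.
Proof.
move=> h; apply: big1 => a _; case: eqP h => [<-|_ _]; last by rewrite mulr0.
by rewrite ix_in.
Qed.

Let comb_spread u : comb v (spread u) = \sum_a u 0 a *: v (ix a).
Proof.
rewrite /comb (eq_bigr (fun i => \sum_a (u 0 a * (ix a == i)%:R) *: v i)).
  rewrite exchange_big; apply: eq_bigr => a _ /=.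
  rewrite (bigD1 (ix a)) //= eqxx mulr1 big1 ?addr0 // => i ne.
  by rewrite eq_sym (negbTE ne) mulr0 scale0r.
by move=> i _; rewrite scaler_suml.
Qed.

Let spreadK (m : 'I_k -> R) : (forall i, i \notin A :\ q -> m i = 0) ->
  comb v m = \sum_a m (ix a) *: v (ix a).
Proof.
move=> m0; have E i : m i = spread (\row_a m (ix a)) i.
  have [/ix_supp[a <-]|ni] := boolP (i \in A :\ q); first by rewrite spread_ix mxE.
  by rewrite spread0 ?m0.
transitivity (comb v (spread (\row_a m (ix a)))).
  by apply: eq_bigr => i _; rewrite E.
by rewrite comb_spread; apply: eq_bigr => a _; rewrite mxE.
Qed.

(** Linear independence of the support vectors without [v q], modulo the axes in [K]. *)
Let indep (K : {set 'I_D}) := forall m : 'I_k -> R, (forall i, i \notin A :\ q -> m i = 0) ->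
  (forall c, c \notin K -> comb v m 0 c = 0) -> forall i, m i = 0.

(** Subtracting [\sum_j m j] times [l] turns [m] into a direction of sum 0 that keeps all zeros, so
    rigidity annihilates it. At [q], where [m] vanishes and [l] does not, this forces the sum of [m]
    to be 0. Omitting [q] thus takes the place of the affine constraint. *)
Let indep_supp : indep [set c | x 0 c != 0].
Proof.
move=> m m0 mx.
have E : forall i, m i - (\sum_j m j) * l i = 0.
  apply: l_rigid.
  - move=> i li; rewrite li mulr0 subr0 m0 // !inE li eqxx andbF //.
  - move=> c xc; rewrite /comb (eq_bigr (fun i => m i *: v i - (\sum_j m j) *: (l i *: v i))).
      rewrite sumrB -scaler_sumr !mxE -/(comb v m) -/(comb v l) xc mulr0 subr0.
      by apply: mx; rewrite inE /x xc eqxx.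
    by move=> i _; rewrite scalerBl scalerA.
  - by rewrite sumrB -mulr_sumr l_sum mulr1 subrr.
have S0 : \sum_j m j = 0.
  have := E q; rewrite m0 ?inE ?eqxx // sub0r => /eqP.
  by rewrite oppr_eq0 mulf_eq0 (gt_eqF lq) orbF => /eqP.
by move=> i; have := E i; rewrite S0 mul0r subr0.
Qed.

Section Frame.
Variable K : {set 'I_D}.
Hypotheses (K_supp : [set c | x 0 c != 0] \subset K) (K_indep : indep K).
Hypothesis K_max : forall c, c \notin K -> ~ indep (c |: K).

Let N : 'M[R]_(n, #|~: K|) := \matrix_(a, b) v (ix a) 0 (enum_val b).

Let mul_N (u : 'rV[R]_n) b : (u *m N) 0 b = comb v (spread u) 0 (enum_val b).
Proof.
rewrite comb_spread summxE mxE; apply: eq_bigr => a _.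
by rewrite [RHS]mxE [N a b]mxE.
Qed.

Let N_free : row_free N.
Proof.
apply: inj_row_free => u uN; apply/rowP => a; rewrite mxE -spread_ix.
apply: K_indep => [i|c cK]; first exact: spread0.
have cK' : c \in ~: K by rewrite inE.
by rewrite -(enum_rankK_in cK' cK') -mul_N uN mxE.
Qed.

(** By maximality, adding a coordinate [c] to [K] admits a nonzero combination that vanishes outside
    [c |: K], and independence modulo [K] makes its value at [c] nonzero. Scaled, it puts a unit
    vector into the row space. *)
Let N_full : row_full N.
Proof.
rewrite -sub1mx; apply/row_subP => b; rewrite row1.
have cK : enum_val b \notin K by have := enum_valP b; rewrite inE.
have [m [m0 mc [i mi]]] : exists m : 'I_k -> R, [/\ forall i, i \notin A :\ q -> m i = 0,
    forall c, c \notin enum_val b |: K -> comb v m 0 c = 0 & exists i, m i <> 0].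
  apply: boolp.contrapT => H; apply: (K_max cK) => m m0 mc i; apply: boolp.contrapT => mi.
  by apply: H; exists m; split=> //; exists i.
have nz : comb v m 0 (enum_val b) != 0.
  apply/eqP => z; apply: mi; apply: K_indep => // c ncK.
  have [->//|ne] := eqVneq c (enum_val b).
  by apply: mc; rewrite !inE negb_or ne.
apply/submxP; exists (\row_a (m (ix a) / comb v m 0 (enum_val b))).
apply/rowP => b'; rewrite mul_N comb_spread.
rewrite (eq_bigr (fun a => (comb v m 0 (enum_val b))^-1 *: (m (ix a) *: v (ix a)))).
  rewrite -scaler_sumr -spreadK // mxE !mxE eqxx /=.
  have [->|ne] := eqVneq b' b; first by rewrite mulVf.
  have -> : comb v m 0 (enum_val b') = 0.
    apply: mc; rewrite !inE negb_or (inj_eq enum_val_inj) ne /=.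
    by have := enum_valP b'; rewrite inE.
  by rewrite mulr0.
by move=> a _; rewrite mxE mulrC scalerA.
Qed.

(** [N] is square and invertible: the support vectors without [v q] and the axes in [K] together
    form a basis of the space. *)
Let card_K : (#|K| + n = D)%N.
Proof.
have <- : #|~: K| = n.
  have /eqP <- := N_free; by apply/esym/eqP; exact: N_full.
by rewrite cardsC card_ord.
Qed.

Let np_le : (np <= D')%N. Proof. by move: card_K; rewrite addnS => -[<-]; exact: leq_addl. Qed.

(** An exchange step: some axis outside [K] can replace [v p] in that basis, namely one with a
    nonzero entry in the column of the inverse of [N] that belongs to [p]. *)
Let exists_pivot : exists b, pinvmx N b ord_max != 0.
Proof.
apply: boolp.contrapT => H.
have := congr1 (fun M : 'M[R]_n => M ord_max ord_max) (mulmxVp N_free).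
rewrite mxE big1 => [|b _]; first by rewrite mxE eqxx => /eqP; rewrite eq_sym oner_eq0.
have [->|nz] := eqVneq (pinvmx N b ord_max) 0; first by rewrite mulr0.
by case: H; exists b.
Qed.

Section Pivot.
Variable b : 'I_#|~: K|.
Hypothesis b_pivot : pinvmx N b ord_max != 0.

Let cm := enum_val b.
Let f (i : 'I_D) := if i == ord_max then cm else nth cm (enum K) (i - np).
(** The last sign makes the pivot coordinate of [p] positive. The others turn each axis of [K]
    against [x], whose coordinates there become minus their absolute values; this is what orders the
    keys. *)
Let e (i : 'I_D) := if i == ord_max then pinvmx N b ord_max < 0 else 0 < x 0 (f i).
Let r := P' ++ enum (~: A).
Let pi i := F (nth p r i).
Local Notation B := (basis pt Y np f e pi).

Let cmK : cm \notin K. Proof. by have := enum_valP b; rewrite inE. Qed.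

Let lt_max (i : 'I_D) : i != ord_max -> (i < D')%N.
Proof. by rewrite -val_eqE /= => ne; have := ltn_ord i; rewrite ltnS leq_eqVlt (negbTE ne). Qed.

Let fK (i : 'I_D) : (np <= i)%N -> i != ord_max -> f i \in K.
Proof.
move=> npi im; rewrite /f (negbTE im) -mem_enum mem_nth // -cardE.
exact: pivot_index_lt card_K npi (lt_max im).
Qed.

Let f_inj (i j : 'I_D) : (np <= i)%N -> (np <= j)%N -> f i = f j -> i = j.
Proof.
move=> npi npj; have [->|im] := eqVneq i ord_max; have [->|jm] := eqVneq j ord_max => //.
- by move=> h; move: cmK (fK npj jm); rewrite -h /f eqxx => /negbTE ->.
- by move=> h; move: cmK (fK npi im); rewrite h /f eqxx => /negbTE ->.
rewrite /f (negbTE im) (negbTE jm) => /eqP.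
rewrite nth_uniq ?enum_uniq // -?cardE; try exact: pivot_index_lt card_K _ (lt_max _).
by move=> /eqP h; apply: val_inj; rewrite /= -(subnK npi) -(subnK npj) h.
Qed.

Let row_lt (i : 'I_D) : (i < np)%N -> row i B = v (nth p P' i).
Proof. by move=> h; rewrite row_basis_pt // /pi nth_cat h. Qed.

Let row_ge (i : 'I_D) c : (np <= i)%N -> B i c = (-1) ^+ e i * (c == f i)%:R.
Proof. by move=> h; rewrite mxE ltnNge h. Qed.

Let low_sum (w : 'I_D -> R) (u : 'rV[R]_n) :
  (forall (i : 'I_D) (a : 'I_n), i = a :> nat -> (i < np)%N -> u 0 a = w i) ->
  \sum_(i < D | (i < np)%N) w i *: row i B + u 0 ord_max *: v p = comb v (spread u).
Proof.
move=> uw; rewrite comb_spread big_ord_recr /= ix_max; congr (_ + _).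
pose g i : 'rV[R]_D := w (inord i) *: v (nth p P' i).
rewrite (eq_bigr (fun i : 'I_D => g i)); last first.
  by move=> i h; rewrite row_lt // /g inord_val.
rewrite -(big_ord_widen D g); last exact: leqW np_le.
apply: eq_bigr => a _; rewrite /g; congr (_ *: _).
have aD : (a < D)%N by rewrite ltnS (leq_trans _ np_le) // ltnW.
by apply/esym/uw => /=; rewrite inordK.
Qed.

(** Outside [K] the combination is [t] times a unit vector, so its coefficients are read off the
    inverse of [N]. *)
Let pivot_row (u : 'rV[R]_n) t : (forall c, c \notin K -> comb v (spread u) 0 c = t * (c == cm)%:R) ->
  u = t *: row b (pinvmx N).
Proof.
move=> h; rewrite -[LHS]mulmx1 -(mulmxVp N_free) mulmxA rowE scalemxAl; congr (_ *m _).
apply/rowP => b'; rewrite mul_N h; last by have := enum_valP b'; rewrite inE.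
by rewrite !mxE eqxx /= (inj_eq enum_val_inj).
Qed.

Let basis_nz : \det B != 0.
Proof.
apply/negP => /det0P[w wn0 wB].
have wBc c : \sum_i w 0 i * B i c = 0.
  by have := congr1 (fun M : 'rV[R]_D => M 0 c) wB; rewrite !mxE.
pose u : 'rV[R]_n := \row_a if (a < np)%N then w 0 (inord a) else 0.
have uw (i : 'I_D) (a : 'I_n) : i = a :> nat -> (i < np)%N -> u 0 a = w 0 i.
  by move=> ia h; rewrite mxE -ia h inord_val.
have low c : c \notin K ->
   comb v (spread u) 0 c = - (w 0 ord_max * (-1) ^+ e ord_max) * (c == cm)%:R.
  move=> cK; rewrite -(low_sum uw) [u 0 ord_max]mxE /= ltnn scale0r addr0 summxE.
  have := wBc c; rewrite (bigID (fun i : 'I_D => (i < np)%N)) /= => /eqP.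
  rewrite addr_eq0 => /eqP => h.
  rewrite (eq_bigr (fun i : 'I_D => w 0 i * B i c)); last first.
    by move=> i _; rewrite 2!mxE.
  rewrite h mulNr; congr (- _).
  rewrite (bigD1 ord_max) -?leqNgt //= big1 => [|i /andP[h1 h2]].
    by rewrite row_ge // /f eqxx mulrA addr0.
  rewrite -leqNgt in h1; rewrite row_ge //.
  case: eqP => [ce|_]; last by rewrite !mulr0.
  by move: cK; rewrite ce fK.
have uE := pivot_row low.
have wm0 : w 0 ord_max = 0.
  have := congr1 (fun M : 'rV[R]_n => M 0 ord_max) uE.
  rewrite 2![in RHS]mxE [in LHS]mxE /= ltnn => /esym/eqP.
  rewrite mulf_eq0 (negbTE b_pivot) orbF oppr_eq0 mulf_eq0 signr_eq0 orbF => /eqP //.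
have u0 : u = 0 by rewrite uE wm0 mul0r oppr0 scale0r.
have wlow (i : 'I_D) : (i < np)%N -> w 0 i = 0.
  move=> h; have hn : (i < n)%N by rewrite ltnS ltnW.
  by rewrite -(uw i (Ordinal hn)) // u0 mxE.
case/negP: wn0; apply/eqP/rowP => i; rewrite mxE.
have [|npi] := ltnP i np; first exact: wlow.
have := wBc (f i); rewrite (bigD1 i) //= big1 ?addr0 => [|j ji].
  rewrite row_ge // eqxx mulr1 => /eqP; rewrite mulf_eq0 signr_eq0 orbF => /eqP //.
have [h|npj] := ltnP j np; first by rewrite wlow // mul0r.
rewrite row_ge //; case: eqP => [/f_inj h|]; last by rewrite !mulr0.
by rewrite h ?eqxx in ji.
Qed.

Local Notation co := (coo pt Y np f e pi).
Local Notation m := (@ord_max D').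

(** [v p] minus its components along the first points vanishes outside [K] except on the axis [cm].
    By [pivot_row] the weight 1 of [v p] is its last coordinate times the absolute value of the
    pivot. *)
Let pivot_pos : 0 < co m (F p).
Proof.
pose u : 'rV[R]_n := \row_a if (a < np)%N then - co (inord a) (F p) else 1.
have uw (i : 'I_D) (a : 'I_n) : i = a :> nat -> (i < np)%N -> u 0 a = - co i (F p).
  by move=> ia h; rewrite mxE -ia h inord_val.
have low c : c \notin K ->
   comb v (spread u) 0 c = (co m (F p) * (-1) ^+ e m) * (c == cm)%:R.
  move=> cK; rewrite -(low_sum uw) [u 0 ord_max]mxE /= ltnn scale1r.
  rewrite (coo_decomp _ basis_nz) [X in _ + X](bigID (fun i : 'I_D => (i < np)%N)) /=.
  rewrite addrA -big_split /= big1 ?add0r => [|i _]; last by rewrite scaleNr addNr.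
  rewrite summxE (bigD1 m) -?leqNgt //= big1 => [|i /andP[h1 h2]].
    by rewrite 2!mxE row_ge // /f eqxx mulrA addr0.
  rewrite -leqNgt in h1; rewrite 2!mxE row_ge //.
  case: eqP => [ce|_]; last by rewrite !mulr0.
  by move: cK; rewrite ce fK.
have := congr1 (fun M : 'rV[R]_n => M 0 ord_max) (pivot_row low).
rewrite 2![in RHS]mxE [in LHS]mxE /= ltnn => h.
have : co m (F p) * `|pinvmx N b ord_max| = 1.
  rewrite h -mulrA; congr (_ * _); rewrite /e eqxx.
  case: ltrP => h0; first by rewrite ltr0_norm // expr1 mulN1r.
  by rewrite ger0_norm // mul1r.
have pos : 0 < `|pinvmx N b ord_max| by rewrite normr_gt0.
by move=> E; rewrite -(pmulr_lgt0 _ pos) E.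
Qed.

(** [l p *: v p + l q *: v q] is [x] minus the contributions of the first points, and [x] lies in
    the span of the axes in [K]. *)
Let co_eq (i : 'I_D) : l p * co i (F p) + l q * co i (F q) =
  if (i < np)%N then - l (nth p P' i) else if i == m then 0 else - `|x 0 (f i)|.
Proof.
pose h := \row_i (if (i < np)%N then - l (nth p P' i) else if i == m then 0 else - `|x 0 (f i)|).
have Bu : B \in unitmx by rewrite unitmxE unitfE basis_nz.
suff E : (\row_i (l p * co i (F p) + l q * co i (F q))) *m B = h *m B.
  by have := congr1 (fun M : 'rV[R]_D => M 0 i) (can_inj (mulmxK Bu) E); rewrite !mxE.
have -> : (\row_i (l p * co i (F p) + l q * co i (F q))) *m B = l p *: v p + l q *: v q.
  rewrite (coo_decomp (F p) basis_nz) (coo_decomp (F q) basis_nz) !scaler_sumr -big_split.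
  by rewrite mulmx_sum_row; apply: eq_bigr => j _; rewrite mxE scalerDl !scalerA.
have xE : x = l p *: v p + l q *: v q + \sum_(i < D | (i < np)%N) l (nth p P' i) *: row i B.
  rewrite {1}/x /comb (bigD1 p) //= (bigD1 q) //= addrA; congr (_ + _).
  rewrite (bigID (fun i => i \in A)) /= [X in _ + X]big1 ?addr0; last first.
    by move=> j /andP[_]; rewrite inE negbK => /eqP ->; rewrite scale0r.
  rewrite (eq_bigl (fun j => j \in A :\ p :\ q)); last first.
    by move=> j; rewrite !inE; case: (j == p); case: (j == q); rewrite ?andbF.
  rewrite -big_enum /= (big_nth p) big_mkord.
  rewrite (big_ord_widen D (fun j => l (nth p P' j) *: v (nth p P' j))); last exact: leqW np_le.
  by apply: eq_bigr => j jn; rewrite row_lt.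
have xD : x = \sum_(i < D | (np <= i)%N && (i != m)) - `|x 0 (f i)| *: row i B.
  apply/rowP => c; rewrite [RHS]summxE.
  have E (j : 'I_D) : (np <= j)%N -> j != m ->
      (- `|x 0 (f j)| *: row j B) 0 c = x 0 (f j) * (c == f j)%:R.
    move=> npj jm; rewrite 2!mxE row_ge // mulrA; congr (_ * _).
    rewrite /e (negbTE jm); case: ltrP => xj; first by rewrite gtr0_norm // expr1 mulrN1 opprK.
    by rewrite ler0_norm // opprK mulr1.
  rewrite (eq_bigr (fun j => x 0 (f j) * (c == f j)%:R)); last first.
    by move=> j /andP[? ?]; apply: E.
  have [j /and3P[npj jm /eqP fj']|nof] := pickP (fun j : 'I_D => [&& (np <= j)%N, j != m & f j == c]).
    rewrite (bigD1 j) ?npj //= fj' eqxx mulr1 big1 ?addr0 // => j' /andP[/andP[h1 h2] h3].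
    rewrite -fj'; case: eqP => [/f_inj jj|]; last by rewrite mulr0.
    by rewrite jj ?eqxx in h3.
  rewrite big1 => [|j /andP[h1 h2]]; last first.
    by have := nof j; rewrite h1 h2 /= eq_sym => ->; rewrite mulr0.
  apply/eqP; apply: contraT => xc.
  have cK : c \in K by move/fintype.subsetP: K_supp; apply; rewrite inE.
  have [j [npj jm fj]] : exists j : 'I_D, [/\ (np <= j)%N, j != m & f j = c].
    have ltc : (np + index c (enum K) < D')%N.
      apply: (pivot_index_gt card_K).
      by rewrite cardE index_mem mem_enum.
    exists (inord (np + index c (enum K))).
    have jE : nat_of_ord (inord (np + index c (enum K)) : 'I_D) = (np + index c (enum K))%N.
      by rewrite inordK // ltnS ltnW.
    have jm : inord (np + index c (enum K)) != m by rewrite -val_eqE /= jE ltn_eqF.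
    by rewrite jE leq_addr /f (negbTE jm) jE addKn nth_index // mem_enum.
  by have := nof j; rewrite npj jm fj eqxx.
rewrite mulmx_sum_row -[l p *: v p + _](addrK (\sum_(i < D | (i < np)%N) l (nth p P' i) *: row i B)).
rewrite -xE {1}xD [RHS](bigID (fun i : 'I_D => (i < np)%N)) /= addrC; congr (_ + _); last first.
  by rewrite -sumrN; apply: eq_bigr => j jn; rewrite mxE jn scaleNr.
rewrite [RHS](bigD1 m) -?leqNgt //= !mxE ltnNge np_le eqxx scale0r add0r.
apply: eq_big => [j|j /andP[npj jm]]; first by rewrite -leqNgt.
by rewrite mxE ltnNge npj (negbTE jm).
Qed.

(** By [co_eq] the last coordinates of [l p *: v p] and [l q *: v q] are opposite, so the two keys
    have a common denominator up to sign. *)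
Let key_diff (i : 'I_D) : i != m ->
  key pt Y np f e pi i (F p) - key pt Y np f e pi i (F q) =
  (if (i < np)%N then - l (nth p P' i) else - `|x 0 (f i)|) / (l p * co m (F p)).
Proof.
move=> im; have := co_eq i; rewrite (negbTE im) => <-.
have := co_eq m; rewrite ltnNge np_le eqxx /= => h.
have qE : co m (F q) = - (l p * co m (F p)) / l q.
  by apply: (mulfI (lt0r_neq0 lq)); rewrite [RHS]mulrC divfK ?(lt0r_neq0 lq) //; lra.
rewrite /key qE; field.
by rewrite !(lt0r_neq0 lq, lt0r_neq0 lp, lt0r_neq0 pivot_pos).
Qed.

Lemma basic_pivot : basic_spec l p q.
Proof.
exists np, f, e, r.
have den : 0 < l p * co m (F p) by rewrite mulr_gt0 ?lp ?pivot_pos.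
split.
- apply: uniq_perm; rewrite ?enum_uniq //=.
    rewrite /r !inE negb_or eq_sym pq !mem_cat !mem_enum !inE !eqxx /= andbF /=.
    rewrite (lt0r_neq0 lp) (lt0r_neq0 lq) /= cat_uniq !enum_uniq /= andbT.
    apply/hasPn => i; rewrite !mem_enum !inE => /negbNE /eqP ->.
    by rewrite eqxx !andbF.
  move=> i; rewrite !inE mem_cat !mem_enum !inE.
  by case: (i == p); case: (i == q); case: (l i == 0).
- by rewrite size_cat leq_addr.
- split=> //; have := co_eq m; rewrite ltnNge np_le eqxx /= => h.
  by rewrite -(pmulr_rlt0 _ lq); lra.
- move=> i im; rewrite -subr_le0 key_diff //.
  by rewrite pmulr_lle0 ?invr_gt0 //; case: ifP; rewrite oppr_le0 ?l_ge0.
- rewrite /est /ksum -sumrB mulrA mulr_sumr /l1.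
  rewrite (eq_bigr (fun i => `|x 0 (f i)|)); last first.
    move=> i /andP[npi im]; rewrite -opprB key_diff // ltnNge npi /= mulrN mulrC -mulrA.
    by rewrite mulVf ?lt0r_neq0 // mulr1 opprK.
  (* As [f] is injective on these rows, the sum is a partial sum of the l1 norm of [x]. *)
  pose J := [set i : 'I_D | (np <= i)%N && (i != m)].
  rewrite (eq_bigl (fun i => i \in J)) => [|i]; last by rewrite inE.
  rewrite -(big_imset (fun c => `|x 0 c|)) /=.
    by rewrite [leRHS](bigID (fun c => c \in f @: J)) /= lerDl sumr_ge0.
  by move=> i j; rewrite !inE => /andP[h1 _] /andP[h2 _]; apply: f_inj.
Qed.
End Pivot.

Lemma basic_frame : basic_spec l p q.
Proof. by have [b bp] := exists_pivot; exact: basic_pivot bp. Qed.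
End Frame.

Lemma basic_pair : basic_spec l p q.
Proof.
have [|K /maxsetP[/boolp.asboolP Ki Kmax] suppK] :=
  @maxset_exists _ (fun K => boolp.asbool (indep K)) [set c | x 0 c != 0].
  by apply/boolp.asboolP; exact: indep_supp.
have Km c : c \notin K -> ~ indep (c |: K).
  move=> cK h; have E : c |: K = K.
    by apply: Kmax; [exact/boolp.asboolP | exact: finset.subsetUr].
  by move: cK; rewrite -E finset.setU11.
exact: basic_frame suppK Ki Km.
Qed.
End Support.

(** The largest weight of a vertex is at least [1 / k], whence the factor [k]. A vertex supported on
    one point has no partner [q]; it falls under the first alternative and is the reason why the
    program also tries single points. *)
Lemma nearest_basic (l : 'I_k -> R) : (forall i, 0 <= l i) -> \sum_i l i = 1 ->
  (exists i, l1 (v i) <= l1 (comb v l)) \/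
  exists p q np f e (r : seq 'I_k), let pi i := F (nth p r i) in
  [/\ perm_eq [:: p, q & r] (enum 'I_k), (np <= size r)%N /\ (np <= D')%N,
      0 < coo pt Y np f e pi ord_max (F p) /\ coo pt Y np f e pi ord_max (F q) < 0,
      forall i, i != ord_max -> key pt Y np f e pi i (F p) <= key pt Y np f e pi i (F q)
    & est pt Y np f e pi (F p) (F q) <= k%:R * l1 (comb v l)].
Proof.
move=> l_ge0 l_sum.
have [l' [l0 ls le rig]] := exists_rigid v l_ge0 l_sum.
have [i0 _] : exists i : 'I_k, true.
  case: (k) l' ls {le rig l0} => [|k'] l' ls; last by exists ord0.
  by move: ls; rewrite big_ord0 => /eqP; rewrite eq_sym oner_eq0.
have [p _ pmax] := @arg_maxP _ _ _ i0 xpredT l' isT.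
have lpk : 1 <= k%:R * l' p.
  rewrite -{1}ls; apply: (@le_trans _ _ (\sum_(i < k) l' p)).
    by apply: ler_sum => i _; apply: pmax.
  by rewrite sumr_const card_ord mulr_natl.
have [q /andP[qp lq]|noq] := pickP (fun q => (q != p) && (0 < l' q)).
  right; have [np [f [e [r [H1 H2 H3 H4 H5]]]]] :=
    basic_pair l0 ls rig (fun i => pmax i isT) lq qp.
  exists p, q, np, f, e, r; split=> //.
  have nn : 0 <= l1 (comb v l') by exact: l1_ge0.
  set E := est _ _ _ _ _ _ _ _ in H5 *.
  have h : k%:R * (l' p * E) <= k%:R * l1 (comb v l).
    by apply: ler_wpM2l => //; exact: le_trans H5 le.
  have [E0|E0] := leP E 0; first by rewrite (le_trans E0) // mulr_ge0 // l1_ge0.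
  apply: le_trans h; rewrite mulrA; nra.
left; exists p.
have l0' i : i != p -> l' i = 0.
  by move=> ip; have := noq i; rewrite ip /= lt_neqAle l0 andbT eq_sym => /negbFE /eqP.
have lp1 : l' p = 1 by rewrite -ls (bigD1 p) //= big1 ?addr0.
suff -> : v p = comb v l' by [].
rewrite /comb (bigD1 p) //= lp1 scale1r big1 ?addr0 // => i ip.
by rewrite l0' // scale0r.
Qed.
End Basic.

Local Close Scope ring_scope.

(** * Program logic *)
Local Open Scope nat_scope.

Fixpoint wmods c : seq var :=
  match c with
  | CW x _ => [:: x]
  | CSeq a b | CIfW _ _ a b | CIfR _ _ a b => wmods a ++ wmods b
  | CFor _ x a => x :: wmods a
  | _ => [::]
  end.

Fixpoint mmods c : seq nat :=
  match c with
  | CM id _ _ => [:: id]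
  | CSeq a b | CIfW _ _ a b | CIfR _ _ a b => mmods a ++ mmods b
  | CFor _ _ a => mmods a
  | _ => [::]
  end.

Fixpoint rmods c : seq var :=
  match c with
  | CR x _ => [:: x]
  | CSeq a b | CIfW _ _ a b | CIfR _ _ a b => rmods a ++ rmods b
  | CFor _ _ a => rmods a
  | _ => [::]
  end.

Section Logic.
Variables (R : realType) (n w K : nat) (inp : nat -> R).
Implicit Types (s : store R) (c : cmd) (Q : store R -> Prop).
Local Notation exec := (exec n inp).
Local Notation safe := (safe n w K inp).

Lemma wv_frame c s x : x \notin wmods c -> wv (exec c s) x = wv s x.
Proof.
elim: c s => [|y e|id a e|y e|a IHa b IHb|e1 e2 a IHa b IHb|e1 e2 a IHa b IHb|lg y a IHa] s //=.
- by rewrite inE => /negbTE ->.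
- by rewrite mem_cat negb_or => /andP[xa xb]; rewrite IHb // IHa.
- by rewrite mem_cat negb_or => /andP[xa xb]; case: ifP => _; [apply: IHa | apply: IHb].
- by rewrite mem_cat negb_or => /andP[xa xb]; case: ifP => _; [apply: IHa | apply: IHb].
- rewrite inE negb_or => /andP[xy xa]; elim: (loop_range _ _) s => //= i l IH s.
  by rewrite IH IHa //= (negbTE xy).
Qed.

Lemma wm_frame c s id : id \notin mmods c -> wm (exec c s) id = wm s id.
Proof.
elim: c s => [|y e|id' a e|y e|a IHa b IHb|e1 e2 a IHa b IHb|e1 e2 a IHa b IHb|lg y a IHa] s //=.
- by rewrite inE => /negbTE ->.
- by rewrite mem_cat negb_or => /andP[xa xb]; rewrite IHb // IHa.
- by rewrite mem_cat negb_or => /andP[xa xb]; case: ifP => _; [apply: IHa | apply: IHb].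
- by rewrite mem_cat negb_or => /andP[xa xb]; case: ifP => _; [apply: IHa | apply: IHb].
- by move=> xa; elim: (loop_range _ _) s => //= i l IH s; rewrite IH IHa.
Qed.

Lemma rv_frame c s x : x \notin rmods c -> rv (exec c s) x = rv s x.
Proof.
elim: c s => [|y e|id a e|y e|a IHa b IHb|e1 e2 a IHa b IHb|e1 e2 a IHa b IHb|lg y a IHa] s //=.
- by rewrite inE => /negbTE ->.
- by rewrite mem_cat negb_or => /andP[xa xb]; rewrite IHb // IHa.
- by rewrite mem_cat negb_or => /andP[xa xb]; case: ifP => _; [apply: IHa | apply: IHb].
- by rewrite mem_cat negb_or => /andP[xa xb]; case: ifP => _; [apply: IHa | apply: IHb].
- by move=> xa; elim: (loop_range _ _) s => //= i l IH s; rewrite IH IHa.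
Qed.

(** Total correctness: termination is built into [exec], and [safe] excludes overflow. *)
Definition runs c s Q := safe c s /\ Q (exec c s).

Lemma runs_seq a b s Q : runs a s (fun s' => runs b s' Q) -> runs (CSeq a b) s Q.
Proof. by case=> sa [sb q]. Qed.

Lemma runs_imp c s Q Q' : runs c s Q -> (forall s', s' = exec c s -> Q s' -> Q' s') ->
  runs c s Q'.
Proof. by case=> sc q H; split=> //; apply: H. Qed.

Lemma runs_ifW e1 e2 a b s Q : wsafe n w K s e1 -> wsafe n w K s e2 ->
  (weval n s e1 <= weval n s e2 -> runs a s Q) ->
  (weval n s e2 < weval n s e1 -> runs b s Q) -> runs (CIfW e1 e2 a b) s Q.
Proof.
by rewrite /runs /= => -> ->; case: leqP => h Ha Hb /=; [case: (Ha isT) | case: (Hb isT)].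
Qed.

Lemma runs_ifR e1 e2 a b s Q : rsafe n w K s e1 -> rsafe n w K s e2 ->
  ((reval n inp s e1 <= reval n inp s e2)%R -> runs a s Q) ->
  ((reval n inp s e2 < reval n inp s e1)%R -> runs b s Q) -> runs (CIfR e1 e2 a b) s Q.
Proof.
by rewrite /runs /= => -> ->; case: leP => h Ha Hb /=; [case: (Ha isT) | case: (Hb isT)].
Qed.

Lemma runs_W x e s Q : wsafe n w K s e -> Q (wset s x (weval n s e)) -> runs (CW x e) s Q.
Proof. by []. Qed.

Lemma runs_R x e s Q : rsafe n w K s e -> Q (rset s x (reval n inp s e)) -> runs (CR x e) s Q.
Proof. by []. Qed.

Lemma runs_M id a e s Q : wsafe n w K s a -> wsafe n w K s e -> id < K ->
  weval n s a * K + id < 2 ^ w -> Q (mset s id (weval n s a) (weval n s e)) ->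
  runs (CM id a e) s Q.
Proof. by move=> h1 h2 h3 h4; split=> //=; rewrite h1 h2 h3. Qed.

Section Loop.
Variables (x : var) (c : cmd).
Notation body := (fun s i => exec c (wset s x i)).
Notation safe_body := (fun i s => safe c (wset s x i)).

Lemma loop_inv (r : seq nat) (I : nat -> store R -> Prop) s : I 0 s ->
  (forall i s, i < size r -> I i s -> runs c (wset s x (nth 0 r i)) (I i.+1)) ->
  loop_safe safe_body (fun i s => exec c (wset s x i)) r s /\ I (size r) (foldl body s r).
Proof.
elim: r I s => //= i r IH I s I0 step.
have [sc I1] := step 0 s isT I0.
have [|sl If] := IH (fun j => I j.+1) (exec c (wset s x i)) I1; last by [].
by move=> j s' jr; apply: (step j.+1).
Qed.

End Loop.

Lemma runs_for_inv lg x c (I : nat -> store R -> Prop) s : I 0 s ->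
  (forall i s, i < size (loop_range n lg) -> I i s ->
     runs c (wset s x (nth 0 (loop_range n lg) i)) (I i.+1)) ->
  runs (CFor lg x c) s (I (size (loop_range n lg))).
Proof. exact: loop_inv. Qed.

(** Suited to search loops: iteration [i] reaches its own goal [G i] and preserves the goals reached
    earlier. *)
Lemma runs_for lg x c (I : store R -> Prop) (G : nat -> store R -> Prop) s : I s ->
  (forall i s, i \in loop_range n lg -> I s ->
     runs c (wset s x i) (fun s' => [/\ I s', G i s' & forall j, G j s -> G j s'])) ->
  runs (CFor lg x c) s (fun s' =>
    [/\ I s', forall i, i \in loop_range n lg -> G i s' & forall j, G j s -> G j s']).
Proof.
move=> Is step; set r := loop_range n lg in step *.
pose J i s' := [/\ I s', forall j, j \in take i r -> G j s' & forall j, G j s -> G j s'].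
have [|i s' ir [Is' gs' ms']|sl] := @loop_inv x c r J s.
- by split=> // j; rewrite take0.
- have [|sc [I1 G1 M1]] := step (nth 0 r i) s' _ Is'; first exact: mem_nth.
  split=> //; split=> // [j|j /ms' /M1 //].
  by rewrite (take_nth 0) // mem_rcons inE => /predU1P[-> //|/gs' /M1].
by rewrite /J take_size.
Qed.

(** * Nested loops *)

Fixpoint nest lg (xs : seq var) c := if xs is x :: xs' then CFor lg x (nest lg xs' c) else c.

Lemma wmods_nest lg xs c : wmods (nest lg xs c) = xs ++ wmods c.
Proof. by elim: xs => //= x xs ->. Qed.

Lemma mmods_nest lg xs c : mmods (nest lg xs c) = mmods c.
Proof. by elim: xs. Qed.

Lemma rmods_nest lg xs c : rmods (nest lg xs c) = rmods c.
Proof. by elim: xs. Qed.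

(** Goals are indexed by the tuple of all loop values. The map [emb] serves the induction, where it
    prepends the values of the outer loops. *)
Lemma runs_nest (T : Type) (emb : seq nat -> T) lg xs c (I : store R -> Prop)
    (G : T -> store R -> Prop) s :
  uniq xs -> {in xs, forall x, x \notin wmods c} ->
  (forall x i s, x \in xs -> I s -> I (wset s x i)) ->
  (forall x i t s, x \in xs -> G t s -> G t (wset s x i)) ->
  (forall vs s, size vs = size xs -> {subset vs <= loop_range n lg} ->
     (forall i, i < size xs -> wv s (nth (0, 0) xs i) = nth 0 vs i) -> I s ->
     runs c s (fun s' => [/\ I s', G (emb vs) s' & forall t, G t s -> G t s'])) -> I s ->
  runs (nest lg xs c) s (fun s' =>
    [/\ I s', forall vs, size vs = size xs -> {subset vs <= loop_range n lg} -> G (emb vs) s'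
      & forall t, G t s -> G t s']).
Proof.
elim: xs emb I s => [|x xs IH] emb I s /= U md Iw Gw body Is.
  have [||||sc [I1 G1 M1]] := body [::] s => //.
  by split=> //; split=> // -[|//] _ _.
have [xxs Uxs] := andP U.
(* The goal of the outer loop at [i] collects the goals of all tuples that begin with [i]; the right
   summand carries the goals reached before. *)
pose G' (i : nat + T) s' := match i with
  | inl i => forall vs, size vs = size xs -> {subset vs <= loop_range n lg} -> G (emb (i :: vs)) s'
  | inr t => G t s' end.
pose J s' := I s' /\ forall t, G t s -> G t s'.
have [||sc [[I1 M1] G1 _]] := @runs_for lg x (nest lg xs c) J (fun i => G' (inl i)) s.
- by split.
- move=> i s' ir [Is' Ms'].
  have [|||||sc [[I1 v1] G1 M1]] := IH (fun vs => emb (i :: vs)) (fun s => I s /\ wv s x = i)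
    (wset s' x i) Uxs.
  + by move=> y yxs; apply: md; rewrite inE yxs orbT.
  + move=> y j s2 yxs [I2 v2]; split; first by apply: Iw; rewrite // inE yxs orbT.
    by rewrite /= ifN //; apply: contraNneq xxs => ->.
  + by move=> y j t s2 yxs; apply: Gw; rewrite inE yxs orbT.
  + move=> vs s2 szv sub vv [I2 v2].
    have [||||sc [I3 G3 M3]] := body (i :: vs) s2 => //.
    * by rewrite /= szv.
    * by move=> j; rewrite inE => /predU1P[->|/sub].
    * by case=> [|j] //=; exact: vv.
    split=> //; split=> //.
    by split=> //; rewrite wv_frame // md // mem_head.
  + by split; [apply: Iw; rewrite ?mem_head | rewrite /= eqxx].
  split=> //; split=> [|//|j Gj vs szv sub].
    by split=> // t /Ms' h; apply/M1/Gw; rewrite ?mem_head.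
  by apply/M1/Gw; [exact: mem_head | exact: Gj].
split=> //; split=> // -[|i vs] //= [szv] sub.
by apply: G1 => // [|j jv]; apply: sub; rewrite inE ?eqxx ?jv ?orbT.
Qed.

End Logic.

(** * Ranking *)

Section RankMath.
Variables (n : nat) (prec : rel nat).
Hypotheses (prec_irr : irreflexive prec) (prec_trans : transitive prec).
Hypothesis prec_total : forall a b, a != b -> prec a b || prec b a.

Definition below (r : seq nat) z := count (prec^~ z) r.

Lemma prec_below r e z : e \in r -> prec e z = (below r e < below r z).
Proof.
move=> er; apply/idP/idP => [ez|].
  apply: (@leq_trans (count (predU (prec^~ e) (pred1 e)) r)).
    have := count_predUI (prec^~ e) (pred1 e) r.
    rewrite [X in _ + X](_ : _ = 0) ?addn0.
      by move=> ->; rewrite -addn1 leq_add2l -has_count has_pred1.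
    apply/eqP; rewrite -leqn0 leqNgt -has_count; apply/hasPn => i _ /=.
    by apply/negP => /andP[ie /eqP ei]; rewrite ei prec_irr in ie.
  apply: sub_count => i /= /orP[ie|/eqP -> //]; exact: prec_trans ez.
apply: contraTT => nez; rewrite -leqNgt; apply: sub_count => i /= iz.
have [<-//|ne] := eqVneq z e.
by have /orP[ze|ez] := prec_total ne; [exact: prec_trans ze | rewrite ez in nez].
Qed.

Lemma below_lt_size r e : e \in r -> below r e < size r.
Proof.
move=> er; rewrite ltn_neqAle count_size andbT -all_count; apply/negP => /allP /(_ e er).
by rewrite prec_irr.
Qed.

Lemma below_inj r : {in r &, injective (below r)}.
Proof.
move=> a b ar br E; apply/eqP; apply: contraT => /prec_total.
by rewrite (prec_below _ ar) (prec_below _ br) E ltnn.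
Qed.

Lemma below_surj r i : uniq r -> i < size r -> exists2 e, e \in r & below r e = i.
Proof.
move=> U ir.
have [] := @uniq_min_size _ (map (below r) r) (iota 0 (size r)).
- by rewrite map_inj_in_uniq //; exact: below_inj.
- by move=> j /mapP[e er ->]; rewrite mem_iota /= below_lt_size.
- by rewrite size_iota size_map.
by move=> _ /(_ i); rewrite mem_iota /= ir => /mapP[e er ->]; exists e.
Qed.

(** The last block may be short, and blocks beyond [n] are empty. *)
Definition blk p b := iota (b * p) (minn p (n - b * p)).

Lemma mem_blk p b z : 0 < p -> (z \in blk p b) = (z < n) && (z %/ p == b).
Proof.
move=> p0; rewrite mem_iota eqn_leq -[z %/ p <= b]ltnS ltn_divLR // leq_divRL // mulSn.
by case: (leqP (b * p) z) => ?; rewrite /= ?andbF // andbT; lia.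
Qed.

(** Ranks in the two halves add up, although [z] lies in at most one of them. This replaces
    merging. *)
Lemma below_double p b z :
  below (blk (2 * p) b) z = below (blk p (2 * b)) z + below (blk p (2 * b).+1) z.
Proof.
rewrite /below /blk -count_cat.
have -> : b * (2 * p) = 2 * b * p by lia.
have -> : minn (2 * p) (n - 2 * b * p) =
   minn p (n - 2 * b * p) + minn p (n - (2 * b).+1 * p) by lia.
rewrite iotaD; have [lt|ge] := ltnP (n - 2 * b * p) p.
  have -> : n - (2 * b).+1 * p = 0 by lia.
  by rewrite minn0 !cats0.
by rewrite [(2 * b).+1 * p]mulSn addnC.
Qed.

Lemma below_blk1 z : z < n -> below (blk 1 z) z = 0.
Proof.
move=> zn; rewrite /below /blk muln1 (minn_idPl _) ?subn_gt0 //= prec_irr //.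
Qed.

End RankMath.

Notation vPi i := (0, i) (only parsing).
Notation vPw i := (1, i) (only parsing).
Notation vOut i := (2, i) (only parsing).
Notation vZ := (3, 0) (only parsing).
Notation vB := (3, 1) (only parsing).
Notation vLo := (3, 2) (only parsing).
Notation vHi := (3, 3) (only parsing).
Notation vIt := (3, 4) (only parsing).
Notation vSt := (3, 5) (only parsing).
Notation vMid := (3, 6) (only parsing).
Notation vE := (3, 7) (only parsing).
Notation vAcc := (3, 8) (only parsing).
Notation vQ := (4, 0) (only parsing).
Notation vP := (4, 1) (only parsing).

Notation "a \w+ b" := (WB OAdd a b) (at level 50, left associativity).
Notation "a \w- b" := (WB OSub a b) (at level 50, left associativity).
Notation "a \w* b" := (WB OMul a b) (at level 40, left associativity).
Notation "a \w/ b" := (WB ODiv a b) (at level 40, left associativity).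
Notation "a ;; b" := (CSeq a b) (at level 60, right associativity).

Lemma mid_ltn a b : a < b -> (a + b) %/ 2 < b.
Proof. lia. Qed.

Lemma leq_mid a b : a < b -> a <= (a + b) %/ 2.
Proof. lia. Qed.

Lemma halve_lo a b : a < b -> (b - ((a + b) %/ 2).+1) * 2 <= b - a.
Proof. lia. Qed.

Lemma halve_hi a b : a < b -> ((a + b) %/ 2 - a) * 2 <= b - a.
Proof. lia. Qed.

Section RankCode.
Variables (aS aR : nat) (cmp : cmd -> cmd -> cmd).

(** Loops are bounded, so binary search runs for a fixed number of rounds, which do nothing once the
    interval is empty. *)
Definition search_step :=
  CIfW (WV vLo \w+ WL 1) (WV vHi)
    (CW vMid ((WV vLo \w+ WV vHi) \w/ WL 2) ;;
     CW vE (WM aS (WV vSt \w+ WV vMid)) ;;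
     cmp (CW vLo (WV vMid \w+ WL 1)) (CW vHi (WV vMid)))
    CSkip.

(** The right half may start beyond [n]; truncated subtraction then makes the search interval
    empty. *)
Definition search_half h :=
  CW vSt (((WV vZ \w/ (WV vB \w* WL 2)) \w* WL 2 \w+ WL h) \w* WV vB) ;;
  CW vLo (WL 0) ;;
  CIfW (WV vSt \w+ WV vB) WN (CW vHi (WV vB)) (CW vHi (WN \w- WV vSt)) ;;
  CFor true vIt search_step ;;
  CW vAcc (WV vAcc \w+ WV vLo).

(** Two loops, because a search needs the complete sorted sequences of both halves, which the first
    loop produces by scattering points to their ranks. *)
Definition rank_level :=
  CFor false vZ
    (CM aS ((WV vZ \w/ WV vB) \w* WV vB \w+ WM aR (WV vZ)) (WV vZ)) ;;
  CFor false vZ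
    (CW vAcc (WL 0) ;; search_half 0 ;; search_half 1 ;; CM aR (WV vZ) (WV vAcc)).

(* Merge sort without merging: the rank of z in its block of size 2p is found by
   binary search in the two blocks of size p, whose sorted sequences are in aS. *)
Definition rank_code :=
  CFor false vZ (CM aR (WV vZ) (WL 0)) ;; CFor true vB rank_level.

Section Correct.
Variables (R : realType) (n w K : nat) (inp : nat -> R).
Implicit Types (s : store R).
Local Notation W := (2 ^ w).
Local Notation runs := (runs n w K inp).
Variables (prec : rel nat) (View : store R -> Prop).
Hypotheses (prec_irr : irreflexive prec) (prec_trans : transitive prec).
Hypothesis prec_total : forall a b, a != b -> prec a b || prec b a.
Hypotheses (n1 : 1 < n) (HW : 8 * n.+1 < W) (HK : n.+2 * K <= W).
Hypotheses (aSR : aS != aR) (aSK : aS < K) (aRK : aR < K).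

Definition fr s s' := [/\ forall x : var, x.1 != 3 -> wv s' x = wv s x,
  forall x, rv s' x = rv s x & forall id, id != aS -> id != aR -> wm s' id = wm s id].

Hypothesis View_fr : forall s s', fr s s' -> View s -> View s'.
Hypothesis cmpP : forall s a b Q, View s -> wv s vE < n -> wv s vZ < n ->
  (prec (wv s vE) (wv s vZ) -> runs a s Q) ->
  (~~ prec (wv s vE) (wv s vZ) -> runs b s Q) -> runs (cmp a b) s Q.

Lemma W_gt a : a <= 8 * n.+1 -> a < W.
Proof. by move=> h; exact: leq_ltn_trans h HW. Qed.

Lemma addr_ok a id : id < K -> a < n -> a * K + id < W.
Proof.
move=> idK an; apply: leq_trans HK; apply: (@leq_trans (a.+1 * K)).
  by rewrite mulSn addnC ltn_add2r.
by rewrite leq_mul2r (leq_trans an) ?orbT // leqW.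
Qed.

Ltac safe_tac := repeat (apply/andP; split); rewrite ?andbT //;
  try (apply: W_gt; lia).

Lemma fr_trans s1 s2 s3 : fr s1 s2 -> fr s2 s3 -> fr s1 s3.
Proof.
move=> [a1 a2 a3] [b1 b2 b3]; split=> [x h|x|id h1 h2].
- by rewrite b1 // a1.
- by rewrite b2.
- by rewrite b3 // a3.
Qed.

Lemma fr_wset s (i v : nat) : fr s (wset s (3, i) v).
Proof. by split=> // -[a b] /= h; rewrite xpair_eqE (negbTE h). Qed.

Lemma fr_mset s id a v : id \in [:: aS; aR] -> fr s (mset s id a v).
Proof.
move=> h; split=> // i iS iR; move: h; rewrite !inE => h.
by case/orP: h => /eqP E /=; rewrite E (negbTE iS, negbTE iR).
Qed.

(** Keeps the start of a half within a word even if it lies beyond [n]. *)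
Lemma start_le z p h : h <= 1 -> (z %/ (p * 2) * 2 + h) * p <= z + p.
Proof.
move=> h1; have := leq_divM z (p * 2).
have : h * p <= 1 * p by rewrite leq_mul2r h1 orbT.
rewrite mulnDl; lia.
Qed.

Lemma search_ok s p b z : View s -> 0 < p -> p < n -> b * p <= n + n -> z < n ->
  (forall e, e \in blk n p b -> wm s aS (b * p + below prec (blk n p b) e) = e) ->
  wv s vZ = z -> wv s vSt = b * p -> wv s vLo = 0 -> wv s vHi = minn p (n - b * p) ->
  runs (CFor true vIt search_step) s (fun s' =>
    [/\ fr s s', wm s' = wm s, forall x, x \in [:: vZ; vB; vSt; vAcc] -> wv s' x = wv s x
      & wv s' vLo = below prec (blk n p b) z]).
Proof.
move=> Vs p0 pn bn zn srt sZ sSt sLo sHi; set c := below _ _ _.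
have szE : size (blk n p b) = minn p (n - b * p) by rewrite size_iota.
have c_le : c <= minn p (n - b * p) by rewrite -szE count_size.
(* The interval always contains the rank [c] and halves in each round. Its initial length is below
   [n], so it is empty after [up_log 2 n] rounds. *)
pose I i s' := [/\ fr s s', wm s' = wm s,
   forall x, x \in [:: vZ; vB; vSt; vAcc] -> wv s' x = wv s x,
   wv s' vLo <= c /\ c <= wv s' vHi /\ wv s' vHi <= minn p (n - b * p)
   & (wv s' vHi - wv s' vLo) * 2 ^ i <= minn p (n - b * p)].
apply: (runs_imp (Q := I (size (loop_range n true)))); last first.
  move=> s' _ [h1 h2 h3 [h4 [h5 h6]] h7]; split=> //.
  have : wv s' vHi - wv s' vLo = 0.
    apply/eqP; rewrite -leqn0 leqNgt; apply/negP => pos.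
    have : n <= 2 ^ size (loop_range n true).
      by rewrite size_map size_iota; exact: up_logP.
    by move: h7 pos; set d := wv s' vHi - _; case: d => // d; rewrite mulSn; lia.
  lia.
apply: runs_for_inv; first by split; rewrite ?sLo ?sHi // subn0 muln1.
move=> i s' _ [h1 h2 h3 [h4 [h5 h6]] h7].
set s1 := wset s' vIt _.
have fr1 : fr s s1 by apply: fr_trans h1 (fr_wset _ _ _).
have rd x : x \in [:: vZ; vB; vSt; vAcc] -> wv s1 x = wv s x.
  by move=> hx; rewrite -h3 //; move: hx; rewrite !inE => /or4P[] /eqP ->.
have lo1 : wv s1 vLo = wv s' vLo by [].
have hi1 : wv s1 vHi = wv s' vHi by [].
have st1 : wv s1 vSt = b * p by rewrite rd.
have hiN : wv s' vHi < n.
  by apply: leq_ltn_trans h6 _; apply: leq_ltn_trans (geq_minl _ _) pn.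
have loN : wv s' vLo < n by apply: leq_ltn_trans hiN; apply: leq_trans h4 h5.
apply: runs_ifW => /=; [by safe_tac | by safe_tac | move=> cond | move=> cond]; last first.
  split=> //; split=> //.
  have -> : wv s' vHi - wv s' vLo = 0 by apply/eqP; rewrite subn_eq0 -ltnS -[(_ vLo).+1]addn1.
  by rewrite mul0n.
set mid := (wv s' vLo + wv s' vHi) %/ 2.
have mid_lt : mid < wv s' vHi by apply: mid_ltn; rewrite -[(_ vLo).+1]addn1.
have lo_mid : wv s' vLo <= mid by apply: leq_mid; rewrite -[(_ vLo).+1]addn1.
have [|e eb eE] := @below_surj prec prec_irr prec_trans prec_total (blk n p b) mid (iota_uniq _ _).
  by rewrite szE (leq_trans mid_lt).
have en : e < n by move: eb; rewrite mem_blk // => /andP[].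
have memE : wm s' aS (b * p + mid) = e by rewrite h2 -eE srt.
have midn : b * p + mid < n.
  by have := leq_trans mid_lt h6; rewrite leq_min ltn_subRL => /andP[].
have idx := addr_ok aSK midn.
apply: runs_seq; apply: runs_W; first by rewrite /=; safe_tac; lia.
rewrite /= -/mid; set s2 := wset s1 vMid mid.
apply: runs_seq; apply: runs_W.
  rewrite /= [wv s' vSt]st1 memE aSK idx; safe_tac.
rewrite /= [wv s' vSt]st1 memE; set s3 := wset s2 vE e.
have fr3 : fr s s3.
  by apply: fr_trans fr1 _; apply: fr_trans (fr_wset _ _ _) (fr_wset _ _ _).
have ez : prec e z = (mid < c) by rewrite (prec_below prec_irr prec_trans prec_total z eb) eE.
have z3 : wv s3 vZ = z by rewrite -sZ -rd.
have rd3 x : x \in [:: vZ; vB; vSt; vAcc] -> wv s3 x = wv s x.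
  by move=> hx; rewrite -rd //; move: hx; rewrite !inE => /or4P[] /eqP ->.
apply: cmpP; first exact: View_fr fr3 Vs.
- by [].
- by rewrite z3.
- rewrite z3 [wv s3 vE]/= ez => mc; apply: runs_W; first by rewrite /=; safe_tac; lia.
  rewrite /= addn1; split=> //.
  + exact: fr_trans fr3 (fr_wset _ _ _).
  + by move=> x hx; rewrite -rd3 //; move: hx; rewrite !inE => /or4P[] /eqP ->.
  + by apply: leq_trans h7; rewrite expnS mulnA leq_mul2r; apply/orP; right; apply: halve_lo; rewrite -addn1.
- rewrite z3 [wv s3 vE]/= ez -leqNgt => mc; apply: runs_W; first by rewrite /=; safe_tac; lia.
  rewrite /=; split=> //.
  + exact: fr_trans fr3 (fr_wset _ _ _).
  + by move=> x hx; rewrite -rd3 //; move: hx; rewrite !inE => /or4P[] /eqP ->.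
  + by split=> //; split=> //; apply: leq_trans (ltnW mid_lt) h6.
  + by apply: leq_trans h7; rewrite expnS mulnA leq_mul2r; apply/orP; right; apply: halve_hi; rewrite -addn1.
Qed.

Lemma half_ok s p h z : View s -> h <= 1 -> 0 < p -> p < n -> z < n ->
  (forall b e, e \in blk n p b -> wm s aS (b * p + below prec (blk n p b) e) = e) ->
  wv s vZ = z -> wv s vB = p -> wv s vAcc <= n ->
  runs (search_half h) s (fun s' =>
    [/\ fr s s', wm s' = wm s, wv s' vZ = z, wv s' vB = p &
      wv s' vAcc = wv s vAcc + below prec (blk n p (2 * (z %/ (2 * p)) + h)) z]).
Proof.
move=> Vs h1 p0 pn zn srt sZ sB sA.
have bE : (z %/ (p * 2) * 2 + h) = (2 * (z %/ (2 * p)) + h) by rewrite [p * 2]mulnC mulnC.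
set b := 2 * (z %/ (2 * p)) + h in bE *.
have bn : b * p <= n + n.
  by rewrite -bE; apply: leq_trans (start_le _ _ h1) _; rewrite leq_add // ltnW.
have zW : z %/ (p * 2) * 2 <= z.
  by apply: leq_trans (leq_divM z (p * 2)); rewrite leq_mul2l leq_pmull ?orbT.
apply: runs_seq; apply: runs_W.
  rewrite /= sZ sB bE; safe_tac; rewrite -?bE; lia.
rewrite /= sZ sB bE; set s1 := wset s vSt (b * p).
apply: runs_seq; apply: runs_W; first by rewrite /=; safe_tac.
set s2 := wset s1 vLo _.
have fr2 : fr s s2 by apply: fr_trans (fr_wset _ _ _) (fr_wset _ _ _).
apply: runs_seq.
apply: (runs_imp (Q := fun s3 => s3 = wset s2 vHi (minn p (n - b * p)))).
  apply: runs_ifW => /=; [by rewrite sB; safe_tac; lia | by safe_tac; lia | |].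
  - rewrite sB => le; apply: runs_W; first by rewrite /= sB; safe_tac; lia.
    by rewrite /= sB (minn_idPl _) // leq_subRL ?(leq_trans (leq_addr _ _) le) // addnC.
  - rewrite sB => le; apply: runs_W; first by rewrite /=; safe_tac; lia.
    rewrite /= (minn_idPr _) //; lia.
move=> _ _ ->; set s3 := wset s2 vHi _.
have fr3 : fr s s3 by apply: fr_trans fr2 (fr_wset _ _ _).
apply: runs_seq; apply: runs_imp.
  apply: (@search_ok s3 p b z) => //; first exact: View_fr fr3 Vs.
  exact: srt.
move=> s4 _ [fr4 m4 v4 lo4]; apply: runs_W.
  have lez : wv s4 vLo <= n.
    by rewrite lo4 (leq_trans (count_size _ _)) // size_iota (leq_trans (geq_minl _ _)) // ltnW.
  rewrite /= v4 //=; safe_tac; lia.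
rewrite /=; split=> //=.
- by apply: fr_trans fr3 _; apply: fr_trans fr4 (fr_wset _ _ _).
- by rewrite v4.
- by rewrite v4.
- by rewrite lo4 v4.
Qed.

Let rk p z := below prec (blk n p (z %/ p)) z.

Lemma rk_lt p z : 0 < p -> z < n -> rk p z < minn p (n - z %/ p * p).
Proof.
move=> p0 zn; have zb : z \in blk n p (z %/ p) by rewrite mem_blk // zn eqxx.
by have := below_lt_size prec_irr zb; rewrite size_iota.
Qed.

Lemma rk_addr p z : 0 < p -> z < n -> z %/ p * p + rk p z < n.
Proof. by move=> p0 zn; have := rk_lt p0 zn; rewrite leq_min ltn_subRL => /andP[]. Qed.

(** The scattering loop of [rank_level] never overwrites a cell of another point. *)
Lemma rk_addr_inj p y z : 0 < p -> y < n -> z < n ->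
  y %/ p * p + rk p y = z %/ p * p + rk p z -> y = z.
Proof.
move=> p0 yn zn E.
have rkp x : x < n -> rk p x < p.
  by move=> xn; have := rk_lt p0 xn; rewrite leq_min => /andP[].
have Ed : y %/ p = z %/ p.
  have := congr1 (divn^~ p) E; rewrite /= !divnMDl //.
  by rewrite !(divn_small (rkp _ _)) // !addn0.
have Er : rk p y = rk p z by move: E; rewrite Ed => /addnI.
rewrite /rk Ed in Er; apply: (below_inj prec_irr prec_trans prec_total _ _ Er);
  by rewrite mem_blk // ?yn ?zn ?Ed eqxx.
Qed.

Lemma rank_level_ok s p : View s -> 0 < p -> p < n -> wv s vB = p ->
  (forall z, z < n -> wm s aR z = rk p z) ->
  runs rank_level s (fun s' => fr s s' /\ forall z, z < n -> wm s' aR z = rk (2 * p) z).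
Proof.
move=> Vs p0 pn sB sR.
apply: runs_seq; apply: runs_imp.
  apply: (runs_for (I := fun s' => [/\ fr s s', wv s' vB = p & forall z, z < n -> wm s' aR z = rk p z])
    (G := fun z s' => z < n -> wm s' aS (z %/ p * p + rk p z) = z)); first by [].
  move=> z s1; rewrite mem_iota add0n => /= zn [fr1 B1 R1].
  have zp : z %/ p * p <= z by exact: leq_divM.
  have ra := rk_addr p0 zn; have zd := leq_div z p.
  apply: runs_M => /=; rewrite ?B1 ?R1 //.
  - by rewrite aRK; safe_tac; apply: addr_ok.
  - by safe_tac.
  - exact: addr_ok.
  split.
  - split=> //= [|y yn].
      apply: fr_trans fr1 _; apply: fr_trans (fr_wset _ _ _) _.
      by apply: fr_mset; rewrite inE eqxx.
    by rewrite eq_sym (negbTE aSR) /= R1.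
  - by rewrite /= !eqxx.
  - move=> y Gy yn /=; rewrite eqxx /=; case: eqP => [E|_]; last exact: Gy.
    by rewrite (rk_addr_inj p0 yn zn E).
move=> s1 _ [[fr1 B1 R1] G1 _].
have srt b e : e \in blk n p b -> wm s1 aS (b * p + below prec (blk n p b) e) = e.
  rewrite mem_blk // => /andP[en /eqP <-].
  by apply: G1; rewrite // mem_iota.
apply: runs_imp.
  apply: (runs_for (I := fun s' => [/\ fr s1 s', wv s' vB = p & wm s' aS = wm s1 aS])
    (G := fun z s' => z < n -> wm s' aR z = rk (2 * p) z)); first by [].
  move=> z s2; rewrite mem_iota add0n => /= zn [fr2 B2 S2].
  set s3 := wset s2 vZ z.
  have fr3 : fr s1 s3 by exact: fr_trans fr2 (fr_wset _ _ _).
  apply: runs_seq; apply: runs_W; first by rewrite /=; safe_tac.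
  rewrite /=; set s4 := wset s3 vAcc 0.
  have fr4 : fr s1 s4 by exact: fr_trans fr3 (fr_wset _ _ _).
  have V4 : View s4 by apply: View_fr (fr_trans fr1 fr4) Vs.
  have hs : below prec (blk n (2 * p) (z %/ (2 * p))) z < n.
    by apply: leq_trans (rk_lt _ zn) _; rewrite ?muln_gt0 // geq_min leq_subr orbT.
  rewrite below_double in hs.
  apply: runs_seq; apply: runs_imp.
    apply: (@half_ok s4 p 0 z) => //.
    by move=> b e eb; rewrite -[RHS](srt b) //= S2.
  move=> s5 _ [fr5 m5 z5 b5 a5]; rewrite [wv s4 vAcc]/= add0n addn0 in a5.
  have V5 : View s5 by apply: View_fr fr5 V4.
  apply: runs_seq; apply: runs_imp.
    apply: (@half_ok s5 p 1 z) => //; last by rewrite a5; lia.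
    by move=> b e eb; rewrite -[RHS](srt b) //= m5 /= S2.
  move=> s6 _ [fr6 m6 z6 b6 a6]; rewrite a5 addn1 -below_double in a6.
  rewrite -below_double in hs.
  have fr56 : fr s1 s6 by apply: fr_trans fr4 _; apply: fr_trans fr5 fr6.
  apply: runs_M => /=; rewrite ?z6 ?a6 //; try by safe_tac; lia.
    exact: addr_ok.
  split.
  - split=> //=; first by apply: fr_trans fr56 _; apply: fr_mset; rewrite !inE eqxx orbT.
    by rewrite m6 m5 /= (negbTE aSR) S2.
  - by rewrite /= !eqxx.
  - move=> y Gy yn /=; rewrite eqxx /=; case: eqP => [->//|_].
    by rewrite m6 m5 /=; apply: Gy.
move=> s2 _ [[fr2 _ _] G2 _]; split; first exact: fr_trans fr1 fr2.
by move=> z zn; apply: G2; rewrite // mem_iota.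
Qed.

Lemma rank_ok s : View s -> runs rank_code s (fun s' => fr s s' /\
  forall z, z < n -> wm s' aR z = below prec (iota 0 n) z).
Proof.
move=> Vs; apply: runs_seq; apply: runs_imp.
  apply: (runs_for (I := fr s) (G := fun z s' => wm s' aR z = 0)); first by [].
  move=> z s1; rewrite mem_iota add0n => /= zn fr1.
  apply: runs_M => /=; rewrite ?andbT //; try by safe_tac; lia.
    by apply: addr_ok.
  split.
  - apply: fr_trans fr1 _; apply: fr_trans (fr_wset _ _ _) _.
    by apply: fr_mset; rewrite !inE eqxx orbT.
  - by rewrite /= !eqxx.
  - by move=> y /= ->; case: ifP.
move=> s1 _ [fr1 G1 _]; apply: runs_imp.
  apply: (runs_for_inv (I := fun i s' => fr s s' /\
     forall z, z < n -> wm s' aR z = rk (2 ^ i) z)).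
    split=> // z zn; rewrite G1 ?mem_iota // /rk expn0 divn1 below_blk1 //.
  move=> i s2 ir [fr2 R2].
  have -> : nth 0 (loop_range n true) i = 2 ^ i.
    move: ir; rewrite /loop_range size_map size_iota => ir.
    by rewrite (nth_map 0) ?size_iota // nth_iota.
  have pn : 2 ^ i < n.
    move: ir; rewrite /loop_range size_map size_iota => ir.
    rewrite ltnNge; apply/negP => /(up_log_min (isT : 1 < 2)); lia.
  have fr3 := fr_trans fr2 (fr_wset s2 1 (2 ^ i)).
  apply: runs_imp.
    apply: (@rank_level_ok _ (2 ^ i)) => //; first exact: View_fr fr3 Vs.
    by rewrite expn_gt0.
  by move=> s3 _ [fr4 R4]; split; [exact: fr_trans fr3 fr4 | rewrite expnS].
(* After the last level the block size is at least [n], so block 0 contains everything. *)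
move=> s2 _ [fr2 R2]; split=> // z zn; rewrite R2 // /rk.
have nL : n <= 2 ^ size (loop_range n true).
  by rewrite size_map size_iota; exact: up_logP.
rewrite divn_small; last exact: leq_trans zn nL.
by rewrite /blk mul0n subn0 (minn_idPr nL).
Qed.

End Correct.
End RankCode.

(** * Expressions for the coordinates *)

Notation rY c := (0, c) (only parsing).
Notation rX c := (1, c) (only parsing).
Notation rV := (2, 0) (only parsing).

Definition signE b := if b then RB OSub (RL 0) (RL 1) else RL 1.
Definition sumE (l : seq rexp) := foldr (RB OAdd) (RL 0) l.
Definition prodE (l : seq rexp) := foldr (RB OMul) (RL 1) l.
Definition ptE D ez c := RI (ez \w* WL D \w+ WL c).
(** The Leibniz formula written out: field operations only, and a number of terms that is constant
    in [n]. *)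
Definition detE D (M : 'I_D -> 'I_D -> rexp) :=
  sumE [seq RB OMul (signE (odd_perm s)) (prodE [seq M i (s i) | i <- enum 'I_D])
       | s <- enum [set: 'S_D]].
Definition digitsE l := foldl (fun a x => a \w* (WN \w+ WL 1) \w+ x) (WL 0) l.

Fixpoint guard (ps : seq (wexp * wexp)) c :=
  if ps is (a, b) :: ps' then CIfW a b (CIfW b a CSkip (guard ps' c)) (guard ps' c) else c.

Definition digval n l := foldl (fun a x => a * n.+1 + x)%N 0%N l.

Lemma digval_rcons n l x : digval n (rcons l x) = (digval n l * n.+1 + x)%N.
Proof. by rewrite /digval foldl_rcons. Qed.

Lemma digval_lt n l : all (leq^~ n) l -> (digval n l < n.+1 ^ size l)%N.
Proof.
elim/last_ind: l => // l x IH; rewrite all_rcons digval_rcons size_rcons => /andP[xn ln].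
have := IH ln; rewrite expnSr => h; apply: leq_trans (_ : (digval n l).+1 * n.+1 <= _)%N.
  by rewrite mulSn addnC ltn_add2r ltnS.
by rewrite leq_mul2r h orbT.
Qed.

(** An array indexed by [digval] is thereby a dictionary keyed by tuples of numbers at most [n],
    with access in constant time and without hashing. *)
Lemma digval_inj n l1 l2 : size l1 = size l2 -> all (leq^~ n) l1 -> all (leq^~ n) l2 ->
  digval n l1 = digval n l2 -> l1 = l2.
Proof.
elim/last_ind: l1 l2 => [|l1 x IH] l2; first by case: l2.
case/lastP: l2 => [|l2 y]; rewrite !size_rcons // => -[sz].
rewrite !all_rcons !digval_rcons => /andP[xn ln1] /andP[yn ln2] E.
have Ed := congr1 (divn^~ n.+1) E; have Em := congr1 (modn^~ n.+1) E; move: Ed Em.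
rewrite /= !divnMDl // !modnMDl !(divn_small (_ : x < n.+1)%N) // !(divn_small (_ : y < n.+1)%N) //.
by rewrite !addn0 !modn_small // => Ed ->; rewrite (IH l2).
Qed.

Section Eval.
Variables (R : realType) (n w K : nat) (inp : nat -> R) (D : nat).
Implicit Types s : store R.
Local Notation W := (2 ^ w)%N.
Local Notation reval := (reval n inp).
Local Notation rsafe := (rsafe n w K).
Local Notation wsafe := (wsafe n w K).
Hypothesis W1 : (1 < W)%N.

Lemma reval_sum s (I : Type) (F : I -> rexp) l :
  reval s (sumE [seq F i | i <- l]) = (\sum_(i <- l) reval s (F i))%R.
Proof. by elim: l => [|i l IH]; rewrite ?big_nil ?big_cons //= IH. Qed.

Lemma reval_prod s (I : Type) (F : I -> rexp) l :
  reval s (prodE [seq F i | i <- l]) = (\prod_(i <- l) reval s (F i))%R.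
Proof. by elim: l => [|i l IH]; rewrite ?big_nil ?big_cons //= IH. Qed.

Lemma reval_sign s b : reval s (signE b) = ((-1) ^+ b)%R.
Proof. by case: b; rewrite //= sub0r. Qed.

Lemma reval_det s M : reval s (@detE D M) = (\det (\matrix_(i, j) reval s (M i j)))%R.
Proof.
rewrite /detE reval_sum big_enum /=; apply: eq_big => [a|a _]; first by rewrite inE.
rewrite /= reval_sign reval_prod big_enum /=; congr (_ * _)%R.
by apply: eq_bigr => i _; rewrite mxE.
Qed.

Lemma rsafe_op s o a b : rsafe s a -> rsafe s b -> rsafe s (RB o a b).
Proof. by move=> /= -> ->. Qed.

Lemma rsafe_sum s l : all (rsafe s) l -> rsafe s (sumE l).
Proof. by elim: l => [_|x l IH /= /andP[-> /IH]] //=; rewrite ltnW. Qed.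

Lemma rsafe_prod s l : all (rsafe s) l -> rsafe s (prodE l).
Proof. by elim: l => //= x l IH /andP[-> /IH]. Qed.

Lemma rsafe_det s M : (forall i j, rsafe s (M i j)) -> rsafe s (@detE D M).
Proof.
move=> h; apply: rsafe_sum; rewrite all_map; apply/allP => a _ /=.
rewrite rsafe_prod ?andbT; last by rewrite all_map; apply/allP => i _ /=.
by case: (odd_perm a); rewrite /= W1 // ltnW.
Qed.

Lemma weval_digval s l : weval n s (digitsE l) = digval n [seq weval n s e | e <- l].
Proof.
rewrite /digitsE /digval; elim/last_ind: l => //= l x IH.
by rewrite map_rcons !foldl_rcons /= IH addn1.
Qed.

Lemma wsafe_digval s l A : (size l <= A)%N -> (n.+1 ^ A.+1 < W)%N ->
  all (wsafe s) l -> all (leq^~ n) [seq weval n s e | e <- l] -> wsafe s (digitsE l).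
Proof.
elim/last_ind: l A => [|l x IH] A /= szA An; first by rewrite andbT ltnW.
rewrite size_rcons in szA; case: A => // A in szA An *.
rewrite map_rcons !all_rcons => /andP[sx sl] /andP[xn ln].
have hl := digval_lt ln; rewrite size_map in hl.
have le1 : (n.+1 ^ A.+1 <= n.+1 ^ A.+2)%N by rewrite leq_pexp2l.
have le2 : (n.+1 ^ (size l).+1 <= n.+1 ^ A.+1)%N by rewrite leq_pexp2l.
have n1 : (n.+1 <= n.+1 ^ A.+1)%N by rewrite -{1}[n.+1]expn1 leq_pexp2l.
have hl' : (digval n [seq weval n s e | e <- l] * n.+1 + n < n.+1 ^ (size l).+1)%N.
  rewrite expnSr; apply: leq_trans (_ : (digval n [seq weval n s e | e <- l]).+1 * n.+1 <= _)%N.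
    by rewrite mulSn addnC.
  by rewrite leq_mul2r hl orbT.
rewrite /digitsE foldl_rcons -/(digitsE l) /= (IH A) // ?(leq_ltn_trans le1) //.
rewrite weval_digval sx addn1 W1 /=.
set h := digval _ _ in hl hl' *; lia.
Qed.

Lemma runs_guard ps c s Q :
  all (fun ab => wsafe s ab.1 && wsafe s ab.2) ps ->
  (all (fun ab => weval n s ab.1 != weval n s ab.2) ps -> runs n w K inp c s Q) ->
  (~~ all (fun ab => weval n s ab.1 != weval n s ab.2) ps -> Q s) ->
  runs n w K inp (guard ps c) s Q.
Proof.
elim: ps => [|[a b] ps IH] /=; first by move=> _ Hc _; exact: Hc.
move=> /andP[/andP[sa sb] sf] Hc HQ.
have {}IH : weval n s a != weval n s b -> runs n w K inp (guard ps c) s Q.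
  move=> ne; apply: IH => // h.
  - by apply: Hc; rewrite ne.
  - by apply: HQ; rewrite negb_and h orbT.
apply: runs_ifW => // ab; last by apply: IH; rewrite neq_ltn ab orbT.
apply: runs_ifW => // ba; last by apply: IH; rewrite neq_ltn ba.
by split=> //; apply: HQ; rewrite eqn_leq ab ba.
Qed.

End Eval.

Section CoordinateExpr.
Variables (D' : nat).
Notation D := D'.+1.
Variables (np : nat) (f : 'I_D -> 'I_D) (e : 'I_D -> bool).

Definition basisE (i c : 'I_D) :=
  if (i < np)%N then RB OSub (ptE D (WV (vPi (nat_of_ord i))) c) (RV (rY (nat_of_ord c)))
  else RB OMul (signE (e i)) (RL (c == f i)).
Definition basis_withE i0 ez (i c : 'I_D) :=
  if i == i0 then RB OSub (ptE D ez c) (RV (rY (nat_of_ord c))) else basisE i c.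
Definition cooE i ez := RB ODiv (detE (basis_withE i ez)) (detE basisE).
Definition keyE i ez := RB ODiv (cooE i ez) (cooE ord_max ez).
Definition ksumE ez := sumE [seq keyE i ez
  | i <- [seq i : 'I_D <- enum 'I_D | (np <= i)%N && (i != ord_max)]].
Definition wtE' p q i := RB OSub (RB OMul (cooE ord_max q) (cooE i p))
  (RB OMul (cooE ord_max p) (cooE i q)).
Definition low : seq 'I_D := [seq i : 'I_D <- enum 'I_D | (i < np)%N].
Definition massE p q := RB OAdd (RB OSub (cooE ord_max p) (cooE ord_max q))
  (sumE [seq wtE' p q i | i <- low]).
Definition candE p q c := RB ODiv
  (RB OAdd (RB OSub (RB OMul (cooE ord_max p) (ptE D q c)) (RB OMul (cooE ord_max q) (ptE D p c)))
     (sumE [seq RB OMul (wtE' p q i) (ptE D (WV (vPi (nat_of_ord i))) c) | i <- low]))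
  (massE p q).
Definition sqE a := RB OMul a a.
Definition valE p q := sumE [seq sqE (RB OSub (candE p q c) (ptE D WN c)) | c <- iota 0 D].

Variables (R : realType) (n w K : nat) (inp : nat -> R).
Implicit Types s : store R.
Local Notation W := (2 ^ w)%N.
Variables (k' : nat) (Y : 'rV[R]_D) (pi : nat -> nat).
Hypotheses (np_k : (np <= k')%N) (W1 : (1 < W)%N) (HD : (n.+1 * D < W)%N).
Hypothesis pi_lt : forall i, (i < k')%N -> (pi i < n)%N.

(** Number [n] is the target [y], which follows the [n] points in the input. *)
Definition pt (z : nat) : 'rV[R]_D := \row_c inp (z * D + c).

Definition View s := (forall i, (i < k')%N -> wv s (vPi i) = pi i) /\
  forall c : 'I_D, rv s (rY (nat_of_ord c)) = Y 0%R c.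

Section Fixed.
Variable s : store R.
Hypothesis Vs : View s.

Lemma reval_pt ez (c : nat) : (c < D)%N ->
  reval n inp s (ptE D ez c) = pt (weval n s ez) 0%R (inord c).
Proof. by move=> h; rewrite /= mxE inordK. Qed.

Lemma reval_basis i c : reval n inp s (basisE i c) = basis pt Y np f e pi i c.
Proof.
rewrite /basisE mxE; case: ifP => h.
  by rewrite /= (proj1 Vs) ?(leq_trans h) // (proj2 Vs) mxE.
by rewrite [LHS]/= reval_sign.
Qed.

Lemma reval_coo i ez : reval n inp s (cooE i ez) = coo pt Y np f e pi i (weval n s ez).
Proof.
transitivity (reval n inp s (detE (basis_withE i ez)) / reval n inp s (detE basisE))%R => //.
rewrite !reval_det /coo; congr (_ / _)%R; congr (determinant _); apply/matrixP => a c.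
  rewrite [LHS]mxE [RHS]mxE /basis_withE; case: ifP => _; last exact: reval_basis.
  by rewrite /= (proj2 Vs) mxE.
by rewrite mxE reval_basis.
Qed.

Lemma reval_key i ez : reval n inp s (keyE i ez) = key pt Y np f e pi i (weval n s ez).
Proof. by rewrite /key -!reval_coo. Qed.

Lemma reval_ksum ez : reval n inp s (ksumE ez) = ksum pt Y np f e pi (weval n s ez).
Proof.
rewrite /ksumE /ksum reval_sum big_filter big_enum_cond.
by apply: eq_bigr => i _; rewrite reval_key.
Qed.

Lemma reval_wt p q i : reval n inp s (wtE' p q i) =
  wt pt Y np f e pi (weval n s p) (weval n s q) i.
Proof. by rewrite /wt -!reval_coo. Qed.

Lemma reval_cand p q c : (c < D)%N -> reval n inp s (candE p q c) =
  cand pt Y np f e pi (weval n s p) (weval n s q) 0%R (inord c).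
Proof.
move=> h; rewrite /cand mxE /mass -!reval_coo [RHS]mulrC.
transitivity ((reval n inp s (cooE ord_max p) * reval n inp s (ptE D q c) -
    reval n inp s (cooE ord_max q) * reval n inp s (ptE D p c) +
    reval n inp s (sumE [seq RB OMul (wtE' p q i) (ptE D (WV (vPi (nat_of_ord i))) c) | i <- low])) /
  (reval n inp s (cooE ord_max p) - reval n inp s (cooE ord_max q) +
    reval n inp s (sumE [seq wtE' p q i | i <- low])))%R => //.
rewrite !reval_sum !big_filter !big_enum_cond [LHS]mulrC [RHS]mulrC.
congr ((_)^-1 * _)%R.
  by congr (_ + _)%R; apply: eq_bigr => i _; rewrite reval_wt.
rewrite !mxE inordK //; congr (_ + _)%R.
rewrite summxE; apply: eq_bigr => i inp'; rewrite /= !mxE inordK //.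
rewrite -reval_wt; congr (_ * inp (_ * _ + _))%R.
by rewrite (proj1 Vs) // (leq_trans inp').
Qed.

Lemma reval_val p q : reval n inp s (valE p q) =
  (\sum_c (cand pt Y np f e pi (weval n s p) (weval n s q) 0 c - pt n 0 c) ^+ 2)%R.
Proof.
rewrite /valE reval_sum -[iota 0 D]/(index_iota 0 D) big_mkord; apply: eq_bigr => c _.
have E : (reval n inp s (candE p q c) - reval n inp s (ptE D WN c) =
    cand pt Y np f e pi (weval n s p) (weval n s q) 0 c - pt n 0 c)%R.
  by rewrite reval_cand // reval_pt // inord_val.
by rewrite expr2 -E.
Qed.

Local Notation rsafe := (rsafe n w K s).
(** The bound is [<= n] rather than [< n] to admit the target as point number [n]. *)
Definition okE ez := wsafe n w K s ez && (weval n s ez <= n)%N.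

Lemma rsafe_pt ez c : okE ez -> (c < D)%N -> rsafe (ptE D ez c).
Proof.
case/andP=> sz zn cD /=; rewrite sz /= andbT.
have : (weval n s ez * D <= n * D)%N by rewrite leq_mul2r zn orbT.
move: HD; rewrite mulSn; lia.
Qed.

Lemma okE_pi i : (i < np)%N -> okE (WV (vPi i)).
Proof.
move=> h; have h' := leq_trans h np_k; have := pi_lt h'.
rewrite /okE /= (proj1 Vs) // andbT => h2.
have : (n.+1 <= n.+1 * D)%N by rewrite leq_pmulr.
by rewrite (ltnW h2) andbT; lia.
Qed.

Lemma rsafe_basis i c : rsafe (basisE i c).
Proof.
rewrite /basisE; case: ifP => h; first by apply/andP; split=> //; apply: rsafe_pt (okE_pi h) (ltn_ord c).
by case: (e i); rewrite /= ?W1 ?(ltnW W1) /=; case: (_ == _) => //=; rewrite ltnW.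
Qed.

Lemma rsafe_coo i ez : okE ez -> rsafe (cooE i ez).
Proof.
move=> ok; apply/andP; split; apply: rsafe_det => // a c; last exact: rsafe_basis.
rewrite /basis_withE; case: ifP => _; last exact: rsafe_basis.
by apply/andP; split=> //; apply: rsafe_pt ok (ltn_ord c).
Qed.

Lemma rsafe_key i ez : okE ez -> rsafe (keyE i ez).
Proof. by move=> ok; apply/andP; split; apply: rsafe_coo. Qed.

Lemma rsafe_ksum ez : okE ez -> rsafe (ksumE ez).
Proof.
by move=> ok; apply: rsafe_sum => //; rewrite all_map; apply/allP => i _; apply: rsafe_key.
Qed.

Lemma rsafe_wt p q i : okE p -> okE q -> rsafe (wtE' p q i).
Proof. by move=> okp okq; apply: rsafe_op; apply: rsafe_op; apply: rsafe_coo. Qed.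

Lemma rsafe_cand p q c : okE p -> okE q -> (c < D)%N -> rsafe (candE p q c).
Proof.
move=> okp okq cD.
have wts g : (forall i : 'I_D, i \in low -> rsafe (g i)) -> rsafe (sumE [seq g i | i <- low]).
  by move=> h; apply: rsafe_sum => //; rewrite all_map; apply/allP => i /h.
apply: rsafe_op; apply: rsafe_op.
- by apply: rsafe_op; apply: rsafe_op; [apply: rsafe_coo | apply: rsafe_pt | apply: rsafe_coo
    | apply: rsafe_pt].
- apply: wts => i; rewrite mem_filter => /andP[inp' _].
  by apply: rsafe_op; [apply: rsafe_wt | apply: rsafe_pt (okE_pi inp') cD].
- by apply: rsafe_op; apply: rsafe_coo.
- by apply: wts => i _; apply: rsafe_wt.
Qed.

Lemma rsafe_val p q : okE p -> okE q -> okE WN -> rsafe (valE p q).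
Proof.
move=> okp okq okn; apply: rsafe_sum => //; rewrite all_map; apply/allP => c.
rewrite mem_iota => /andP[_ cD].
by apply: rsafe_op; apply: rsafe_op; [apply: rsafe_cand | apply: rsafe_pt | apply: rsafe_cand
  | apply: rsafe_pt].
Qed.

End Fixed.
End CoordinateExpr.

(** * Euclidean norm *)

Section Norm.
Variables (R : realType) (d : nat).
Implicit Types x y : 'rV[R]_d.
Local Open Scope ring_scope.

Definition sq x : R := \sum_c x 0 c ^+ 2.
Definition nrm x : R := Num.sqrt (sq x).

Lemma sq_ge0 x : 0 <= sq x.
Proof. by apply: sumr_ge0 => c _; apply: sqr_ge0. Qed.

Lemma nrm_ge0 x : 0 <= nrm x. Proof. exact: sqrtr_ge0. Qed.

Lemma sqr_nrm x : nrm x ^+ 2 = sq x. Proof. exact: sqr_sqrtr (sq_ge0 x). Qed.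

Lemma cauchy_schwarz x y : \sum_c x 0 c * y 0 c <= nrm x * nrm y.
Proof.
set S := \sum_c _.
suff : S ^+ 2 <= sq x * sq y.
  rewrite -ler_sqrt ?mulr_ge0 ?sq_ge0 // sqrtr_sqr sqrtrM ?sq_ge0 // => h.
  exact: le_trans (ler_norm S) h.
have [y0|y0] := eqVneq (sq y) 0.
  suff -> : S = 0 by rewrite expr0n mulr_ge0 ?sq_ge0.
  apply: big1 => c _; move/eqP: y0; rewrite psumr_eq0 => [|c' _]; last exact: sqr_ge0.
  by move/allP/(_ c); rewrite mem_index_enum sqrf_eq0 => /(_ isT)/eqP ->; rewrite mulr0.
have ypos : 0 < sq y by rewrite lt0r y0 sq_ge0.
rewrite -subr_ge0 -(pmulr_rge0 _ ypos).
(* On the right stands the squared norm of [sq y *: x - S *: y], which is [sq y] times the component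
   of [x] orthogonal to [y]. *)
have -> : sq y * (sq x * sq y - S ^+ 2) = \sum_c (sq y * x 0 c - S * y 0 c) ^+ 2.
  rewrite (eq_bigr (fun c => sq y ^+ 2 * x 0 c ^+ 2 - 2 * sq y * S * (x 0 c * y 0 c) +
     S ^+ 2 * y 0 c ^+ 2)); last by move=> c _; ring.
  by rewrite big_split sumrB /= -!mulr_sumr -/(sq x) -/(sq y) -/S; ring.
by apply: sumr_ge0 => c _; apply: sqr_ge0.
Qed.

Lemma nrmD x y : nrm (x + y) <= nrm x + nrm y.
Proof.
rewrite -(@ler_pXn2r _ 2) ?nnegrE ?addr_ge0 ?nrm_ge0 // sqrrD !sqr_nrm.
have -> : sq (x + y) = sq x + (\sum_c x 0 c * y 0 c) *+ 2 + sq y.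
  rewrite /sq -sumrMnl -!big_split; apply: eq_bigr => c _ /=.
  by rewrite mxE sqrrD.
by rewrite lerD2r lerD2l lerMn2r cauchy_schwarz orbT.
Qed.

Lemma nrm_l1 x : nrm x <= l1 x.
Proof.
rewrite -(@ler_pXn2r _ 2) ?nnegrE ?nrm_ge0 ?l1_ge0 // sqr_nrm expr2 /l1 mulr_suml.
apply: ler_sum => c _; rewrite -real_normK ?num_real // expr2 ler_wpM2l //.
by rewrite (bigD1 c) //= lerDl sumr_ge0.
Qed.

Lemma nrmN x : nrm (- x) = nrm x.
Proof. by rewrite /nrm /sq; congr Num.sqrt; apply: eq_bigr => c _; rewrite mxE sqrrN. Qed.

Lemma abs_le_nrm x c : `|x 0 c| <= nrm x.
Proof.
rewrite -(@ler_pXn2r _ 2) ?nnegrE ?nrm_ge0 // sqr_nrm real_normK ?num_real //.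
by rewrite /sq (bigD1 c) //= lerDl sumr_ge0 // => i _; apply: sqr_ge0.
Qed.

End Norm.

(** * Nearest pair for a fixed coordinate system *)

Definition seqC := foldr CSeq CSkip.

Lemma wmods_seqCR l (g : nat -> var) h : wmods (seqC [seq CR (g c) (h c) | c <- l]) = [::].
Proof. by elim: l. Qed.

Lemma wmods_seqCW l (g : nat -> var) h :
  wmods (seqC [seq CW (g c) (h c) | c <- l]) = [seq g c | c <- l].
Proof. by elim: l => //= c l ->. Qed.

Section BlockCode.
Variables (D' k' : nat).
Notation D := D'.+1.
Variables (np : nat) (f : 'I_D -> 'I_D) (e : 'I_D -> bool) (t : bool) (uid aS : nat).

Definition aR i := aS.+1 + i.
Local Notation coE := (cooE np f e ord_max).
Local Notation kE := (keyE np f e).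
Local Notation ksE := (ksumE np f e).

(* Ties are broken by the index of the point, in the direction t. *)
Definition prec_cmd i a b :=
  CIfR (kE i (WV vE)) (kE i (WV vZ))
    (CIfR (kE i (WV vZ)) (kE i (WV vE))
      (CIfW ((if t then WV vE else WV vZ) \w+ WL 1) (if t then WV vZ else WV vE) a b) a) b.

Definition ranks := seqC [seq rank_code aS (aR i) (prec_cmd (inord i)) | i <- iota 0 D'].

Definition pws : seq var := [seq vPw i | i <- iota 0 D'].
Definition pis : seq var := [seq vPi i | i <- iota 0 k'].

(** A node is named by its level and its number for each key; [b = 1] names the next node in every
    key. The first points belong to the address, so different choices of them use disjoint cells. *)
Definition addrE z b := digitsE ([seq WV x | x <- pis] ++ [seq WV x | x <- pws] ++
  [seq WM (aR i) (WV z) \w/ WV (vPw i) \w+ WL b | i <- iota 0 D']).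

Definition not_pi z := [seq (WV z, WV x) | x <- pis].

(** The entry [q + 1] stands for [q], as 0 marks an empty cell. *)
Definition insert_cell :=
  CIfW (WM uid (addrE vQ 0)) (WL 0) (CM uid (addrE vQ 0) (WV vQ \w+ WL 1))
    (CIfR (ksE (WM uid (addrE vQ 0) \w- WL 1)) (ksE (WV vQ)) CSkip
       (CM uid (addrE vQ 0) (WV vQ \w+ WL 1))).

Definition insert := CFor false vQ (guard (not_pi vQ)
  (CIfR (RL 0) (coE (WV vQ)) CSkip (nest true pws insert_cell))).

Definition record := CR rV (valE np f e (WV vP) (WV vQ)) ;;
  seqC [seq CR (rX c) (candE np f e (WV vP) (WV vQ) c) | c <- iota 0 D] ;;
  seqC [seq CW (vOut i) (WV (vPi i)) | i <- iota 0 k'] ;;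
  CW (vOut k') (WV vP) ;; CW (vOut k'.+1) (WV vQ).

(** Candidates from all centers compete by their exact squared distance to [y], not by their bounds,
    so no pass makes the result worse. *)
Definition candidate :=
  CIfR (valE np f e (WV vP) (WV vQ)) (RV rV) record CSkip.

(* The nodes (p, rank / p + 1), p a power of 2, cover exactly the points of
   larger rank. *)
Definition query_cell := CIfW (WM uid (addrE vP 1)) (WL 0) CSkip
  (CW vQ (WM uid (addrE vP 1) \w- WL 1) ;; candidate).

Definition query := CFor false vP (guard (not_pi vP)
  (CIfR (coE (WV vP)) (RL 0) CSkip (nest true pws query_cell))).

Definition pi_pairs :=
  [seq (WV (vPi ij.1), WV (vPi ij.2)) | ij <- [seq (i, j) | i <- iota 0 k', j <- iota 0 k'] & ij.1 < ij.2].

Definition block := guard pi_pairs (ranks ;; insert ;; query).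

Definition nearest_pair := nest false pis block.

End BlockCode.

(** At the lowest level where the two numbers share a node, they lie in its left and right child,
    which are adjacent one level below. The nodes found for one [a] at different levels may overlap,
    which is harmless for a minimum. *)
Lemma exists_sibling n a b : a < b -> b < n ->
  exists2 i, i < up_log 2 n & b %/ 2 ^ i = a %/ 2 ^ i + 1.
Proof.
move=> ab bn.
have ex : exists i, a %/ 2 ^ i == b %/ 2 ^ i.
  exists (up_log 2 n); have nL : n <= 2 ^ up_log 2 n by exact: up_logP.
  by rewrite !divn_small // (leq_trans _ nL) // (ltn_trans ab).
case: (ex_minnP ex) => -[|i] /eqP E min.
  by move: ab; rewrite !expn0 !divn1 in E *; rewrite E ltnn.
have ne : a %/ 2 ^ i != b %/ 2 ^ i.
  by apply/negP => /min; rewrite ltnn.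
have le : a %/ 2 ^ i <= b %/ 2 ^ i by apply: leq_div2r; exact: ltnW.
rewrite expnSr !divnMA in E; exists i; last by lia.
rewrite ltnNge; apply/negP => /(leq_pexp2l (isT : 0 < 2)) h.
have nL : n <= 2 ^ i by apply: leq_trans h; exact: up_logP.
by move: ne; rewrite !divn_small ?eqxx // ?(leq_trans bn) // (ltn_trans ab) // (leq_trans bn).
Qed.

Lemma last_two i k : k <= i -> i < k.+2 -> i = k \/ i = k.+1.
Proof. lia. Qed.

(** * Correctness of the dominance search *)

Section BlockCorrect.
Variables (R : realType) (n w K : nat) (inp : nat -> R) (D' k' : nat).
Notation D := D'.+1.
Notation k := k'.+2.
Implicit Types s : store R.
Local Notation W := (2 ^ w)%N.
Local Notation runs := (runs n w K inp).
Local Notation pt := (pt D' inp).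
Variables (np : nat) (f : 'I_D -> 'I_D) (e : 'I_D -> bool) (t : bool) (uid aS : nat).
Variable Y : 'rV[R]_D.
Hypotheses (n1 : 1 < n) (np_k : np <= k') (np_D : np <= D').
Hypotheses (HW : 8 * n.+1 < W) (HD : n.+1 * D < W) (HA : n.+1 ^ (k' + 2 * D').+1 < W).
Hypotheses (HK : n.+1 ^ (k' + 2 * D').+1 * K <= W) (HK2 : n.+2 * K <= W).
Hypotheses (uidS : aS + D' < uid) (uidK : uid < K).

(* The best point found so far is the convex combination rX of the points
   numbered by the variables vOut. *)
Definition Best s := exists (J : 'I_k -> nat) (a : 'I_k -> R),
  [/\ injective J, forall i, J i < n, forall i : 'I_k, wv s (vOut (nat_of_ord i)) = J i,
   [/\ forall i, (0 <= a i)%R, (\sum_i a i = 1)%R &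
     forall c : 'I_D, rv s (rX (nat_of_ord c)) = (\sum_i a i * pt (J i) 0 c)%R]
   & rv s rV = (\sum_(c < D) (rv s (rX (nat_of_ord c)) - pt n 0 c) ^+ 2)%R].

(** Within [r] of [Y] means within [nrm (Y - pt n) + r] of the target. Squares are compared because
    the machine has no square root. *)
Definition bnd s (r : R) := (rv s rV <= (nrm (Y - pt n) + r) ^+ 2)%R.

Local Notation co vs := (coo pt Y np f e (nth 0 vs)).
Local Notation ky vs := (key pt Y np f e (nth 0 vs)).
Local Notation ks vs := (ksum pt Y np f e (nth 0 vs)).
Local Notation es vs := (est pt Y np f e (nth 0 vs)).

Definition prec vs i a b := (ky vs i a < ky vs i b)%R ||
  (ky vs i a == ky vs i b) && (if t then a < b else b < a).

Lemma prec_irr vs i : irreflexive (prec vs i).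
Proof. by move=> a; rewrite /prec ltxx eqxx /=; case: (t); rewrite ltnn. Qed.

Lemma prec_trans vs i : transitive (prec vs i).
Proof.
move=> b a c; rewrite /prec => /orP[ab|/andP[/eqP ab tab]] /orP[bc|/andP[/eqP bc tbc]].
- by rewrite (lt_trans ab bc).
- by rewrite -bc ab.
- by rewrite ab bc.
- rewrite ab bc eqxx /=; apply/orP; right.
  by case: (t) tab tbc => h1 h2; [exact: ltn_trans h1 h2 | exact: ltn_trans h2 h1].
Qed.

Lemma prec_total vs i a b : a != b -> prec vs i a b || prec vs i b a.
Proof.
rewrite /prec => ab; case: (ltgtP (ky vs i a) (ky vs i b)) => //= _.
by case: (t); case: (ltngtP a b) ab.
Qed.

Definition rho vs i z := below (prec vs (inord i)) (iota 0 n) z.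

Lemma rho_prec vs i a b : a < n -> prec vs (inord i) a b = (rho vs i a < rho vs i b).
Proof.
move=> an; apply: (prec_below (prec_irr vs _) (@prec_trans vs _) (@prec_total vs _)).
by rewrite mem_iota.
Qed.

Lemma rho_lt vs i z : z < n -> rho vs i z < n.
Proof.
move=> zn; rewrite -[X in _ < X](size_iota 0) below_lt_size ?mem_iota //.
exact: prec_irr.
Qed.

Definition digs vs z b ps := ps ++ [seq rho vs i z %/ nth 0 ps i + b | i <- iota 0 D'].

Lemma digs_inj vs1 z1 b1 ps1 vs2 z2 b2 ps2 : size ps1 = size ps2 ->
  digs vs1 z1 b1 ps1 = digs vs2 z2 b2 ps2 -> ps1 = ps2 /\
  forall i, i < D' -> rho vs1 i z1 %/ nth 0 ps1 i + b1 = rho vs2 i z2 %/ nth 0 ps2 i + b2.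
Proof.
move=> sz /eqP; rewrite /digs eqseq_cat // => /andP[/eqP E1 /eqP E2]; split=> // i iD.
have := congr1 (nth 0 ^~ i) E2.
by rewrite /= !(nth_map 0) ?size_iota // !nth_iota.
Qed.

Definition cell s vs ds := wm s uid (digval n (vs ++ ds)).

(** Quantified over all [vs], since the array is shared by all choices of the first points and is
    not cleared in between. *)
Definition tree_ok s := forall vs ds, size vs = k' -> all (ltn^~ n) vs ->
  size ds = (2 * D')%N -> all (leq^~ n) ds -> cell s vs ds = 0 \/
  exists q ps, [/\ cell s vs ds = q.+1, q < n, q \notin vs, (co vs ord_max q < 0)%R &
    size ps = D' /\ ds = digs vs q 0 ps].

Section Block.
Variable vs : seq nat.
Hypotheses (vs_size : size vs = k') (vs_lt : all (ltn^~ n) vs).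

Let vs_nth i : i < k' -> nth 0 vs i < n.
Proof. by rewrite -vs_size => h; apply: (allP vs_lt); apply: mem_nth. Qed.

Let W1 : 1 < W. Proof. by apply: leq_ltn_trans HW; rewrite muln_gt0. Qed.

Let W_le a : a <= n -> a < W.
Proof. by move=> h; apply: leq_ltn_trans HW; rewrite mulnS addnC; apply: leq_trans (leq_addr _ _); rewrite (leq_trans h) // leq_pmull. Qed.

Let W_lt1 a : a < n -> a + 1 < W.
Proof. by move=> h; rewrite addn1 W_le. Qed.

Let addr_lt A id : A < n.+1 ^ (k' + 2 * D').+1 -> id < K -> A * K + id < W.
Proof.
move=> An idK; apply: leq_trans HK; apply: (@leq_trans (A.+1 * K)).
  by rewrite mulSn addnC ltn_add2r.
by rewrite leq_mul2r An orbT.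
Qed.

Definition Ctx s := View k' Y (nth 0 vs) s /\
  forall i z, i < D' -> z < n -> wm s (aR aS i) z = rho vs i z.

Lemma Ctx_wset s (x : var) v : x.1 != 0 -> Ctx s -> Ctx (wset s x v).
Proof.
move=> x0 [[h1 h2] h3]; split=> //; split=> // i ik /=.
by rewrite ifN ?h1 //; apply: contraNneq x0 => <-.
Qed.

Lemma Ctx_mset s id A v : aS + D' < id -> Ctx s -> Ctx (mset s id A v).
Proof.
move=> hid [[h1 h2] h3]; split=> // i z iD zn /=.
by rewrite ifN ?h3 // /aR; apply/negP => /andP[/eqP]; lia.
Qed.

Let okv s x : wv s x < n -> okE n w K s (WV x).
Proof. by move=> h; rewrite /okE /= andbT (ltnW h) andbT W_le // ltnW. Qed.

Lemma prec_cmd_ok i s a b Q : View k' Y (nth 0 vs) s -> wv s vE < n -> wv s vZ < n ->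
  (prec vs i (wv s vE) (wv s vZ) -> runs a s Q) ->
  (~~ prec vs i (wv s vE) (wv s vZ) -> runs b s Q) ->
  runs (prec_cmd np f e t i a b) s Q.
Proof.
move=> Vs en zn Ha Hb.
have se := rsafe_key f e np_k W1 HD vs_nth Vs i (okv en).
have sz := rsafe_key f e np_k W1 HD vs_nth Vs i (okv zn).
have Ee := reval_key f e n inp np_k Vs i (WV vE); have Ez := reval_key f e n inp np_k Vs i (WV vZ).
apply: runs_ifR => //; rewrite Ee Ez /= => h1; last first.
  apply: Hb; rewrite /prec ltNge (ltW h1) /=.
  by rewrite eq_sym lt_eqF.
apply: runs_ifR => //; rewrite Ee Ez /= => h2; last first.
  by apply: Ha; rewrite /prec h2.
have E : ky vs i (wv s vE) == ky vs i (wv s vZ) by rewrite eq_le h1 h2.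
have pE : prec vs i (wv s vE) (wv s vZ) =
    (if t then wv s vE < wv s vZ else wv s vZ < wv s vE).
  by rewrite /prec ltNge h2 E.
have lW a' : a' < n -> (a' < W) && (a' + 1 < W).
  by move=> h; rewrite W_le ?W_lt1 // ltnW.
have /andP[e1 e2] := lW _ en; have /andP[z1 z2] := lW _ zn.
case: (t) pE => pE; apply: runs_ifW; rewrite /= ?e1 ?e2 ?z1 ?z2 ?W1 // addn1 => h3.
- by apply: Ha; rewrite pE.
- by apply: Hb; rewrite pE -leqNgt.
- by apply: Ha; rewrite pE.
- by apply: Hb; rewrite pE -leqNgt.
Qed.

Lemma ranks_ok s : View k' Y (nth 0 vs) s ->
  runs (ranks np f e t aS) s Ctx.
Proof.
move=> Vs; suff H j m s1 : j + m = D' -> View k' Y (nth 0 vs) s1 ->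
    (forall i z, i < j -> z < n -> wm s1 (aR aS i) z = rho vs i z) ->
    runs (seqC [seq rank_code aS (aR aS i) (prec_cmd np f e t (inord i)) | i <- iota j m]) s1 Ctx.
  exact: (H 0 D').
elim: m j s1 => [|m IH] j s1 jm V1 R1 /=.
  by split=> //; split=> // i z iD; apply: R1; rewrite -[j]addn0 jm.
apply: runs_seq; apply: runs_imp.
  apply: (@rank_ok aS (aR aS j) _ R n w K inp (prec vs (inord j)) (View k' Y (nth 0 vs))) => //.
  - exact: prec_irr.
  - exact: prec_trans.
  - exact: prec_total.
  - by rewrite /aR; lia.
  - by lia.
  - by rewrite /aR; lia.
  - move=> s2 s3 [f1 f2 f3] [h1 h2]; split=> [i ik|c]; first by rewrite f1 // h1.
    by rewrite f2 h2.
  - exact: prec_cmd_ok.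
move=> s2 _ [[f1 f2 f3] R2]; apply: IH; first by rewrite addSnnS.
- by case: V1 => h1 h2; split=> [i ik|c]; rewrite ?f1 ?h1 ?f2 ?h2.
- move=> i z; rewrite ltnS leq_eqVlt => /predU1P[->|ij] zn; first exact: R2.
  by rewrite f3 ?R1 // /aR; apply/eqP; lia.
Qed.

Definition powers ps := size ps = D' /\ {subset ps <= loop_range n true}.

Lemma powers_nth ps i : powers ps -> i < D' -> 0 < nth 0 ps i < n.
Proof.
move=> [sz sub] iD; have := sub (nth 0 ps i); rewrite mem_nth ?sz // => /(_ isT).
move=> /mapP[j]; rewrite mem_iota /= => jL ->; rewrite expn_gt0 /= ltnNge.
by apply/negP => /(up_log_min (isT : 1 < 2)); rewrite leqNgt jL.
Qed.

Lemma digs_le z b ps : powers ps -> z < n -> b <= 1 -> all (leq^~ n) (digs vs z b ps).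
Proof.
move=> Hps zn b1; rewrite all_cat; apply/andP; split.
  apply/(all_nthP 0) => i; rewrite (proj1 Hps) => iD /=.
  by have /andP[_ /ltnW] := powers_nth Hps iD.
rewrite all_map; apply/allP => i _ /=; have := rho_lt vs i zn.
by have := leq_div (rho vs i z) (nth 0 ps i); lia.
Qed.

Lemma size_digs z b ps : size ps = D' -> size (digs vs z b ps) = (2 * D')%N.
Proof. by move=> sz; rewrite size_cat size_map size_iota sz mul2n addnn. Qed.

Definition Pw ps s := forall i, i < D' -> wv s (vPw i) = nth 0 ps i.

Section Address.
Variables (s : store R) (ps : seq nat) (z : var) (b : nat).
Hypotheses (Cs : Ctx s) (Hps : powers ps) (Ps : Pw ps s) (zn : wv s z < n) (b1 : b <= 1).

Let digits_eq : [seq weval n s x | x <- [seq WV x | x <- pis k'] ++ [seq WV x | x <- pws D'] ++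
  [seq WM (aR aS i) (WV z) \w/ WV (vPw i) \w+ WL b | i <- iota 0 D']] =
  vs ++ digs vs (wv s z) b ps.
Proof.
rewrite !map_cat -!map_comp; congr (_ ++ (_ ++ _)).
- apply: (@eq_from_nth _ 0); rewrite size_map size_iota // => i ik.
  by rewrite (nth_map 0) ?size_iota // nth_iota //= (proj1 (proj1 Cs)).
- apply: (@eq_from_nth _ 0); rewrite size_map size_iota ?(proj1 Hps) // => i ik.
  by rewrite (nth_map 0) ?size_iota // nth_iota //= Ps.
- by apply/eq_in_map => i; rewrite mem_iota add0n => /= iD; rewrite (proj2 Cs) // Ps.
Qed.

Lemma weval_addr : weval n s (addrE D' k' aS z b) = digval n (vs ++ digs vs (wv s z) b ps).
Proof. by rewrite /addrE weval_digval digits_eq. Qed.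

Let all_le : all (leq^~ n) (vs ++ digs vs (wv s z) b ps).
Proof.
rewrite all_cat digs_le // andbT; apply/allP => v /(allP vs_lt) /=; exact: ltnW.
Qed.

Lemma addr_bound : weval n s (addrE D' k' aS z b) < n.+1 ^ (k' + 2 * D').+1.
Proof.
rewrite weval_addr; apply: leq_trans (digval_lt all_le) _.
by rewrite leq_pexp2l // size_cat vs_size size_digs ?(proj1 Hps).
Qed.

Lemma wsafe_addr : wsafe n w K s (addrE D' k' aS z b).
Proof.
apply: (wsafe_digval W1 _ HA); last by rewrite digits_eq.
  by rewrite !size_cat !size_map !size_iota; lia.
rewrite !all_cat !all_map; apply/and3P; split; apply/allP => i; rewrite ?mem_iota add0n /= => iD.
- by rewrite andbT (proj1 (proj1 Cs)) // W_le // ltnW // vs_nth.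
- by have /andP[_ h] := powers_nth Hps iD; rewrite andbT Ps // W_le // ltnW.
- have /andP[p0 pn] := powers_nth Hps iD.
  have aK : aR aS i < K by apply: ltn_trans uidK; apply: leq_ltn_trans uidS; rewrite /aR addSnnS leq_add2l.
  have r_n : rho vs i (wv s z) %/ nth 0 ps i < n.
    by apply: leq_ltn_trans (leq_div _ _) (rho_lt vs i zn).
  have aKW : wv s z * K + aR aS i < W.
    apply: leq_trans HK2; apply: (@leq_trans ((wv s z).+1 * K)).
      by rewrite mulSn addnC ltn_add2r.
    by rewrite leq_mul2r; apply/orP; right; apply: ltnW; rewrite ltnS ltnW // ltnS.
  have rb : rho vs i (wv s z) %/ nth 0 ps i + b <= n by rewrite (leq_trans (leq_add (leqnn _) b1)) // addn1.
  have r_le := ltnW (rho_lt vs i zn).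
  by rewrite Ps // (proj2 Cs) // (W_le rb) (W_le (ltnW r_n)) (W_le r_le) (W_le (ltnW zn)) (W_le (ltnW pn))
    (W_le (leq_trans b1 (ltnW n1))) aK aKW.
Qed.

Lemma wsafe_cell : wm s uid (weval n s (addrE D' k' aS z b)) <= n ->
  wsafe n w K s (WM uid (addrE D' k' aS z b)).
Proof.
by move=> h; rewrite /= wsafe_addr uidK addr_lt ?addr_bound // !andbT W_le.
Qed.

End Address.

Definition good qps s := let: (q, ps) := qps in
  exists2 r, cell s vs (digs vs q 0 ps) = r.+1 & (ks vs r <= ks vs q)%R.

Lemma insert_cell_ok s ps q : Ctx s -> tree_ok s -> powers ps -> Pw ps s ->
  wv s vQ = q -> q < n -> q \notin vs -> (co vs ord_max q < 0)%R ->
  runs (insert_cell k' np f e uid aS) s (fun s' =>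
    [/\ Ctx s' /\ tree_ok s', good (q, ps) s' & forall qps, good qps s -> good qps s']).
Proof.
move=> Cs Ts Hps Ps sq qn qvs coq.
have zn : wv s vQ < n by rewrite sq.
have Ea := weval_addr 0 Cs Hps Ps zn; rewrite sq in Ea.
have sa := wsafe_addr Cs Hps Ps zn (leq0n 1).
set A := digval n (vs ++ digs vs q 0 ps) in Ea.
have cE : wm s uid A = cell s vs (digs vs q 0 ps) by [].
have sz2 : size (digs vs q 0 ps) = (2 * D')%N by rewrite size_digs ?(proj1 Hps).
have dl : all (leq^~ n) (digs vs q 0 ps) by exact: digs_le.
have Tc := Ts vs (digs vs q 0 ps) vs_size vs_lt sz2 dl.
have cn : wm s uid A <= n.
  by rewrite cE; case: Tc => [->|[q' [ps' [-> ? _ _ _]]]].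
have vl us : all (ltn^~ n) us -> all (leq^~ n) us.
  by move=> h; apply/allP => v /(allP h) /=; exact: ltnW.
(* Writing [q] occurs in two cases, an empty cell and a larger key sum. In both, the goals already
   attached to the cell survive. *)
have store_ok : (forall qps, good qps s -> cell s vs (digs vs qps.1 0 qps.2) = wm s uid A ->
      digval n (vs ++ digs vs qps.1 0 qps.2) = A -> (ks vs q <= ks vs qps.1)%R) ->
    runs (CM uid (addrE D' k' aS vQ 0) (WV vQ \w+ WL 1)) s (fun s' =>
    [/\ Ctx s' /\ tree_ok s', good (q, ps) s' & forall qps, good qps s -> good qps s']).
  move=> better; apply: runs_M => //.
  - by rewrite /= sq W1 andbT W_lt1 // W_le // ltnW.
  - by rewrite addr_lt // (addr_bound Cs Hps Ps).
  rewrite Ea /=; rewrite sq addn1; split.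
  - split; first exact: Ctx_mset.
    move=> us ds szu ul szd dl'; rewrite /cell /= eqxx /=.
    case: eqP => [E|_]; last exact: Ts.
    (* The address determines the key, so only the intended cell has changed. *)
    right; have /eqP : us ++ ds = vs ++ digs vs q 0 ps.
      apply: digval_inj E; first by rewrite size_cat szu szd size_cat vs_size sz2.
        by rewrite all_cat dl' vl.
      by rewrite all_cat dl vl.
    by rewrite eqseq_cat ?szu ?vs_size // => /andP[/eqP -> /eqP ->]; exists q, ps; split=> //; case: Hps.
  - by exists q => //; rewrite /cell /= !eqxx.
  - move=> [q' ps'] g; have := better (q', ps') g; case: g => r cr kr /=.
    rewrite /good /cell /= eqxx /=; case: eqP => [E|_] h; last by exists r.
    exists q => //; apply: h => //; by rewrite /cell E.
apply: runs_ifW.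
- by apply: (wsafe_cell Cs Hps Ps zn (leq0n 1)); rewrite Ea.
- by rewrite /= ltnW.
- rewrite /= Ea leqn0 => /eqP c0; apply: store_ok => -[q' ps'] [r cr _] /= E _.
  by move: cr; rewrite E c0.
rewrite /= Ea => cpos.
have [r cr] : exists r, wm s uid A = r.+1 by case: (wm s uid A) cpos => // r _; exists r.
have rn : r < n by rewrite -cr.
have er : weval n s (WM uid (addrE D' k' aS vQ 0) \w- WL 1) = r by rewrite /= Ea cr subn1.
have sr : okE n w K s (WM uid (addrE D' k' aS vQ 0) \w- WL 1).
  rewrite /okE er (ltnW rn) andbT; apply/and3P; split; first by rewrite er W_le // ltnW.
    by apply: (wsafe_cell Cs Hps Ps zn (leq0n 1)); rewrite Ea.
  by rewrite /= W1.
have sq' := okv zn.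
apply: runs_ifR; first exact: (rsafe_ksum f e np_k W1 HD vs_nth Cs.1 sr).
- exact: (rsafe_ksum f e np_k W1 HD vs_nth Cs.1 sq').
- rewrite !(reval_ksum f e n inp np_k Cs.1) er [weval _ _ (WV _)]/= sq => le.
  split=> //; split=> //; exists r => //; by rewrite -cE.
rewrite !(reval_ksum f e n inp np_k Cs.1) er [weval _ _ (WV _)]/= sq => lt.
apply: store_ok => -[q' ps'] [r' cr' kr'] /= E _.
by apply: le_trans (ltW lt) _; move: cr'; rewrite E cr => -[->].
Qed.

Let nth_vs i : i < k' -> nth 0 vs i \in vs.
Proof. by move=> ik; rewrite mem_nth ?vs_size. Qed.

Lemma not_piE (z : var) s : View k' Y (nth 0 vs) s ->
  all (fun ab => weval n s ab.1 != weval n s ab.2) (not_pi k' z) = (wv s z \notin vs).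
Proof.
move=> Vs; rewrite /not_pi /pis -map_comp all_map; apply/allP/idP => [h|h i].
  apply/negP => zv; have ik : index (wv s z) vs < k' by rewrite -vs_size index_mem.
  have := h (index (wv s z) vs); rewrite mem_iota /= ik (proj1 Vs) // nth_index // eqxx.
  by move=> /(_ isT).
rewrite mem_iota /= => ik; rewrite (proj1 Vs) //.
by apply: contraNneq h => ->; apply: nth_vs.
Qed.

Lemma wsafe_not_pi (z : var) s : View k' Y (nth 0 vs) s -> wv s z < n ->
  all (fun ab => wsafe n w K s ab.1 && wsafe n w K s ab.2) (not_pi k' z).
Proof.
move=> Vs zn; rewrite /not_pi /pis -map_comp all_map; apply/allP => i.
by rewrite mem_iota /= => ik; rewrite (proj1 Vs) // !W_le // ltnW // vs_nth.
Qed.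

Lemma pws_uniq : uniq (pws D').
Proof. by rewrite map_inj_uniq ?iota_uniq // => i j []. Qed.

Lemma pws_nth i : i < D' -> nth (0, 0) (pws D') i = vPw i.
Proof. by move=> iD; rewrite (nth_map 0) ?size_iota // nth_iota. Qed.

Lemma powersP ps (s : store R) : size ps = size (pws D') -> {subset ps <= loop_range n true} ->
  (forall i, i < size (pws D') -> wv s (nth (0, 0) (pws D') i) = nth 0 ps i) ->
  powers ps /\ Pw ps s.
Proof.
rewrite size_map size_iota => sz sub h; split=> // i iD.
by rewrite -h // pws_nth.
Qed.

Lemma insert_ok s : Ctx s -> tree_ok s -> runs (insert k' np f e uid aS) s (fun s' =>
  [/\ Ctx s', tree_ok s' & forall q ps, q < n -> q \notin vs -> (co vs ord_max q < 0)%R ->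
     powers ps -> good (q, ps) s']).
Proof.
move=> Cs Ts; apply: runs_imp.
  apply: (runs_for (I := fun s => Ctx s /\ tree_ok s) (G := fun q s => q \notin vs ->
     (co vs ord_max q < 0)%R -> forall ps, powers ps -> good (q, ps) s)); first by [].
  move=> q s1; rewrite mem_iota add0n => /= qn [C1 T1].
  set s2 := wset s1 vQ q.
  have C2 : Ctx s2 by exact: Ctx_wset.
  have q2 : wv s2 vQ = q by [].
  have wq : weval n s2 (WV vQ) = q by [].
  have qn2 : wv s2 vQ < n by rewrite q2.
  have G2 qps : good qps s1 -> good qps s2 by case: qps.
  apply: runs_guard; first exact: wsafe_not_pi C2.1 qn2.
    rewrite (not_piE vQ C2.1) q2 => qvs; apply: runs_ifR.
    - by rewrite /= ltnW.
    - exact: (rsafe_coo f e np_k W1 HD vs_nth C2.1 _ (okv qn2)).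
    - rewrite (reval_coo f e n inp np_k C2.1) wq => ge; split=> //; split=> //.
      by move=> _; rewrite ltNge [X in ~~ X]ge.
    rewrite (reval_coo f e n inp np_k C2.1) wq [reval _ _ _ _]/= => lt.
    apply: runs_imp.
      apply: (runs_nest (emb := fun ps => (q, ps)) (G := good)
         (I := fun s => [/\ Ctx s, tree_ok s & wv s vQ = q])); first exact: pws_uniq.
      - move=> x xp; apply/negP => xm; move: xp => /mapP[i _ E]; move: xm.
        by rewrite E /insert_cell /=.
      - move=> x i s3 /mapP[j _ ->] [C3 T3 q3]; split=> //; exact: Ctx_wset.
      - by move=> x i [q' ps'] s3 _.
      - move=> ps s3 szp sub pv [C3 T3 q3]; have [Hps Ps] := powersP szp sub pv.
        apply: runs_imp; first exact: (insert_cell_ok C3 T3 Hps Ps q3 qn qvs lt).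
        move=> s4 E [[C4 T4] g4 m4]; split=> //; split=> //.
        by rewrite E wv_frame.
      - by [].
    move=> s3 _ [[C3 T3 _] g3 m3]; split=> //.
    - move=> _ _ ps [szp sub]; apply: g3 => //; by rewrite size_map size_iota.
    - by move=> j gj jvs cj ps Hps; apply: (m3 (j, ps)); apply: G2; apply: gj.
  rewrite (not_piE vQ C2.1) q2 negbK => qvs; split=> //.
  by rewrite qvs.
move=> s1 _ [[C1 T1] G1 _]; split=> // q ps qn qvs cq Hps.
by apply: G1; rewrite ?mem_iota.
Qed.
Definition frC s s' := [/\ forall x : var, x.1 != 2 -> wv s' x = wv s x,
  forall x : var, x.1 \notin [:: 1; 2] -> rv s' x = rv s x & wm s' = wm s].

Lemma frC_trans s1 s2 s3 : frC s1 s2 -> frC s2 s3 -> frC s1 s3.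
Proof.
move=> [a1 a2 a3] [b1 b2 b3]; split=> [x h|x h|].
- by rewrite b1 // a1.
- by rewrite b2 // a2.
- by rewrite b3.
Qed.

Lemma frC_View s s' : frC s s' -> View k' Y (nth 0 vs) s -> View k' Y (nth 0 vs) s'.
Proof. by move=> [f1 f2 _] [h1 h2]; split=> [i ik|c]; rewrite ?f1 ?h1 ?f2 ?h2. Qed.

Lemma frC_wset s i v : frC s (wset s (2, i) v).
Proof. by split=> // -[a b] /= h; rewrite xpair_eqE (negbTE h). Qed.

Lemma frC_rset s i j v : i \in [:: 1; 2] -> frC s (rset s (i, j) v).
Proof.
move=> ii; split=> // -[a b] h; rewrite /= xpair_eqE.
by case: eqP h => // ->; rewrite ii.
Qed.

Section Record.
Variables (p q : nat) (s0 : store R).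
Hypotheses (V0 : View k' Y (nth 0 vs) s0) (p0 : wv s0 vP = p) (q0 : wv s0 vQ = q).
Hypotheses (pn : p < n) (qn : q < n).
Let x := cand pt Y np f e (nth 0 vs) p q.

Let frP s : frC s0 s -> [/\ View k' Y (nth 0 vs) s, okE n w K s (WV vP), okE n w K s (WV vQ)
  & weval n s (WV vP) = p /\ weval n s (WV vQ) = q].
Proof.
move=> f0; have Vs := frC_View f0 V0; case: f0 => f1 f2 f3.
have p1 : wv s vP = p by rewrite f1.
have q1 : wv s vQ = q by rewrite f1.
by split=> //; apply: okv; rewrite ?p1 ?q1.
Qed.

Lemma set_cand l s : uniq l -> all (ltn^~ D) l -> frC s0 s ->
  runs (seqC [seq CR (rX c) (candE np f e (WV vP) (WV vQ) c) | c <- l]) s (fun s' =>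
    [/\ frC s0 s', wv s' = wv s, rv s' rV = rv s rV,
        forall c, c \in l -> rv s' (rX c) = x 0%R (inord c)
      & forall c, c \notin l -> rv s' (rX c) = rv s (rX c)]).
Proof.
elim: l s => [|c l IH] s //= /andP[cl U] /andP[cD lD] f0.
have [Vs okp okq [p1 q1]] := frP f0.
apply: runs_seq; apply: runs_R; first exact: (rsafe_cand f e np_k W1 HD vs_nth Vs okp okq cD).
rewrite (reval_cand _ _ _ _ np_k Vs) // p1 q1; set s1 := rset _ _ _.
have f1 : frC s s1 by exact: frC_rset.
apply: runs_imp; first exact: (IH s1 U lD (frC_trans f0 f1)).
move=> s' _ [g1 g2 g3 g4 g5]; split=> // [j|j].
  rewrite inE; case: eqP => [->|_ /=]; last exact: g4.
  by rewrite g5 //= eqxx.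
rewrite inE negb_or => /andP[jc jl]; rewrite g5 //= xpair_eqE /=.
by rewrite (negbTE jc).
Qed.

Lemma set_out l s : uniq l -> all (ltn^~ k') l -> frC s0 s ->
  runs (seqC [seq CW (vOut i) (WV (vPi i)) | i <- l]) s (fun s' =>
    [/\ frC s0 s', rv s' = rv s, forall i, i \in l -> wv s' (vOut i) = nth 0 vs i
      & forall i, i \notin l -> wv s' (vOut i) = wv s (vOut i)]).
Proof.
elim: l s => [|c l IH] s //= /andP[cl U] /andP[cD lD] f0.
have [Vs _ _ _] := frP f0.
apply: runs_seq; apply: runs_W.
  by rewrite /= (proj1 Vs) // W_le // ltnW // vs_nth.
rewrite /= (proj1 Vs) //; set s1 := wset _ _ _.
apply: runs_imp; first exact: (IH s1 U lD (frC_trans f0 (frC_wset _ _ _))).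
move=> s' _ [g1 g2 g3 g4]; split=> // [j|j].
  rewrite inE; case: eqP => [->|_ /=]; last exact: g3.
  by rewrite g4 //= eqxx.
rewrite inE negb_or => /andP[jc jl]; rewrite g4 //= xpair_eqE /=.
by rewrite (negbTE jc).
Qed.

Hypotheses (vs_uniq : uniq vs) (p_vs : p \notin vs) (q_vs : q \notin vs).
Hypotheses (p_pos : (0 < co vs ord_max p)%R) (q_neg : (co vs ord_max q < 0)%R).
Hypothesis key_le : forall i, i != ord_max -> (ky vs i p <= ky vs i q)%R.

Let J (i : 'I_k) := nth 0 (vs ++ [:: p; q]) i.

Let J_inj : injective J.
Proof.
have U : uniq (vs ++ [:: p; q]).
  rewrite cat_uniq vs_uniq /= (negbTE p_vs) (negbTE q_vs) /= mem_seq1 andbT.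
  (* [p] and [q] differ because their last coordinates have opposite signs. *)
  by apply: contraTneq p_pos => ->; rewrite -leNgt ltW.
move=> i j /eqP; rewrite /J nth_uniq //; first by move/eqP/val_inj.
- by rewrite size_cat vs_size addn2.
- by rewrite size_cat vs_size addn2.
Qed.

Let J_lt i : J i < n.
Proof.
apply: (@allP _ (ltn^~ n) (vs ++ [:: p; q])); last first.
  by apply: mem_nth; rewrite size_cat vs_size addn2.
by rewrite all_cat vs_lt /= pn qn.
Qed.

(** The weights of [cand] in the output order [vs], [p], [q]: the weight of [p] comes from the
    coordinate of [q] and conversely, and points of [vs] from position [np] on get 0. *)
Let wts (i : 'I_k) : R := ((mass pt Y np f e (nth 0 vs) p q)^-1 *
  (if (i < np)%N then wt pt Y np f e (nth 0 vs) p q (inord i)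
   else if (i < k')%N then 0 else if i == k' :> nat then - co vs ord_max q
   else co vs ord_max p))%R.

Let wts_sum (g : nat -> R) : (\sum_i wts i * g (J i) =
  (mass pt Y np f e (nth 0 vs) p q)^-1 *
  (co vs ord_max p * g q - co vs ord_max q * g p +
   \sum_(i < D | (i < np)%N) wt pt Y np f e (nth 0 vs) p q i * g (nth 0%N vs i)))%R.
Proof.
rewrite big_ord_recr big_ord_recr /= /wts /J /= ltnn eqxx.
have h1 : (k' < np)%N = false by rewrite ltnNge np_k.
have h2 : (k'.+1 < np)%N = false by rewrite ltnNge leqW.
have h3 : (k'.+1 < k')%N = false by rewrite ltnNge leqnSn.
have h4 : (k'.+1 == k') = false by apply/negbTE; rewrite neq_ltn ltnSn orbT.
rewrite h1 h2 h3 h4 !nth_cat !vs_size ltnn h3 subnn subSnn /=.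
have -> : (\sum_(i < D | (i < np)%N) wt pt Y np f e (nth 0 vs) p q i * g (nth 0%N vs i) =
   \sum_(i < np) wt pt Y np f e (nth 0 vs) p q (inord i) * g (nth 0%N vs i))%R.
  rewrite (big_ord_widen D (fun i => wt pt Y np f e (nth 0 vs) p q (inord i) * g (nth 0%N vs i))%R); last exact: leqW.
  by apply: eq_bigr => i _; rewrite inord_val.
rewrite (big_ord_widen k' (fun i => wt pt Y np f e (nth 0 vs) p q (inord i) * g (nth 0%N vs i))%R) //.
rewrite [X in (X + _ + _)%R](_ : _ = (mass pt Y np f e (nth 0 vs) p q)^-1 *
    \sum_(i < k' | (i < np)%N) wt pt Y np f e (nth 0 vs) p q (inord i) * g (nth 0%N vs i))%R.
  by ring.
rewrite mulr_sumr [RHS]big_mkcond; apply: eq_bigr => i _ /=.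
by rewrite ltn_ord nth_cat vs_size ltn_ord; case: ifP => _; rewrite ?mulr0 ?mul0r // mulrA.
Qed.

Lemma record_ok : runs (record k' np f e) s0 (fun s' =>
  [/\ frC s0 s', Best s' & rv s' rV = sq (x - pt n)]).
Proof.
have [Vs okp okq [p1 q1]] := frP (And3 (fun _ _ => erefl) (fun _ _ => erefl) erefl : frC s0 s0).
have okn : okE n w K s0 WN by rewrite /okE /= W_le ?leqnn.
apply: runs_seq; apply: runs_R; first exact: (rsafe_val f e np_k W1 HD vs_nth Vs okp okq okn).
rewrite (reval_val _ _ _ _ np_k Vs) p1 q1 -/x.
have -> : (\sum_c (x 0 c - pt n 0 c) ^+ 2 = sq (x - pt n))%R.
  by rewrite /sq; apply: eq_bigr => c _; rewrite !mxE.
set s1 := rset _ _ _.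
have f1 : frC s0 s1 by exact: frC_rset.
apply: runs_seq; apply: runs_imp.
  apply: (set_cand (iota_uniq 0 D) _ f1); apply/allP => c; by rewrite mem_iota.
move=> s2 _ [f2 w2 v2 x2 _].
apply: runs_seq; apply: runs_imp.
  apply: (set_out (iota_uniq 0 k') _ f2); apply/allP => c; by rewrite mem_iota.
move=> s3 _ [f3 v3 o3 _].
have [_ _ _ [p3 q3]] := frP f3.
apply: runs_seq; apply: runs_W; first by rewrite /= [wv s3 _]p3 W_le // ltnW.
rewrite p3; set s4 := wset s3 _ _.
have f4 : frC s0 s4 by exact: frC_trans f3 (frC_wset _ _ _).
have [_ _ _ [_ q4]] := frP f4.
apply: runs_W; first by rewrite -[wsafe _ _ _ _ _]/((weval n s4 (WV vQ) < W) && true) q4 W_le // ltnW.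
rewrite q4; set s5 := wset s4 _ _.
have f5 : frC s0 s5 by exact: frC_trans f4 (frC_wset _ _ _).
have r5 : rv s5 = rv s2 by rewrite -v3.
have rV5 : rv s5 rV = sq (x - pt n) by rewrite r5 v2.
have rX5 (c : 'I_D) : rv s5 (rX (nat_of_ord c)) = x 0%R c.
  by rewrite r5 x2 ?inord_val // mem_iota /= add0n.
split=> //; exists J, wts; split=> //.
- move=> i; rewrite /J nth_cat vs_size /=; have [ik|ki] := ltnP i k'.
    by rewrite !xpair_eqE /= (ltn_eqF (leqW ik)) (ltn_eqF ik) o3 // mem_iota.
  case: (last_two ki (ltn_ord i)) => ->; rewrite !xpair_eqE /= ?eqxx ?subnn ?subSnn //.
  by rewrite (ltn_eqF (ltnSn k')).
- have M0 := mass_gt0 np_D p_pos q_neg key_le.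
  split.
  + move=> i; rewrite /wts mulr_ge0 ?invr_ge0 ?(ltW M0) //.
    case: ifP => [inp'|_].
      have iD : i < D by rewrite (leq_trans inp') // leqW.
      apply: (wt_ge0 p_pos q_neg key_le).
      by rewrite -val_eqE /= inordK // ltn_eqF // (leq_trans inp').
    by case: ifP => // _; case: ifP => _; rewrite ?oppr_ge0 ltW.
  + have := wts_sum (fun=> 1%R); rewrite (eq_bigr wts) => [->|i _]; last by rewrite mulr1.
    rewrite !mulr1 (eq_bigr (wt pt Y np f e (nth 0 vs) p q)) => [|i _]; last by rewrite mulr1.
    by rewrite -/(mass pt Y np f e (nth 0 vs) p q) mulVf // lt0r_neq0.
  + move=> c; rewrite rX5 (wts_sum (fun i => pt i 0%R c)) /x /cand mxE; congr (_ * _)%R.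
    rewrite !mxE summxE; congr (_ + _)%R.
    by apply: eq_bigr => i _; rewrite mxE.
- rewrite rV5 /sq; apply: eq_bigr => c _; by rewrite rX5 !mxE.
Qed.

(** The triangle inequality through [Y], with [cand_l1] and the l1 norm dominating the Euclidean
    one. If the candidate is rejected, the old value of [rV] is smaller still. *)
Lemma candidate_ok : Best s0 -> runs (candidate k' np f e) s0 (fun s' =>
  [/\ frC s0 s', Best s', (rv s' rV <= rv s0 rV)%R & bnd s' (es vs p q)]).
Proof.
move=> B0.
have [Vs okp okq [p1 q1]] := frP (And3 (fun _ _ => erefl) (fun _ _ => erefl) erefl : frC s0 s0).
have okn : okE n w K s0 WN by rewrite /okE /= W_le ?leqnn.
have valE : reval n inp s0 (valE np f e (WV vP) (WV vQ)) = sq (x - pt n).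
  rewrite (reval_val _ _ _ _ np_k Vs) p1 q1 -/x /sq.
  by apply: eq_bigr => c _; rewrite !mxE.
have le : (sq (x - pt n) <= (nrm (Y - pt n) + es vs p q) ^+ 2)%R.
  have cl := cand_l1 np_D p_pos q_neg key_le; rewrite -/x in cl.
  have e0 : (0 <= es vs p q)%R by apply: le_trans (l1_ge0 _) cl.
  rewrite -sqr_nrm ler_pXn2r ?nnegrE ?addr_ge0 ?nrm_ge0 //.
  rewrite -(subrKA Y x) addrC; apply: le_trans (nrmD _ _) _; rewrite lerD2l.
  exact: le_trans (nrm_l1 _) cl.
apply: runs_ifR => //; first exact: (rsafe_val f e np_k W1 HD vs_nth Vs okp okq okn).
- rewrite valE /= => better; apply: runs_imp; first exact: record_ok.
  by move=> s' _ [f1 b1 v1]; split=> //; rewrite /bnd v1.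
- by rewrite valE /= => worse; split=> //; split=> //; apply: le_trans (ltW worse) le.
Qed.

End Record.
Definition all_good s := forall q ps, q < n -> q \notin vs -> (co vs ord_max q < 0)%R ->
  powers ps -> good (q, ps) s.

Definition Inv s := [/\ Ctx s, tree_ok s, all_good s & Best s].

Lemma Best_eq s s' : (forall i, wv s' (vOut i) = wv s (vOut i)) ->
  (forall x : var, x.1 \in [:: 1; 2] -> rv s' x = rv s x) -> Best s -> Best s'.
Proof.
move=> hw hr [J [a [h1 h2 h3 [h4 h5 h6] h7]]]; exists J, a; split=> //.
- by move=> i; rewrite hw.
- by split=> // c; rewrite hr.
- by rewrite hr // h7; apply: eq_bigr => c _; rewrite hr.
Qed.

Lemma tree_eq s s' : wm s' uid = wm s uid -> (tree_ok s -> tree_ok s') /\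
  (all_good s -> all_good s').
Proof. by move=> E; rewrite /tree_ok /all_good /good /cell E. Qed.

Lemma Inv_wset s (x : var) v : x.1 \notin [:: 0; 2] -> Inv s -> Inv (wset s x v).
Proof.
rewrite !inE negb_or => /andP[x0 x2] [h1 h2 h3 h4]; split=> //; first exact: Ctx_wset.
apply: Best_eq h4 => // i; rewrite /= ifN //.
by apply: contraNneq x2 => <-.
Qed.

Lemma bnd_le s s' r r' : (rv s' rV <= rv s rV)%R -> (0 <= r)%R -> (r <= r')%R ->
  bnd s r -> bnd s' r'.
Proof.
move=> le r0 rr h; apply: le_trans le _; apply: le_trans h _.
by rewrite ler_pXn2r ?nnegrE ?addr_ge0 ?nrm_ge0 ?(le_trans r0) // lerD2l.
Qed.

Lemma es_ge0 p q : (0 < co vs ord_max p)%R ->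
  (forall i, i < D' -> prec vs (inord i) p q) -> (0 <= es vs p q)%R.
Proof.
move=> pp kl; rewrite /est mulr_ge0 ?(ltW pp) // subr_ge0; apply: ler_sum => i /andP[_ im].
have iD : i < D' by move: im; rewrite -val_eqE /= => im; have := ltn_ord i; rewrite ltnS leq_eqVlt (negbTE im).
have := kl i iD; rewrite inord_val /prec => /orP[/ltW //|/andP[/eqP -> _]//].
Qed.

Definition sibling ps p q := forall i, i < D' ->
  rho vs i q %/ nth 0 ps i = rho vs i p %/ nth 0 ps i + 1.

Lemma sibling_prec ps p q : p < n -> powers ps -> sibling ps p q ->
  forall i, i < D' -> prec vs (inord i) p q.
Proof.
move=> pn Hps sib i iD; rewrite rho_prec // ltnNge; apply/negP => le.
have := leq_div2r (nth 0 ps i) le.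
by rewrite sib // addn1 ltnn.
Qed.

(** The level of the separating node differs from key to key, so it is chosen for each key
    separately. *)
Lemma exists_powers p q : p < n -> q < n -> (forall i, i < D' -> prec vs (inord i) p q) ->
  exists2 ps, powers ps & sibling ps p q.
Proof.
move=> pn qn h.
have H i : exists j, i < D' -> j < up_log 2 n /\ rho vs i q %/ 2 ^ j = rho vs i p %/ 2 ^ j + 1.
  have [iD|] := ltnP i D'; last by exists 0.
  have := h i iD; rewrite rho_prec // => lt.
  by have [j j1 j2] := exists_sibling lt (rho_lt vs i qn); exists j.
have [g gP] := boolp.choice H.
exists [seq 2 ^ g i | i <- iota 0 D'].
  split; first by rewrite size_map size_iota.
  move=> x /mapP[i]; rewrite mem_iota /= => iD ->.
  by rewrite map_f // mem_iota /=; case: (gP i iD).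
move=> i iD; rewrite (nth_map 0) ?size_iota // nth_iota //.
by case: (gP i iD).
Qed.

(** The stored point [r] lies in the same node as each [q] it stands for; hence its keys also
    dominate those of [p] and the pair is admissible. As [ks vs r <= ks vs q], the bound [es vs p r]
    is at most [es vs p q]. *)
Lemma query_cell_ok s ps p : Inv s -> powers ps -> Pw ps s -> wv s vP = p -> p < n ->
  uniq vs -> p \notin vs -> (0 < co vs ord_max p)%R ->
  runs (query_cell k' np f e uid aS) s (fun s' =>
    [/\ Inv s', (rv s' rV <= rv s rV)%R & forall q, q < n -> q \notin vs ->
       (co vs ord_max q < 0)%R -> sibling ps p q -> bnd s' (es vs p q)]).
Proof.
move=> Is Hps Ps sp pn U pvs pp; have [Cs Ts Gs Bs] := Is.
have zn : wv s vP < n by rewrite sp.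
have Ea := weval_addr 1 Cs Hps Ps zn; rewrite sp in Ea.
set A := digval n (vs ++ digs vs p 1 ps) in Ea.
have sz2 : size (digs vs p 1 ps) = (2 * D')%N by rewrite size_digs ?(proj1 Hps).
have dl : all (leq^~ n) (digs vs p 1 ps) by exact: digs_le.
have sib_digs q : sibling ps p q -> digs vs q 0 ps = digs vs p 1 ps.
  move=> sib; congr (_ ++ _); apply/eq_in_map => i; rewrite mem_iota /= => iD.
  by rewrite addn0 sib.
have cE : wm s uid A = cell s vs (digs vs p 1 ps) by [].
have Tc := Ts vs (digs vs p 1 ps) vs_size vs_lt sz2 dl.
have cn : wm s uid A <= n.
  by rewrite cE; case: Tc => [->|[q' [ps' [-> ? _ _ _]]]].
have sc : wsafe n w K s (WM uid (addrE D' k' aS vP 1)).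
  by apply: (wsafe_cell Cs Hps Ps zn (leqnn 1)); rewrite Ea.
apply: runs_ifW => //; first by rewrite /= ltnW.
  rewrite /= Ea leqn0 => /eqP c0; split=> //; split=> // q qn qvs cq sib.
  by have [r] := Gs q ps qn qvs cq Hps; rewrite (sib_digs _ sib) -cE c0.
rewrite /= Ea => cpos.
case: Tc => [c0|[r [ps' [cr rn rvs cor [szp' dE]]]]]; first by rewrite cE c0 in cpos.
have er : weval n s (WM uid (addrE D' k' aS vP 1) \w- WL 1) = r.
  by rewrite /= Ea cE cr subn1.
apply: runs_seq; apply: runs_W.
  apply/and3P; split; first by rewrite er W_le // ltnW.
    exact: sc.
  by rewrite /= W1.
rewrite er; set s1 := wset s vQ r.
have I1 : Inv s1 by exact: Inv_wset.
have [C1 T1 G1 B1] := I1.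
have [psE digE] : ps = ps' /\ forall i, i < D' ->
    rho vs i p %/ nth 0 ps i + 1 = rho vs i r %/ nth 0 ps' i + 0.
  by apply: digs_inj dE; rewrite szp' (proj1 Hps).
have sib_r : sibling ps p r by move=> i iD; rewrite digE // psE addn0.
have pr := sibling_prec pn Hps sib_r.
have kl i : i != ord_max -> (ky vs i p <= ky vs i r)%R.
  move=> im; have iD : i < D'.
    by move: im; rewrite -val_eqE /= => im; have := ltn_ord i; rewrite ltnS leq_eqVlt (negbTE im).
  have := pr i iD; rewrite inord_val /prec => /orP[/ltW //|/andP[/eqP -> _]//].
apply: runs_imp.
  by apply: (@candidate_ok p r s1 C1.1 _ _ pn rn U pvs rvs pp cor kl B1).
move=> s2 _ [f2 B2 le2 b2].
have [t2 g2] := @tree_eq s1 s2 (congr1 (fun m => m uid) (let: And3 _ _ h := f2 in h)).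
split.
- split; [|exact: t2 T1|exact: g2 G1|exact: B2].
  split; first exact: frC_View f2 C1.1.
  by case: f2 => _ _ ->; exact: C1.2.
- exact: le2.
- move=> q qn qvs cq sib; apply: bnd_le b2 => //; first exact: es_ge0.
  have [r' cr' kr'] := Gs q ps qn qvs cq Hps.
  move: cr'; rewrite (sib_digs _ sib) cr => -[E]; rewrite -E in kr'.
  by rewrite /est ler_pM2l // lerB.
Qed.

Lemma wmods_query_cell :
  all (fun x : var => (x.1 == 2) || (x == vQ)) (wmods (query_cell k' np f e uid aS)).
Proof.
rewrite /= !all_cat /= andbT wmods_seqCR wmods_seqCW /= all_map.
by apply/andP; split=> //; apply/allP.
Qed.

Lemma query_ok s : Inv s -> uniq vs -> runs (query k' np f e uid aS) s (fun s' =>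
  [/\ Inv s', (rv s' rV <= rv s rV)%R & forall p q, p < n -> q < n -> p \notin vs -> q \notin vs ->
     (0 < co vs ord_max p)%R -> (co vs ord_max q < 0)%R ->
     (forall i, i < D' -> prec vs (inord i) p q) -> bnd s' (es vs p q)]).
Proof.
move=> Is U; apply: runs_imp.
  apply: (runs_for (I := fun s' => Inv s' /\ (rv s' rV <= rv s rV)%R) (G := fun p s' => p \notin vs ->
     (0 < co vs ord_max p)%R -> forall q, q < n -> q \notin vs -> (co vs ord_max q < 0)%R ->
     (forall i, i < D' -> prec vs (inord i) p q) -> bnd s' (es vs p q))); first by [].
  move=> p s1; rewrite mem_iota add0n => /= pn [I1 le1].
  set s2 := wset s1 vP p.
  have I2 : Inv s2 by exact: Inv_wset.
  have C2 : Ctx s2 by case: I2.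
  have p2 : wv s2 vP = p by [].
  have wp : weval n s2 (WV vP) = p by [].
  have pn2 : wv s2 vP < n by rewrite p2.
  apply: runs_guard; first exact: wsafe_not_pi C2.1 pn2.
    rewrite (not_piE vP C2.1) p2 => pvs; apply: runs_ifR.
    - exact: (rsafe_coo f e np_k W1 HD vs_nth C2.1 _ (okv pn2)).
    - by rewrite /= ltnW.
    - rewrite (reval_coo f e n inp np_k C2.1) wp => le; split=> //; split=> //.
      by move=> _; rewrite ltNge [X in ~~ X]le.
    rewrite (reval_coo f e n inp np_k C2.1) wp [reval _ _ _ _]/= => lt.
    apply: runs_imp.
      apply: (runs_nest (emb := id) (G := fun ps s => forall q, q < n -> q \notin vs ->
         (co vs ord_max q < 0)%R -> sibling ps p q -> powers ps -> bnd s (es vs p q))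
         (I := fun s => [/\ Inv s, (rv s rV <= rv s2 rV)%R & wv s vP = p])); first exact: pws_uniq.
      - move=> x /mapP[i _ ->]; apply/negP => /(allP wmods_query_cell) /=.
        by rewrite xpair_eqE.
      - move=> x i s3 /mapP[j _ ->] [I3 le3 p3]; split=> //; exact: Inv_wset.
      - by [].
      - move=> ps s3 szp sub pv [I3 le3 p3]; have [Hps Ps] := powersP szp sub pv.
        apply: runs_imp; first exact: (query_cell_ok I3 Hps Ps p3 pn U pvs lt).
        move=> s4 E [I4 le4 g4]; split=> //.
        + split=> //; first exact: le_trans le4 le3.
          by rewrite E wv_frame //; apply/negP => /(allP wmods_query_cell).
        + by move=> q qn qvs cq sib _; apply: g4.
        + move=> ps' h q qn qvs cq sib Hps'; apply: bnd_le (h q qn qvs cq sib Hps') => //.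
          by apply: es_ge0 => //; exact: sibling_prec sib.
      - by [].
    move=> s3 _ [[I3 le3 _] g3 _].
    have le13 : (rv s3 rV <= rv s1 rV)%R by [].
    split.
    - by split=> //; exact: le_trans le13 le1.
    - move=> _ _ q qn qvs cq kl; have [ps [szp sub] sib] := exists_powers pn qn kl.
      by apply: (g3 ps) => //; rewrite size_map size_iota.
    - move=> j gj jvs cj q qn qvs cq kl; apply: bnd_le (gj jvs cj q qn qvs cq kl) => //.
      exact: es_ge0.
  rewrite (not_piE vP C2.1) p2 negbK => pvs; split=> //.
  by rewrite pvs.
move=> s1 _ [[I1 le1] G1 _]; split=> // p q pn qn pvs qvs pp cq kl.
by apply: (G1 p) => //; rewrite mem_iota.
Qed.
Lemma ranks_frame s : Best s -> tree_ok s -> let s' := exec n inp (ranks np f e t aS) s in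
  [/\ Best s', tree_ok s' & rv s' rV = rv s rV].
Proof.
move=> Bs Ts /=.
have hw (l : seq nat) : all (fun x : var => x.1 == 3)
    (wmods (seqC [seq rank_code aS (aR aS i) (prec_cmd np f e t (inord i)) | i <- l])).
  by elim: l => //= i l ->; rewrite andbT.
have hr (l : seq nat) :
    rmods (seqC [seq rank_code aS (aR aS i) (prec_cmd np f e t (inord i)) | i <- l]) = [::].
  by elim: l => //= i l ->.
have hm (l : seq nat) : all (ltn^~ D') l -> uid \notin
    mmods (seqC [seq rank_code aS (aR aS i) (prec_cmd np f e t (inord i)) | i <- l]).
  elim: l => //= i l IH /andP[iD lD]; rewrite !inE !negb_or /= IH // andbT.
  have aU : aS < uid by apply: leq_ltn_trans uidS; rewrite leq_addr.
  have rU : aR aS i < uid by apply: leq_ltn_trans uidS; rewrite /aR addSnnS leq_add2l.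
  by rewrite !(gtn_eqF aU) !(gtn_eqF rU).
have rvE x : rv (exec n inp (ranks np f e t aS) s) x = rv s x.
  by rewrite rv_frame // /ranks hr.
split=> //.
- apply: Best_eq Bs => [i|x _]; last exact: rvE.
  by rewrite wv_frame //; apply/negP => /(allP (hw _)).
- apply: (proj1 (tree_eq _)) Ts; rewrite wm_frame // hm //.
  by apply/allP => i; rewrite mem_iota.
Qed.

Lemma wmods_guard ps c x : x \in wmods (guard ps c) -> x \in wmods c.
Proof.
by elim: ps => [|[a b] ps IH] //=; rewrite mem_cat => /orP[/IH|/IH].
Qed.

Lemma rmods_guard ps c x : x \in rmods (guard ps c) -> x \in rmods c.
Proof.
by elim: ps => [|[a b] ps IH] //=; rewrite mem_cat => /orP[/IH|/IH].
Qed.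

Lemma mmods_guard ps c x : x \in mmods (guard ps c) -> x \in mmods c.
Proof.
by elim: ps => [|[a b] ps IH] //=; rewrite mem_cat => /orP[/IH|/IH].
Qed.

Lemma insert_frame s : Best s -> let s' := exec n inp (insert k' np f e uid aS) s in
  Best s' /\ rv s' rV = rv s rV.
Proof.
move=> Bs; cbv zeta.
have hr x : x \notin rmods (insert k' np f e uid aS).
  by apply/negP => /rmods_guard /=; rewrite rmods_nest.
split; last by rewrite rv_frame.
apply: Best_eq Bs => [i|x _]; last by rewrite rv_frame.
rewrite wv_frame //; apply/negP; rewrite inE => /orP[//|/wmods_guard /=].
by rewrite wmods_nest cats0 => /mapP[].
Qed.

Lemma pi_pairsE s : View k' Y (nth 0 vs) s ->
  all (fun ab => weval n s ab.1 != weval n s ab.2) (pi_pairs k') = uniq vs.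
Proof.
move=> Vs; apply/idP/idP => [h|U].
  apply/negPn/negP => /(uniqPn 0)[i [j [ij jk E]]]; move: h.
  rewrite /pi_pairs all_map => /allP /(_ (i, j)); rewrite mem_filter /= ij /=.
  rewrite vs_size in jk; have ik := ltn_trans ij jk.
  rewrite !(proj1 Vs) // E eqxx => h.
  suff : false by []; apply: h; apply/allpairsP; by exists (i, j); rewrite !mem_iota.
rewrite /pi_pairs all_map; apply/allP => -[i j]; rewrite mem_filter => /andP[/= ij /allpairsP[[a b] /= [ai bi [E1 E2]]]].
have ik : i < k' by move: ai; rewrite mem_iota E1.
have jk : j < k' by move: bi; rewrite mem_iota E2.
by rewrite /= !(proj1 Vs) // nth_uniq ?vs_size // neq_ltn ij.
Qed.

Lemma block_ok s : View k' Y (nth 0 vs) s -> tree_ok s -> Best s ->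
  runs (block k' np f e t uid aS) s (fun s' => [/\ tree_ok s', Best s', (rv s' rV <= rv s rV)%R &
    uniq vs -> forall p q, p < n -> q < n -> p \notin vs -> q \notin vs ->
      (0 < co vs ord_max p)%R -> (co vs ord_max q < 0)%R ->
      (forall i, i < D' -> prec vs (inord i) p q) -> bnd s' (es vs p q)]).
Proof.
move=> Vs Ts Bs; apply: runs_guard.
- rewrite /pi_pairs all_map; apply/allP => -[i j]; rewrite mem_filter => /andP[/= _ /allpairsP[[a b] /= [ai bi [E1 E2]]]].
  have ik : i < k' by move: ai; rewrite mem_iota E1.
  have jk : j < k' by move: bi; rewrite mem_iota E2.
  by rewrite /= !(proj1 Vs) // !W_le // ltnW // vs_nth.
- rewrite pi_pairsE // => U; apply: runs_seq; apply: runs_imp; first exact: ranks_ok Vs.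
  move=> s1 E1 C1; have [B1 T1 v1] := ranks_frame Bs Ts; rewrite -E1 in B1 T1 v1.
  apply: runs_seq; apply: runs_imp; first exact: insert_ok C1 T1.
  move=> s2 E2 [C2 T2 G2]; have [B2 v2] := insert_frame B1; rewrite -E2 in B2 v2.
  apply: runs_imp; first by apply: (query_ok (s := s2)).
  move=> s3 _ [[_ T3 _ B3] le3 b3]; split=> //; first by rewrite -v1 -v2.
- by rewrite pi_pairsE // => /negbTE ->.
Qed.
End Block.

Lemma rmods_nearest_pair x : x \in rmods (nearest_pair k' np f e t uid aS) -> x.1 \in [:: 1; 2].
Proof.
have rX l : rmods (seqC [seq CR (rX c) (candE np f e (WV vP) (WV vQ) c) | c <- l]) =
    [seq rX c | c <- l] by elim: l => //= c l ->.
have rW l : rmods (seqC [seq CW (vOut i) (WV (vPi i)) | i <- l]) = [::] by elim: l.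
have rk (l : seq nat) :
    rmods (seqC [seq rank_code aS (aR aS i) (prec_cmd np f e t (inord i)) | i <- l]) = [::].
  by elim: l => //= i l ->.
rewrite rmods_nest => /rmods_guard.
rewrite -[rmods _]/(rmods (ranks np f e t aS) ++ rmods (insert k' np f e uid aS) ++
  rmods (query k' np f e uid aS)) rk !mem_cat => /or3P[//|/rmods_guard /=|/rmods_guard /=].
  by rewrite rmods_nest.
rewrite rmods_nest /= rX rW !cats0 !inE => /or3P[/eqP ->|/eqP ->|/mapP[c _ ->]] //.
Qed.

Lemma mmods_nearest_pair id : aS + D' < id -> id != uid ->
  id \notin mmods (nearest_pair k' np f e t uid aS).
Proof.
move=> aid iu.
have mX l : mmods (seqC [seq CR (rX c) (candE np f e (WV vP) (WV vQ) c) | c <- l]) = [::] by elim: l.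
have mW l : mmods (seqC [seq CW (vOut i) (WV (vPi i)) | i <- l]) = [::] by elim: l.
have rk (l : seq nat) : all (ltn^~ D') l -> id \notin
    mmods (seqC [seq rank_code aS (aR aS i) (prec_cmd np f e t (inord i)) | i <- l]).
  elim: l => //= i l IH /andP[iD lD]; rewrite !inE !negb_or /= IH // andbT.
  have aU : aS < id by apply: leq_ltn_trans aid; rewrite leq_addr.
  have rU : aR aS i < id by apply: leq_ltn_trans aid; rewrite /aR addSnnS leq_add2l.
  by rewrite !(gtn_eqF aU) !(gtn_eqF rU).
rewrite mmods_nest; apply/negP => /mmods_guard; apply/negP.
rewrite -[mmods _]/(mmods (ranks np f e t aS) ++ mmods (insert k' np f e uid aS) ++
  mmods (query k' np f e uid aS)) !mem_cat !negb_or rk /=; last first.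
  by apply/allP => i; rewrite mem_iota.
apply/andP; split; apply/negP => /mmods_guard /=; rewrite mmods_nest /=.
  by rewrite !inE (negbTE iu).
by rewrite mX mW.
Qed.

Lemma nearest_pair_ok s : (forall c : 'I_D, rv s (rY (nat_of_ord c)) = Y 0%R c) -> tree_ok s -> Best s ->
  runs (nearest_pair k' np f e t uid aS) s (fun s' => [/\ Best s', (rv s' rV <= rv s rV)%R &
    forall vs p q, size vs = k' -> all (ltn^~ n) vs -> uniq vs ->
      p < n -> q < n -> p \notin vs -> q \notin vs ->
      (0 < co vs ord_max p)%R -> (co vs ord_max q < 0)%R ->
      (forall i, i < D' -> prec vs (inord i) p q) -> bnd s' (es vs p q)]).
Proof.
move=> Ys Ts Bs.
apply: runs_imp.
  apply: (runs_nest (emb := id) (I := fun s' => [/\ forall c : 'I_D, rv s' (rY (nat_of_ord c)) = Y 0%R c,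
       tree_ok s', Best s' & (rv s' rV <= rv s rV)%R])
    (G := fun vs s' => all (ltn^~ n) vs -> size vs = k' -> uniq vs -> forall p q,
      p < n -> q < n -> p \notin vs -> q \notin vs ->
      (0 < co vs ord_max p)%R -> (co vs ord_max q < 0)%R ->
      (forall i, i < D' -> prec vs (inord i) p q) -> bnd s' (es vs p q))).
- by rewrite map_inj_uniq ?iota_uniq // => i j [].
- move=> x /mapP[i _ ->]; apply/negP => /wmods_guard.
  have wk (l : seq nat) : all (fun x : var => x.1 == 3)
      (wmods (seqC [seq rank_code aS (aR aS i) (prec_cmd np f e t (inord i)) | i <- l])).
    by elim: l => //= j l ->; rewrite andbT.
  rewrite -[wmods _]/(wmods (ranks np f e t aS) ++ wmods (insert k' np f e uid aS) ++
    wmods (query k' np f e uid aS)) !mem_cat.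
  case/or3P => [/(allP (wk _)) //||]; rewrite inE => /orP[//|/wmods_guard /=].
    by rewrite wmods_nest cats0 => /mapP[].
  by rewrite wmods_nest mem_cat => /orP[/mapP[] //|/(allP wmods_query_cell)].
- by move=> x i s1 /mapP[j _ ->] [h1 h2 h3 h4]; split=> //; apply: Best_eq h3.
- by move=> x i vs s1 /mapP[j _ ->].
- move=> vs s1; rewrite size_map size_iota => szv sub vv [Y1 T1 B1 le1].
  have vl : all (ltn^~ n) vs by apply/allP => v /sub; rewrite mem_iota.
  have V1 : View k' Y (nth 0 vs) s1.
    split=> // i ik; rewrite -vv // (nth_map 0) ?size_iota // nth_iota //.
  apply: runs_imp; first exact: (block_ok szv vl V1 T1 B1).
  move=> s2 E [T2 B2 le2 g2]; split.
  + split=> //; last exact: le_trans le2 le1.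
    move=> c; rewrite E rv_frame ?Y1 //; apply/negP => h.
    have : rY (nat_of_ord c) \in rmods (nearest_pair k' np f e t uid aS) by rewrite rmods_nest.
    by move/rmods_nearest_pair.
  + by move=> _ _ U; apply: g2.
  + move=> vs' g' vl' sz' U p q pn qn pv qv pp qq kl; apply: bnd_le (g' vl' sz' U p q pn qn pv qv pp qq kl) => //.
    exact: es_ge0.
- by [].
move=> s1 _ [[_ T1 B1 le1] g1 _]; split=> // vs p q szv vl U.
by apply: (g1 vs); rewrite ?size_map ?size_iota // => v /(allP vl); rewrite mem_iota.
Qed.

End BlockCorrect.

(** * The complete program *)

Section Program.
Variables (D' k' q0 G : nat).
Notation D := D'.+1.
Notation k := k'.+2.
Notation vI := (4, 2).
Notation rS c := (3, c).

Definition config : finType := ('I_k'.+1 * {ffun 'I_D -> 'I_D} * {ffun 'I_D -> bool} * bool)%type.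

(** Ranking uses the arrays [k] to [k + D']. The arrays below [k] are kept for the answer, because
    cell 0 of array [i] is memory cell [i]. *)
Definition config_code uid (c : config) :=
  nearest_pair k' c.1.1.1 c.1.1.2 c.1.2 c.2 uid k.

(** Each configuration has its own array [uid], which must be 0 at the start; the number of its
    cells exceeds the time bound, so it cannot be cleared cell by cell. *)
Fixpoint pass uid (l : seq config) :=
  if l is c :: l' then config_code uid c ;; pass uid.+1 l' else CSkip.

Definition set_center (F : nat -> rexp) := seqC [seq CR (rY r) (F r) | r <- iota 0 D].

(** An axis, whose component of [z - y] supplies the mesh, and a vector of steps from [- G] to [G],
    shifted by [G]. *)
Definition grid_index : finType := ('I_D * {ffun 'I_D -> 'I_G.*2.+1})%type.

Definition grid_coord (g : grid_index) r := RB OAdd (ptE D WN r)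
  (RB OMul (RB ODiv (RV (rS (nat_of_ord g.1))) (RL q0))
     (RB OSub (RL (g.2 (inord r))) (RL G))).

Fixpoint grid_passes uid (l : seq grid_index) :=
  if l is g :: l' then set_center (grid_coord g) ;; pass uid (enum {: config}) ;;
    grid_passes (uid + #|{: config}|) l'
  else CSkip.

Definition point_val := sumE [seq sqE (RB OSub (ptE D (WV vI) c) (ptE D WN c)) | c <- iota 0 D].

(* Completes the point vI to k distinct points. *)
Definition point_record := CR rV point_val ;;
  seqC [seq CR (rX c) (ptE D (WV vI) c) | c <- iota 0 D] ;;
  CW (vOut 0) (WV vI) ;;
  seqC [seq CIfW (WV vI) (WL i) (CIfW (WL i) (WV vI) (CW (vOut i) (WL 0)) (CW (vOut i) (WL i)))
          (CW (vOut i) (WL i)) | i <- iota 1 k'.+1].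

Definition nearest_point := CW vI (WL 0) ;; point_record ;;
  CFor false vI (CIfR point_val (RV rV) point_record CSkip).

Definition uid0 := (k + D').+1.

(* The first pass, centered at y, gives a constant factor approximation, whose
   error fixes the scale of the grid of centers of the remaining passes. *)
Definition main_program := nearest_point ;; set_center (ptE D WN) ;; pass uid0 (enum {: config}) ;;
  seqC [seq CR (rS c) (RB OSub (RV (rX c)) (ptE D WN c)) | c <- iota 0 D] ;;
  grid_passes (uid0 + #|{: config}|) (enum {: grid_index}) ;;
  seqC [seq CM i (WL 0) (WV (vOut i)) | i <- iota 0 k].

Definition num_arrays := uid0 + #|{: config}| * #|{: grid_index}|.+1.

End Program.

(** * Coordinate systems with pointwise equal data *)

Section Extensionality.
Variables (R : realType) (D' : nat).
Notation D := D'.+1.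
Variables (pt : nat -> 'rV[R]_D) (Y : 'rV[R]_D) (np : nat).
Variables (f f' : 'I_D -> 'I_D) (e e' : 'I_D -> bool) (pi pi' : nat -> nat).
Hypotheses (ff : f =1 f') (ee : e =1 e') (pp : forall i, i < np -> pi i = pi' i).

(** Passes from the functions supplied by [nearest_basic] to the finite functions enumerated by
    [config]; the indices [pi] have to agree only below [np]. *)
Lemma basis_ext : basis pt Y np f e pi = basis pt Y np f' e' pi'.
Proof. by apply/matrixP => i c; rewrite !mxE; case: ifP => [/pp ->|_]; rewrite // ff ee. Qed.

Lemma coo_ext i z : coo pt Y np f e pi i z = coo pt Y np f' e' pi' i z.
Proof. by rewrite /coo /basis_with basis_ext. Qed.

Lemma key_ext i z : key pt Y np f e pi i z = key pt Y np f' e' pi' i z.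
Proof. by rewrite /key !coo_ext. Qed.

Lemma est_ext p q : est pt Y np f e pi p q = est pt Y np f' e' pi' p q.
Proof.
by rewrite /est coo_ext /ksum; congr (_ * (_ - _))%R; apply: eq_bigr => i _; rewrite key_ext.
Qed.
End Extensionality.

(** * Rounding to the grid of centers *)

Section Grid.
Variables (R : realType) (D' : nat).
Notation D := D'.+1.
Implicit Types x y z : 'rV[R]_D.
Local Open Scope ring_scope.

Lemma l1_le_const x (a : R) : (forall c, `|x 0 c| <= a) -> l1 x <= D%:R * a.
Proof.
move=> h; apply: (@le_trans _ _ (\sum_(c < D) a)); first by apply: ler_sum => c _; apply: h.
by rewrite sumr_const card_ord mulr_natl.
Qed.

Lemma l1_nrm x : l1 x <= D%:R * nrm x.
Proof.
by apply: l1_le_const => c; apply: abs_le_nrm.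
Qed.

(* Rounding x to the grid with mesh |z_c - y_c| / q0 around y. *)
Lemma grid_round x y z (q0 : nat) : (0 < q0)%N -> nrm (x - y) <= nrm (z - y) -> 0 < nrm (z - y) ->
  let G := (D * q0)%N in
  exists (c : 'I_D) (g : {ffun 'I_D -> 'I_G.*2.+1}),
  let Y := y + \row_r ((z 0 c - y 0 c) / q0%:R * ((g r)%:R - G%:R)) in
  l1 (x - Y) <= D%:R * (nrm (z - y) / q0%:R).
Proof.
move=> q0p xz zy G.
(* The largest component of [z - y] is at least [nrm (z - y) / D], so [G = D * q0] steps in each
   direction reach every point as near to [y] as [z]. *)
have [c _ cmax] := @arg_maxP _ _ _ (ord0 : 'I_D) xpredT (fun c => `|z 0 c - y 0 c|) isT.
set sg := (z 0 c - y 0 c) / q0%:R.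
have q0R : (0 : R) < q0%:R by rewrite ltr0n.
have le_c : nrm (z - y) <= D%:R * `|z 0 c - y 0 c|.
  apply: le_trans (nrm_l1 _) _; apply: l1_le_const => r; rewrite !mxE; exact: cmax.
have zc0 : 0 < `|z 0 c - y 0 c| by rewrite -(@pmulr_rgt0 _ D%:R) ?ltr0n //; exact: lt_le_trans le_c.
have sg0 : sg != 0.
  by apply: mulf_neq0; [rewrite -normr_gt0 | apply: invr_neq0; rewrite gt_eqF].
pose u r := (x 0 r - y 0 r) / sg + G%:R.
have u_bound r : 0 <= u r /\ u r <= (G.*2)%:R.
  have : `|(x 0 r - y 0 r) / sg| <= G%:R.
    rewrite normrM normfV ler_pdivrMr ?normr_gt0 // /sg normrM normfV (gtr0_norm q0R).
    have -> (a : R) : G%:R * (a / q0%:R) = D%:R * a by rewrite natrM; field; rewrite gt_eqF.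
    apply: le_trans le_c; apply: le_trans xz.
    by have := abs_le_nrm (x - y) r; rewrite !mxE.
  by rewrite ler_norml -addnn natrD => /andP[h1 h2]; rewrite /u; split; lra.
exists c, [ffun r => inord (Num.truncn (u r))] => /=.
apply: l1_le_const => r; rewrite !mxE ffunE -/sg.
have [u0 uG] := u_bound r.
have /andP[t1 t2] := truncn_itv u0.
rewrite inordK; last first.
  by rewrite ltnS -(ler_nat R) (le_trans t1).
have -> : x 0 r - (y 0 r + sg * ((Num.truncn (u r))%:R - G%:R)) = sg * (u r - (Num.truncn (u r))%:R).
  by rewrite /u; field.
rewrite normrM; apply: (@le_trans _ _ (`|sg| * 1)).
  by rewrite ler_wpM2l // ger0_norm ?subr_ge0 // lerBlDl; rewrite -natr1 in t2; exact: ltW.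
rewrite mulr1 /sg normrM normfV (gtr0_norm q0R) ler_wpM2r ?invr_ge0 ?ler0n //.
by have := abs_le_nrm (z - y) c; rewrite !mxE.
Qed.
End Grid.

(** * Correctness of the complete program *)

Section ProgramCorrect.
Variables (R : realType) (n w : nat) (inp : nat -> R) (D' k' q0 G : nat).
Notation D := D'.+1.
Notation k := k'.+2.
Notation vI := (4, 2).
Notation rS c := (3, c).
Notation K := (num_arrays D' k' G).
Implicit Types s : store R.
Local Notation W := (2 ^ w)%N.
Local Notation runs := (runs n w K inp).
Local Notation pt := (pt D' inp).
Local Notation Best := (Best n inp D' k').
Local Notation y := (pt n).
Hypotheses (n1 : 1 < n) (kD : k' <= D') (kn : k <= n).
Hypotheses (HW : 8 * n.+1 < W) (HD : n.+1 * D < W) (HA : n.+1 ^ (k' + 2 * D').+1 < W).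
Hypotheses (HK : n.+1 ^ (k' + 2 * D').+1 * K <= W) (HK2 : n.+2 * K <= W).
Hypotheses (Wq : q0 < W) (WG : G.*2 < W) (Wk : k < W).

Let W1 : 1 < W. Proof. by apply: leq_ltn_trans HW; rewrite muln_gt0. Qed.

Let W_le a : a <= n -> a < W.
Proof. by move=> h; apply: leq_ltn_trans HW; rewrite mulnS addnC; apply: leq_trans (leq_addr _ _); rewrite (leq_trans h) // leq_pmull. Qed.

Definition pair_goal (Y : 'rV[R]_D) (c : config D' k') s :=
  let np := nat_of_ord c.1.1.1 in let f := c.1.1.2 in let e := c.1.2 in
  forall vs p q, size vs = k' -> all (ltn^~ n) vs -> uniq vs ->
    p < n -> q < n -> p \notin vs -> q \notin vs ->
    (0 < coo pt Y np f e (nth 0 vs) ord_max p)%R ->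
    (coo pt Y np f e (nth 0 vs) ord_max q < 0)%R ->
    (forall i, i < D' -> prec inp np f e c.2 Y vs (inord i) p q) ->
    bnd n inp Y s (est pt Y np f e (nth 0 vs) p q).

Lemma pair_goal_le Y c s s' : (rv s' rV <= rv s rV)%R -> pair_goal Y c s -> pair_goal Y c s'.
Proof. 
move=> le h; rewrite /pair_goal => vs p q h1 h2 h3 h4 h5 h6 h7 h8 h9 h10.
exact: (le_trans le (h vs p q h1 h2 h3 h4 h5 h6 h7 h8 h9 h10)).
Qed.

Lemma rmods_pass u (l : seq (config D' k')) x : x \in rmods (pass u l) -> x.1 \in [:: 1; 2].
Proof. by elim: l u => //= c l IH u; rewrite mem_cat => /orP[/rmods_nearest_pair|/IH]. Qed.

Lemma mmods_pass u (l : seq (config D' k')) id : k + D' < u -> u + size l <= id -> id \notin mmods (pass u l).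
Proof.
elim: l u => //= c l IH u ku; rewrite addnS => le; have lt : u < id by apply: leq_trans le; rewrite ltnS leq_addr.
rewrite mem_cat negb_or IH // ?leqW // andbT.
by apply: mmods_nearest_pair; rewrite ?(ltn_trans ku) // neq_ltn lt orbT.
Qed.

Lemma pass_ok (Y : 'rV[R]_D) (l : seq (config D' k')) u s : k + D' < u -> u + size l <= K ->
  (forall c : 'I_D, rv s (rY (nat_of_ord c)) = Y 0%R c) ->
  (forall id a, u <= id < u + size l -> wm s id a = 0) -> Best s ->
  runs (pass u l) s (fun s' =>
    [/\ Best s', (rv s' rV <= rv s rV)%R & forall c, c \in l -> pair_goal Y c s']).
Proof.
elim: l u s => [|c l IH] u s ku uK Ys Zs Bs /=; first by split=> //; split.
rewrite /= addnS in uK.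
have uK' : u < K by apply: leq_trans uK; rewrite ltnS leq_addr.
have np_k : nat_of_ord c.1.1.1 <= k' by rewrite -ltnS.
apply: runs_seq; apply: runs_imp.
  apply: (nearest_pair_ok (t := c.2) n1 np_k (leq_trans np_k kD) HW HD HA HK HK2 ku uK' Ys) => //.
  by move=> us ds _ _ _ _; left; apply: Zs; rewrite /= addnS leqnn ltnS leq_addr.
move=> s1 E [B1 le1 g1].
have Y1 (c' : 'I_D) : rv s1 (rY (nat_of_ord c')) = Y 0%R c'.
  by rewrite E rv_frame //; apply/negP => /rmods_nearest_pair.
apply: runs_imp; first apply: (IH u.+1 s1 _ uK Y1 _ B1).
- exact: ltnW.
- move=> id a /andP[h1 h2]; rewrite E wm_frame ?Zs //.
    by rewrite (ltnW h1) /= addnS.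
  by apply: mmods_nearest_pair; [exact: ltn_trans h1 | rewrite neq_ltn h1 orbT].
move=> s2 _ [B2 le2 g2]; split=> //; first exact: le_trans le2 le1.
move=> c'; rewrite inE => /predU1P[->|]; last exact: g2.
by apply: pair_goal_le le2 _.
Qed.

(** The combination given by [l] is arbitrary. Its vertex is either a single point, covered by
    [init], or a pair in some configuration, covered by [goals]. *)
Lemma pass_bound (Y : 'rV[R]_D) s (F : 'I_k -> nat) (l : 'I_k -> R) :
  (forall c, pair_goal Y c s) -> (forall i, i < n -> (rv s rV <= sq (pt i - y))%R) ->
  injective F -> (forall i, F i < n) -> (forall i, (0 <= l i)%R) -> (\sum_i l i = 1)%R ->
  (rv s rV <= (nrm (Y - y) + k%:R * l1 (\sum_i l i *: pt (F i) - Y)) ^+ 2)%R.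
Proof.
move=> goals init F_inj F_lt l_ge0 l_sum.
have cE : (comb (fun i => pt (F i) - Y) l = \sum_i l i *: pt (F i) - Y)%R.
  rewrite /comb (eq_bigr (fun i => l i *: pt (F i) - l i *: Y)%R) => [|i _].
    by rewrite sumrB -scaler_suml l_sum scale1r.
  by rewrite scalerBr.
rewrite -cE; set L := l1 _.
have L0 : (0 <= L)%R by exact: l1_ge0.
have b0 : (0 <= nrm (Y - y) + k%:R * L)%R by rewrite addr_ge0 ?nrm_ge0 // mulr_ge0.
have [[i le]|[p [q [np [f [e [r]]]]]]] := nearest_basic pt Y F l_ge0 l_sum.
  apply: le_trans (init _ (F_lt i)) _; rewrite -sqr_nrm ler_pXn2r ?nnegrE ?nrm_ge0 //.
  rewrite -(subrKA Y (pt (F i))) addrC; apply: le_trans (nrmD _ _) _; rewrite lerD2l.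
  apply: le_trans (nrm_l1 _) _; apply: le_trans le _; rewrite -/L.
  by rewrite ler_peMl // ler1n.
move=> /= [pr [np_r np_D] [pp pq] kl le].
pose vs := [seq F i | i <- r].
have szr : size r = k' by have := perm_size pr; rewrite /= size_enum_ord => -[].
have U : uniq [:: p, q & r] by rewrite (perm_uniq pr) enum_uniq.
have /and3P[] := U; rewrite inE negb_or => /andP[pq_ne pr_n] qr_n Ur.
have npk : np < k'.+1 by rewrite ltnS -szr.
(* The direction of ties is chosen so that equal keys also put [F p] strictly before [F q]. *)
pose c : config D' k' := (Ordinal npk, finfun f, finfun e, F p < F q).
have pi_eq i : i < np -> F (nth p r i) = nth 0 vs i.
  by move=> inp'; rewrite (nth_map p) // (leq_trans inp').
have fE : f =1 finfun f by move=> i; rewrite ffunE.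
have eE : e =1 finfun e by move=> i; rewrite ffunE.
rewrite !(coo_ext _ _ fE eE pi_eq) in pp pq; rewrite (est_ext _ _ fE eE pi_eq) in le.
have bn : bnd n inp Y s (est pt Y np (finfun f) (finfun e) (nth 0 vs) (F p) (F q)).
  apply: (goals c) => //.
  - by rewrite size_map.
  - by apply/allP => v /mapP[i _ ->] /=.
  - by rewrite map_inj_uniq.
  - by rewrite mem_map.
  - by rewrite mem_map.
  - move=> i iD; have im : inord i != ord_max :> 'I_D.
      by rewrite -val_eqE /= inordK ?ltn_eqF // ltnW.
    have := kl _ im; rewrite !(key_ext _ _ fE eE pi_eq) /prec le_eqVlt => /orP[h|->//].
    apply/orP; right; rewrite h /=; case: ltnP => // ge.
    by rewrite ltn_neqAle ge andbT (inj_eq F_inj) eq_sym.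
set est0 := est _ _ _ _ _ _ _ _ in le bn.
have e0 : (0 <= est0)%R.
  rewrite /est0 /est mulr_ge0 ?(ltW pp) // subr_ge0; apply: ler_sum => i /andP[_ im].
  by rewrite -!(key_ext _ _ fE eE pi_eq) kl.
apply: le_trans bn _; rewrite ler_pXn2r ?nnegrE //; first by rewrite lerD2l.
by apply: addr_ge0 e0; exact: nrm_ge0.
Qed.

(** The expressions are evaluated in any state that agrees with [s] off the tag [T]: their values
    must not depend on the variables being assigned. *)
Lemma set_tag (T : nat) (F : nat -> rexp) (x : nat -> R) l s : uniq l ->
  (forall s' c, c \in l -> wv s' = wv s -> wm s' = wm s ->
     (forall v : var, v.1 != T -> rv s' v = rv s v) ->
     rsafe n w K s' (F c) /\ reval n inp s' (F c) = x c) ->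
  runs (seqC [seq CR (T, c) (F c) | c <- l]) s (fun s' =>
    [/\ wv s' = wv s, wm s' = wm s, forall v : var, v.1 != T -> rv s' v = rv s v
      & forall c, c \in l -> rv s' (T, c) = x c]).
Proof.
move=> U hF; suff H l' s1 : uniq l' -> {subset l' <= l} -> wv s1 = wv s -> wm s1 = wm s ->
    (forall v : var, v.1 != T -> rv s1 v = rv s v) ->
    runs (seqC [seq CR (T, c) (F c) | c <- l']) s1 (fun s' =>
    [/\ wv s' = wv s /\ wm s' = wm s, forall v : var, v.1 != T -> rv s' v = rv s v,
        forall c, c \in l' -> rv s' (T, c) = x c
      & forall c, c \notin l' -> rv s' (T, c) = rv s1 (T, c)]).
  apply: runs_imp; first by apply: (H l s).
  by move=> s' _ [[h1 h2] h3 h4 _].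
elim: l' s1 => [|c l' IH] s1 /=; first by move=> _ _ h1 h2 h3; split.
case/andP=> cl' U' sub h1 h2 h3.
have [sF vF] := hF s1 c (sub c (mem_head _ _)) h1 h2 h3.
apply: runs_seq; apply: runs_R => //; rewrite vF; set s2 := rset _ _ _.
apply: runs_imp; first apply: (IH s2) => //.
- by move=> j jl; apply: sub; rewrite inE jl orbT.
- move=> [a j] /= aT; rewrite xpair_eqE (negbTE aT) /=; exact: h3.
move=> s3 _ [h4 h5 h6 h7]; split=> // j; rewrite inE.
  by case: eqP => [->|_ /h6 //]; rewrite h7 //= eqxx.
by rewrite negb_or => /andP[jc jl]; rewrite h7 //= xpair_eqE (negbTE jc) andbF.
Qed.

Let okN s : okE n w K s WN.
Proof. by rewrite /okE /= W_le ?leqnn. Qed.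

Let pt_ok s ez (c : nat) : okE n w K s ez -> c < D -> rsafe n w K s (ptE D ez c) /\
  reval n inp s (ptE D ez c) = pt (weval n s ez) 0%R (inord c).
Proof.
move=> ok cD; split; last by rewrite /= mxE inordK.
case/andP: ok => sz zn /=; rewrite sz /= andbT.
have : weval n s ez * D + c < n.+1 * D.
  rewrite mulSn addnC -addSn leq_add //.
  by rewrite leq_mul2r zn orbT.
move=> h; have h' := ltn_trans h HD; rewrite h' /=.
have cW : c < W by apply: leq_ltn_trans h'; rewrite leq_addl.
have DW : D < W by apply: leq_ltn_trans HD; rewrite leq_pmull.
by rewrite cW DW andbT andbT (leq_ltn_trans _ h') ?leq_addr.
Qed.

Lemma point_record_ok s i : wv s vI = i -> i < n ->
  rsafe n w K s (point_val D') /\ reval n inp s (point_val D') = sq (pt i - y) /\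
  runs (point_record D' k') s (fun s' => [/\ Best s', rv s' rV = sq (pt i - y) & wm s' = wm s]).
Proof.
move=> si iN.
have okI s' : wv s' = wv s -> okE n w K s' (WV vI).
  by move=> E; rewrite /okE /= E si (ltnW iN) W_le // ltnW.
have sv : rsafe n w K s (point_val D').
  apply: rsafe_sum => //; rewrite all_map; apply/allP => c; rewrite mem_iota => /andP[_ cD].
  have [s1 _] := pt_ok (okI s erefl) cD; have [s2 _] := pt_ok (okN s) cD.
  by apply: rsafe_op; apply: rsafe_op.
have ev : reval n inp s (point_val D') = sq (pt i - y).
  rewrite /point_val reval_sum -[iota 0 D]/(index_iota 0 D) big_mkord /sq; apply: eq_bigr => c _.
  have [_ e1] := pt_ok (okI s erefl) (ltn_ord c); have [_ e2] := pt_ok (okN s) (ltn_ord c).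
  rewrite [LHS](_ : _ = ((reval n inp s (ptE D (WV vI) c) - reval n inp s (ptE D WN c)) ^+ 2)%R) //.
  by rewrite e1 e2 /= si inord_val !mxE.
split=> //; split=> //.
apply: runs_seq; apply: runs_R => //; rewrite ev; set s1 := rset _ _ _.
apply: runs_seq; apply: runs_imp.
  apply: (set_tag (x := fun c => pt i 0%R (inord c))); first exact: iota_uniq.
  move=> s2 c; rewrite mem_iota => /andP[_ cD] w2 m2 r2.
  by have [h1 h2] := pt_ok (okI s2 w2) cD; rewrite h1 h2 /= w2 si.
move=> s2 _ [w2 m2 v2 x2].
apply: runs_seq; apply: runs_W; first by rewrite /= w2 /= si W_le // ltnW.
rewrite /= w2 /= si; set s3 := wset _ _ _.
(* The transposition of [0] and [i], hence injective. *)
pose J (j : nat) := if j == 0 then i else if j == i then 0 else j.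
have H l s4 : uniq l -> all (fun j => 0 < j < k) l -> wv s4 vI = i -> rv s4 = rv s2 -> wm s4 = wm s ->
  runs (seqC [seq CIfW (WV vI) (WL j) (CIfW (WL j) (WV vI) (CW (vOut j) (WL 0)) (CW (vOut j) (WL j)))
          (CW (vOut j) (WL j)) | j <- l]) s4 (fun s' => [/\ rv s' = rv s2, wm s' = wm s,
    forall j, j \in l -> wv s' (vOut j) = J j & forall j, j \notin l -> wv s' (vOut j) = wv s4 (vOut j)]).
  elim: l s4 => [|j l IH] s4 //= /andP[jl U] /andP[/andP[j0 jk] lk] i4 r4 m4.
  have jW : j < W by exact: ltn_trans jk Wk.
  apply: runs_seq; apply: (runs_imp (Q := fun s' => s' = wset s4 (vOut j) (J j))).
    have sI : wsafe n w K s4 (WV vI) by rewrite /= i4 W_le // ltnW.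
    have sj : wsafe n w K s4 (WL j) by rewrite /= jW.
    have Jj : J j = if j == i then 0 else j by rewrite /J gtn_eqF.
    apply: runs_ifW => //=; rewrite i4 => h1.
      apply: runs_ifW => //=; rewrite i4 => h2; apply: runs_W => //=; first by rewrite ltnW.
        by rewrite Jj eqn_leq h1 h2.
      by rewrite Jj gtn_eqF.
    by apply: runs_W => //=; rewrite Jj ltn_eqF.
  move=> s5 _ ->; apply: runs_imp; first by apply: (IH (wset s4 (vOut j) (J j))).
  move=> s6 _ [h1 h2 h3 h4]; split=> // a; rewrite inE.
    by case: eqP => [->|_ /h3 //]; rewrite h4 //= eqxx.
  by rewrite negb_or => /andP[aj al]; rewrite h4 //= xpair_eqE (negbTE aj) andbF.
apply: runs_imp; first apply: (H (iota 1 k'.+1) s3) => //.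
- exact: iota_uniq.
- by apply/allP => j; rewrite mem_iota.
- by rewrite /= w2.
move=> s4 _ [r4 m4 o4 n4]; split=> //; last by rewrite r4 v2 //= eqxx.
exists (fun j : 'I_k => J j), (fun j : 'I_k => (j == ord0)%:R%R); split.
- move=> a b; rewrite /J => E; apply: val_inj; move: E => /=.
  by repeat (case: eqP => ?); lia.
- move=> j; rewrite /J; case: ifP => // _; case: ifP => _; first exact: ltnW.
  exact: leq_trans (ltn_ord j) kn.
- move=> j; have [j0|j0] := posnP j.
    by rewrite j0 n4 ?mem_iota //= /J eqxx.
  by rewrite o4 // mem_iota j0 add1n ltn_ord.
- split.
  + by move=> j; rewrite ler0n.
  + by rewrite (bigD1 ord0) //= big1 ?addr0 // => j /negbTE ->.
  + move=> c; rewrite r4 x2 ?mem_iota //= inord_val.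
    by rewrite big_ord_recl /= big1 ?addr0 ?mul1r // => j _; rewrite mul0r.
- rewrite r4 v2 //= /sq; apply: eq_bigr => c _.
  by rewrite [rv _ _]x2 ?mem_iota ?add0n ?ltn_ord // inord_val 2!mxE [in LHS]mxE.
Qed.

Lemma nearest_point_ok s : runs (nearest_point D' k') s (fun s' =>
  [/\ Best s', wm s' = wm s & forall i, i < n -> (rv s' rV <= sq (pt i - y))%R]).
Proof.
apply: runs_seq; apply: runs_W; first by rewrite /= ltnW.
set s1 := wset s vI _.
have [_ [_ pr]] := @point_record_ok s1 0 erefl (ltnW n1).
apply: runs_seq; apply: (runs_imp pr) => s2 _ [B2 _ m2].
apply: runs_imp.
  apply: (runs_for (I := fun s' => Best s' /\ wm s' = wm s)
    (G := fun i s' => i < n -> (rv s' rV <= sq (pt i - y))%R)); first by rewrite m2.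
  move=> i s3; rewrite mem_iota add0n => /= iN [B3 m3].
  set s4 := wset s3 vI i.
  have [sv [ev pr4]] := @point_record_ok s4 i erefl iN.
  have B4 : Best s4 by apply: Best_eq B3.
  apply: runs_ifR => //; rewrite ev /= => h.
    apply: (runs_imp pr4) => s5 _ [B5 v5 m5]; split.
    - by rewrite m5.
    - by rewrite v5.
    - by move=> j Gj jn; rewrite v5; apply: le_trans h (Gj jn).
  by split=> //; split=> // _; exact: ltW.
by move=> s3 _ [[B3 m3] G3 _]; split=> // i iN; apply: G3; rewrite // mem_iota.
Qed.
Definition grid_center (rs : nat -> R) (g : grid_index D' G) : 'rV[R]_D :=
  (y + \row_r (rs (nat_of_ord g.1) / q0%:R * ((nat_of_ord (g.2 r))%:R - G%:R)))%R.

Lemma grid_passes_ok (l : seq (grid_index D' G)) u (rs : nat -> R) s :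
  k + D' < u -> u + #|config D' k'| * size l <= K ->
  (forall c, rv s (rS c) = rs c) ->
  (forall id a, u <= id < u + #|config D' k'| * size l -> wm s id a = 0) -> Best s ->
  runs (grid_passes k' q0 u l) s (fun s' =>
    [/\ Best s', (rv s' rV <= rv s rV)%R &
        forall g, g \in l -> forall c, pair_goal (grid_center rs g) c s']).
Proof.
elim: l u s => [|g l IH] u s ku uK rS_s Zs Bs /=; first by split.
rewrite /= mulnS addnA in uK.
apply: runs_seq; apply: runs_imp.
  apply: (set_tag (x := fun r => grid_center rs g 0%R (inord r))); first exact: iota_uniq.
  move=> s1 r; rewrite mem_iota => /andP[_ rD] w1 m1 r1.
  have [h1 h2] := pt_ok (okN s1) rD.
  have gW : nat_of_ord (g.2 (inord r)) < W by apply: leq_ltn_trans WG; rewrite -ltnS.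
  have GW : G < W by apply: leq_ltn_trans WG; rewrite -addnn leq_addr.
  split; first by apply: rsafe_op h1 _; rewrite /= Wq gW GW.
  rewrite [LHS](_ : _ = (reval n inp s1 (ptE D WN r) + rv s1 (rS (nat_of_ord g.1)) / q0%:R *
    ((nat_of_ord (g.2 (inord r)))%:R - G%:R))%R) //.
  by rewrite h2 r1 // rS_s !mxE.
move=> s1 _ [w1 m1 r1 Y1].
have B1 : Best s1.
  by apply: Best_eq Bs => [i|[a b]]; [rewrite w1 | rewrite !inE /= => /orP[]/eqP-> ; apply: r1].
apply: runs_seq; apply: runs_imp.
  apply: (@pass_ok (grid_center rs g) (enum {: config D' k'}) u s1) => //.
  - by rewrite -cardE (leq_trans _ uK) // leq_addr.
  - by move=> c; rewrite [rv _ _]Y1 ?mem_iota ?inord_val //= ltn_ord.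
  - move=> id a /andP[h1 h2]; rewrite m1 Zs // h1 (leq_trans h2) //.
    by rewrite leq_add2l -cardE /= mulnS leq_addr.
move=> s2 E2 [B2 le2 g2].
apply: runs_imp; first apply: (IH (u + #|config D' k'|) s2) => //.
- by apply: leq_trans ku (leq_addr _ _).
- by move=> c; rewrite E2 rv_frame ?r1 //; apply/negP => /rmods_pass.
- move=> id a /andP[h1 h2]; rewrite E2 wm_frame ?m1 ?Zs //.
    by rewrite (leq_trans _ h1) ?leq_addr //= mulnS addnA.
  by apply: mmods_pass => //; rewrite -cardE.
move=> s3 _ [B3 le3 g3]; split=> //.
  by apply: (le_trans le3); apply: (le_trans le2); rewrite r1.
move=> g'; rewrite inE => /predU1P[->|]; last exact: g3.
by move=> c; apply: (pair_goal_le le3); apply: g2; rewrite mem_enum.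
Qed.

Lemma save_outputs_ok s (J : nat -> nat) l : uniq l -> all (ltn^~ k) l ->
  (forall i, i < k -> wv s (vOut i) = J i) -> (forall i, i < k -> J i < n) ->
  runs (seqC [seq CM i (WL 0) (WV (vOut i)) | i <- l]) s (fun s' =>
    (forall i, i \in l -> wm s' i 0 = J i) /\ forall i, i \notin l -> wm s' i 0 = wm s i 0).
Proof.
move=> + + + Jn; elim: l s => [|i l IH] s //= /andP[il U] /andP[ik lk] Js.
have kK : k <= K by rewrite /num_arrays /uid0 addSn leqW // -addnA leq_addr.
have KW : K <= W by apply: leq_trans HK2; rewrite leq_pmull.
apply: runs_seq; apply: runs_M => //=.
- by rewrite ltnW.
- by rewrite Js // W_le // ltnW // Jn.
- exact: leq_trans ik kK.
- by rewrite (leq_trans ik) // (leq_trans kK).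
apply: runs_imp; first by apply: IH.
move=> s' _ [h1 h2]; split=> j; rewrite inE.
  by case: eqP => [->|_ /h1 //]; rewrite h2 //= !eqxx Js.
by rewrite negb_or => /andP[ji jl]; rewrite h2 //= (negbTE ji).
Qed.

(** Write [r = nrm (x - y)] and [L = l1 (x - Y)] for a grid center [Y] near [x]. The first pass
    gives [nrm (z - y) <= k * D * r], rounding gives [L <= D * nrm (z - y) / q0], and the pass at
    [Y] gives a distance of at most [nrm (Y - y) + k * L <= r + (k + 1) * L]. Hence the condition on
    [q0]. [Y] depends on the competitor [x], but every center has been tried. *)
Lemma main_ok (eps : R) s : 0 < q0 -> G = (D * q0)%N ->
  (k.+1%:R * k%:R * D%:R ^+ 2 <= eps * q0%:R)%R ->
  (forall id a, uid0 D' k' <= id < K -> wm s id a = 0) ->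
  runs (main_program D' k' q0 G) s (fun s' => exists (J : 'I_k -> nat) (a : 'I_k -> R),
   [/\ injective J, forall i, J i < n, forall i : 'I_k, wm s' i 0 = J i,
       (forall i, (0 <= a i)%R) /\ (\sum_i a i = 1)%R &
       forall (F : 'I_k -> nat) (l : 'I_k -> R),
         injective F -> (forall i, F i < n) -> (forall i, (0 <= l i)%R) -> (\sum_i l i = 1)%R ->
         (nrm (\sum_i a i *: pt (J i) - y) <= (1 + eps) * nrm (\sum_i l i *: pt (F i) - y))%R]).
Proof.
move=> q0p GE eps_q0 Zs.
have kD0 : k + D' < uid0 D' k' by rewrite /uid0.
apply: runs_seq; apply: runs_imp; first exact: nearest_point_ok.
move=> s1 _ [B1 m1 init1].
apply: runs_seq; apply: runs_imp.
  apply: (set_tag (x := fun r => y 0%R (inord r))); first exact: iota_uniq.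
  by move=> s2 r; rewrite mem_iota => /andP[_ rD] _ _ _; apply: pt_ok.
move=> s2 _ [w2 m2 r2 Y2].
have B2 : Best s2.
  by apply: Best_eq B1 => [i|[a b]]; [rewrite w2 | rewrite !inE /= => /orP[]/eqP-> ; apply: r2].
have uK1 : uid0 D' k' + #|config D' k'| <= K by rewrite /num_arrays mulnS addnA leq_addr.
apply: runs_seq; apply: runs_imp.
  apply: (@pass_ok y (enum {: config D' k'}) (uid0 D' k') s2) => //.
  - by rewrite -cardE.
  - by move=> c; rewrite [rv _ _]Y2 ?mem_iota ?inord_val //= ltn_ord.
  - move=> id a /andP[h1 h2]; rewrite m2 m1 Zs // h1 (leq_trans h2) //.
    by rewrite -cardE.
move=> s3 E3 [B3 le3 g3].
have [J3 [z3w [_ _ _ [_ _ z3E] v3]]] := B3.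
pose z : 'rV[R]_D := (\row_c rv s3 (rX (nat_of_ord c)))%R.
have zV : rv s3 rV = (nrm (z - y) ^+ 2)%R.
  by rewrite v3 sqr_nrm /sq; apply: eq_bigr => c _; rewrite !mxE.
apply: runs_seq; apply: runs_imp.
  apply: (set_tag (x := fun r => (rv s3 (rX r) - y 0 (inord r))%R)); first exact: iota_uniq.
  move=> s4 r; rewrite mem_iota => /andP[_ rD] w4 m4 r4.
  have [h1 h2] := pt_ok (okN s4) rD; split; first exact: rsafe_op.
  by rewrite [LHS](_ : _ = (rv s4 (rX r) - reval n inp s4 (ptE D WN r))%R) // h2 r4.
move=> s4 _ [w4 m4 r4 S4].
have B4 : Best s4.
  by apply: Best_eq B3 => [i|[a b]]; [rewrite w4 | rewrite !inE /= => /orP[]/eqP-> ; apply: r4].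
apply: runs_seq; apply: runs_imp.
  apply: (@grid_passes_ok (enum {: grid_index D' G}) _ (fun c => rv s4 (rS c)) s4) => //.
  - by apply: leq_trans kD0 (leq_addr _ _).
  - by rewrite -cardE /num_arrays mulnS addnA.
  - move=> id a /andP[h1 h2]; rewrite m4 E3 wm_frame ?m2 ?m1 ?Zs //.
      by rewrite (leq_trans _ h1) ?leq_addr //; move: h2; rewrite -cardE -addnA -mulnS.
    by apply: mmods_pass => //; rewrite -cardE.
move=> s5 _ [B5 le5 g5].
have [J [a [Ji Jn Jw [a0 a1 aX] aV]]] := B5.
have init3 i : i < n -> (rv s3 rV <= sq (pt i - y))%R.
  by move=> h; apply: le_trans le3 _; rewrite r2 // init1.
have le53 : (rv s5 rV <= rv s3 rV)%R by rewrite -r4.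
apply: runs_imp.
  apply: (save_outputs_ok (J := fun i => J (inord i))); first exact: (iota_uniq 0 k).
  - by apply/allP => i; rewrite mem_iota.
  - by move=> i ik; rewrite -Jw inordK.
  - by move=> i _; apply: Jn.
move=> s6 _ [o6 _]; exists J, a; split=> //.
  by move=> i; rewrite o6 ?inord_val // mem_iota /=.
move=> F l Fi Fn l0 l1E; set x := (\sum_i l i *: pt (F i))%R.
have -> : nrm (\sum_i a i *: pt (J i) - y)%R = Num.sqrt (rv s5 rV).
  rewrite aV /nrm /sq; congr Num.sqrt; apply: eq_bigr => c _.
  rewrite 2!mxE summxE aX; congr ((_ - _) ^+ 2)%R; apply: eq_bigr => i _; by rewrite mxE.
have r0 : (0 <= nrm (x - y))%R := nrm_ge0 _.
have eps0 : (0 < eps)%R.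
  have q0R : (0 < q0%:R :> R)%R by rewrite ltr0n.
  rewrite -(pmulr_lgt0 _ q0R); apply: lt_le_trans eps_q0.
  by rewrite mulr_gt0 ?exprn_gt0 // ?mulr_gt0 ?ltr0n.
have sqrt_le (v b : R) : (0 <= b -> v <= b ^+ 2 -> Num.sqrt v <= b)%R.
  by move=> b0 h; rewrite -(ger0_norm b0) -sqrtr_sqr ler_wsqrtr.
(* If [z] is as near as [x], later passes only improve on it. Otherwise [x] lies in the ball that
   the grid covers, and the mesh is not 0. *)
have [zx|xz] := lerP (nrm (z - y)) (nrm (x - y)).
  apply: (@le_trans _ _ (nrm (z - y))).
    by apply: sqrt_le; [exact: nrm_ge0 | rewrite -zV].
  by apply: (le_trans zx); rewrite ler_peMl // lerDl ltW.
have z0 : (0 < nrm (z - y))%R by exact: le_lt_trans xz.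
have b3 : (nrm (z - y) <= k%:R * (D%:R * nrm (x - y)))%R.
  have := @pass_bound y s3 F l (fun c => g3 c (mem_enum _ _)) init3 Fi Fn l0 l1E.
  rewrite -/x zV subrr (_ : nrm 0 = 0)%R ?add0r; last first.
    by rewrite /nrm /sq big1 ?sqrtr0 // => c _; rewrite mxE expr0n.
  rewrite ler_pXn2r ?nnegrE ?nrm_ge0 ?mulr_ge0 ?l1_ge0 // => h.
  by apply: (le_trans h); rewrite ler_wpM2l ?l1_nrm.
have [c [g /= gE]] := @grid_round R D' x y z q0 q0p (ltW xz) z0.
rewrite -GE in g gE.
have YE : grid_center (fun c => rv s4 (rS c)) (c, g) =
  (y + \row_r ((z 0 c - y 0 c) / q0%:R * ((nat_of_ord (g r))%:R - G%:R)))%R.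
  rewrite /grid_center /=; congr (_ + _)%R; apply/rowP => r.
  by rewrite !mxE S4 ?mem_iota /= ?ltn_ord // inord_val mxE.
rewrite -YE in gE; set Y := grid_center _ _ in YE gE.
have b5 := @pass_bound Y s5 F l (g5 _ (mem_enum _ _)) (fun i h => le_trans le53 (init3 i h)) Fi Fn l0 l1E.
apply: (@le_trans _ _ (nrm (Y - y) + k%:R * l1 (x - Y))%R).
  by apply: sqrt_le b5; rewrite addr_ge0 ?nrm_ge0 ?mulr_ge0 ?l1_ge0.
have t : (nrm (Y - y) <= nrm (x - y) + l1 (x - Y))%R.
  rewrite -(subrKA x Y); apply: le_trans (nrmD _ _) _; rewrite addrC lerD2l.
  by rewrite -nrmN opprB nrm_l1.
have q0R : (0 < q0%:R :> R)%R by rewrite ltr0n.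
set r := nrm (x - y) in r0 b3 t *; set L := l1 (x - Y) in t gE *.
have hL : (L * q0%:R <= k%:R * D%:R ^+ 2 * r)%R.
  rewrite -ler_pdivlMr //; apply: (le_trans gE).
  rewrite mulrA ler_pM2r ?invr_gt0 // expr2.
  by rewrite (_ : _ * r = D%:R * (k%:R * (D%:R * r)))%R ?ler_wpM2l //; ring.
apply: (@le_trans _ _ (r + k.+1%:R * L)%R).
  by rewrite -natr1 mulrDl mul1r; lra.
rewrite [leRHS]mulrDl mul1r lerD2l -(ler_pM2r q0R) -mulrA.
apply: le_trans (ler_wpM2l (ler0n _ _) hL) _.
rewrite [leRHS](_ : _ = eps * q0%:R * r)%R; last by ring.
by rewrite mulrA [leLHS](_ : _ = k.+1%:R * k%:R * D%:R ^+ 2 * r)%R ?ler_wpM2r // !mulrA.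
Qed.
End ProgramCorrect.

(** * Running time *)

(** The bound starts at [n = 2], from where [up_log 2 n] is positive and additive constants can be
    absorbed. *)
Definition costs a b c := exists C, forall n, 1 < n -> cost n c <= C * (n ^ a * up_log 2 n ^ b).

Lemma up_log2_gt0 n : 1 < n -> 0 < up_log 2 n.
Proof. by rewrite up_log_gt0. Qed.

Lemma costs_le a b a' b' c : a <= a' -> b <= b' -> costs a b c -> costs a' b' c.
Proof.
move=> ha hb [C h]; exists C => n n1; apply: leq_trans (h n n1) _.
by rewrite leq_mul2l leq_mul ?orbT // leq_pexp2l ?up_log2_gt0 // ltnW.
Qed.

Lemma costs_const a b c C : (forall n, cost n c <= C) -> costs a b c.
Proof.
move=> h; exists C => n n1; apply: leq_trans (h n) _.
by rewrite leq_pmulr // muln_gt0 !expn_gt0 (ltnW n1) up_log2_gt0.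
Qed.

Lemma costs_skip a b : costs a b CSkip.
Proof. exact: (@costs_const _ _ _ 0). Qed.

Lemma costs_W a b x e : costs a b (CW x e).
Proof. exact: (@costs_const _ _ _ (wlen e + 2)). Qed.

Lemma costs_R a b x e : costs a b (CR x e).
Proof. exact: (@costs_const _ _ _ (rlen e + 2)). Qed.

Lemma costs_M a b id z e : costs a b (CM id z e).
Proof. exact: (@costs_const _ _ _ (wlen z + wlen e + 5)). Qed.

Lemma costs_seq a b c1 c2 : costs a b c1 -> costs a b c2 -> costs a b (c1 ;; c2).
Proof.
move=> [C1 h1] [C2 h2]; exists (C1 + C2) => n n1 /=.
by rewrite mulnDl leq_add ?h1 ?h2.
Qed.

Lemma costs_branch a b c c1 c2 C : (forall n, cost n c = cost n c1 + cost n c2 + C) ->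
  costs a b c1 -> costs a b c2 -> costs a b c.
Proof.
move=> E [C1 h1] [C2 h2]; exists (C1 + C2 + C) => n n1; rewrite E !mulnDl.
rewrite !leq_add ?h1 ?h2 // leq_pmulr // muln_gt0 !expn_gt0 (ltnW n1) up_log2_gt0 //.
Qed.

Lemma costs_ifW a b e1 e2 c1 c2 : costs a b c1 -> costs a b c2 -> costs a b (CIfW e1 e2 c1 c2).
Proof. by apply: (@costs_branch _ _ _ _ _ (wlen e1 + wlen e2 + 2)) => n /=; lia. Qed.

Lemma costs_ifR a b e1 e2 c1 c2 : costs a b c1 -> costs a b c2 -> costs a b (CIfR e1 e2 c1 c2).
Proof. by apply: (@costs_branch _ _ _ _ _ (rlen e1 + rlen e2 + 2)) => n /=; lia. Qed.

Lemma loop_cost_le C m X : 0 < X -> 0 < m -> m * (C * X + 6) + 2 <= (C + 8) * (m * X).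
Proof. nia. Qed.

Lemma costs_for lg a b x c : costs a b c ->
  costs (if lg then a else a.+1) (if lg then b.+1 else b) (CFor lg x c).
Proof.
move=> [C h]; exists (C + 8) => n n1 /=.
set X := n ^ a * up_log 2 n ^ b; set m := size _.
have -> : n ^ (if lg then a else a.+1) * up_log 2 n ^ (if lg then b.+1 else b) = m * X.
  rewrite /m /X /loop_range; case: (lg); rewrite ?size_map size_iota expnS; last by rewrite mulnA.
  by rewrite mulnCA.
have m0 : 0 < m.
  by rewrite /m /loop_range; case: (lg); rewrite ?size_map size_iota ?up_log2_gt0 // ltnW.
have X0 : 0 < X by rewrite muln_gt0 !expn_gt0 (ltnW n1) up_log2_gt0.
apply: leq_trans (loop_cost_le C X0 m0).
by rewrite leq_add2r leq_mul2l leq_add2r h ?orbT.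
Qed.

Lemma costs_seqC (T : Type) a b (F : T -> cmd) l : (forall i, costs a b (F i)) ->
  costs a b (seqC [seq F i | i <- l]).
Proof. by move=> h; elim: l => [|i l IH] /=; [exact: costs_skip | exact: costs_seq]. Qed.

Lemma costs_nest lg xs a b c : costs a b c ->
  costs (if lg then a else a + size xs) (if lg then b + size xs else b) (nest lg xs c).
Proof.
move=> h; elim: xs => [|x xs IH] /=; first by rewrite !addn0; case: lg.
by move: (costs_for lg x IH); case: lg {IH}; rewrite addnS.
Qed.

Lemma costs_guard a b l c : costs a b c -> costs a b (guard l c).
Proof.
move=> h; elim: l => [|[z1 z2] l IH] //=.
by apply: costs_ifW => //; apply: costs_ifW => //; exact: costs_skip.
Qed.

Lemma costs_rank aS aR cmp : (forall a b, costs 0 0 a -> costs 0 0 b -> costs 0 0 (cmp a b)) ->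
  costs 1 2 (rank_code aS aR cmp).
Proof.
move=> hc.
have hs : costs 0 0 (search_step aS cmp).
  apply: costs_ifW; last exact: costs_skip.
  by do ?[apply: costs_seq; first exact: costs_W]; apply: hc; exact: costs_W.
have hh h : costs 0 1 (search_half aS cmp h).
  do ?[apply: costs_seq]; rewrite ?/search_half; try exact: costs_W.
    by apply: costs_ifW; exact: costs_W.
  exact: (costs_for true _ hs).
apply: costs_seq.
  apply: (@costs_le 1 0) => //; exact: (costs_for false _ (costs_M 0 0 _ _ _)).
apply: (costs_for true _ (a := 1) (b := 1)); apply: costs_seq; apply: (costs_for false _ (a := 0) (b := 1)).
  exact: costs_M.
by apply: costs_seq (costs_W _ _ _ _) _; apply: costs_seq (hh 0) _; apply: costs_seq (hh 1) (costs_M _ _ _ _ _).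
Qed.

(** For each of the [n ^ k'] choices, insertion and queries take [n] times [D'] logarithmic factors,
    and ranking takes [n] times two. The exponent [D'.+1] covers both, also for [D' = 1]. *)
Lemma costs_nearest_pair D' k' np (f : 'I_D'.+1 -> 'I_D'.+1) e t uid aS : 0 < D' ->
  costs k'.+1 D'.+1 (nearest_pair k' np f e t uid aS).
Proof.
move=> D0; rewrite -add1n.
have := @costs_nest false (pis k') 1 D'.+1 (block k' np f e t uid aS).
rewrite size_map size_iota /=; apply; apply: costs_guard.
have cp i a b : costs 0 0 a -> costs 0 0 b -> costs 0 0 (prec_cmd np f e t i a b).
  by move=> ha hb; do 2!apply: costs_ifR => //; apply: costs_ifW.
have tree c x C1 C2 : costs 0 0 c -> costs 1 D'.+1 (CFor false x (guard C1 (CIfR C2.1 C2.2 CSkip (nest true (pws D') c)))).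
  move=> hc; apply: (costs_for false _ (a := 0)); apply: costs_guard; apply: costs_ifR; first exact: costs_skip.
  apply: (@costs_le 0 D') => //.
  by have := costs_nest true (pws D') hc; rewrite size_map size_iota.
apply: costs_seq.
  apply: (@costs_le 1 2) => //; rewrite /ranks; apply: costs_seqC => i.
  by apply: costs_rank => a b; exact: cp.
apply: costs_seq.
  apply: (tree _ _ _ (_, _)).
  do ?[apply: costs_ifW | apply: costs_ifR | apply: costs_skip | apply: costs_M].
apply: (tree _ _ _ (_, _)); apply: costs_ifW; first exact: costs_skip.
apply: costs_seq; first exact: costs_W.
apply: costs_ifR; last exact: costs_skip.
do ?[apply: costs_seq | apply: costs_W | apply: costs_R | apply: costs_seqC => ?].
Qed.

Lemma costs_pass D' k' uid l : 0 < D' -> costs k'.+1 D'.+1 (@pass D' k' uid l).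
Proof.
move=> D0; elim: l uid => [|c l IH] uid; first exact: costs_skip.
by apply: costs_seq => //; exact: costs_nearest_pair.
Qed.

Lemma costs_main D' k' q0 G : 0 < D' -> costs k'.+1 D'.+1 (main_program D' k' q0 G).
Proof.
move=> D0.
have hr : costs 0 0 (point_record D' k').
  by do ?[apply: costs_seq | apply: costs_W | apply: costs_R | apply: costs_ifW | apply: costs_seqC => ?].
have hc F : costs k'.+1 D'.+1 (set_center D' F) by apply: costs_seqC => i; exact: costs_R.
apply: costs_seq.
  apply: (@costs_le 1 0) => //; apply: costs_seq; first exact: costs_W.
  apply: costs_seq; first exact: costs_le hr.
  by apply: (costs_for false _ (a := 0)); apply: costs_ifR => //; exact: costs_skip.
apply: costs_seq => //; apply: costs_seq; first exact: costs_pass.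
apply: costs_seq; first by apply: costs_seqC => i; exact: costs_R.
apply: costs_seq; last by apply: costs_seqC => i; exact: costs_M.
elim: (enum _) (uid0 _ _ + _) => [|g l IH] uid; first exact: costs_skip.
by apply: costs_seq => //; apply: costs_seq => //; exact: costs_pass.
Qed.

(** * Runs on the input of the problem *)

Lemma nth_flatten_const (T : Type) (x0 : T) d (ss : seq (seq T)) i j :
  all (fun s => size s == d) ss -> j < d -> i < size ss ->
  nth x0 (flatten ss) (i * d + j) = nth x0 (nth [::] ss i) j.
Proof.
elim: ss i => [|s ss IH] [|i] //= /andP[/eqP sd al] jd il; rewrite nth_cat sd.
  by rewrite mul0n add0n jd.
by rewrite mulSn -addnA ltnNge leq_addr addKn /= IH.
Qed.

(** [n + 2 <= X ^ 2] and [c < X ^ c]: constant factors are absorbed by the exponent, so a sum of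
    constants can serve as word factor. *)
Lemma exp_word_bound X n a c b : 1 < X -> n <= X -> 1 < n -> 2 * a + c <= b ->
  n.+2 ^ a * c < X ^ b.
Proof.
move=> X1 nX n1 le; apply: (@leq_trans (X ^ (2 * a + c))); last by rewrite leq_pexp2l // ltnW.
rewrite expnD expnM; apply: (@leq_ltn_trans ((X ^ 2) ^ a * c)).
  rewrite leq_mul2r; apply/orP; right; case: a {le} => // a.
  by rewrite leq_exp2r // -mulnn; nia.
by rewrite ltn_pmul2l ?expn_gt0 ?(ltnW X1) // ltn_expl.
Qed.

Section Run.
Variables (R : realType) (D' k' q0 G n : nat).
Notation D := D'.+1.
Notation k := k'.+2.
Notation K := (num_arrays D' k' G).
Variables (S : 'I_n -> 'rV[R]_D) (y : 'rV[R]_D).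
Hypotheses (kD : k' <= D') (kn : k <= n).

(** One summand for each quantity that must fit in a word; the first two make room for addresses up
    to [n.+1 ^ (k' + 2 * D').+1 * K]. *)
Definition word_factor := 2 * (k' + 2 * D').+1 + K + G.*2 + q0 + k + D + 20.
Notation w := (word_size word_factor n).
Notation m0 := (input S y).
Notation main := (main_program D' k' q0 G).
Notation P := (cc K main 0 0).

Lemma input_row i : i <= n -> pt D' (rmem m0) i = nth 0%R (rcons [seq S i | i <- enum 'I_n] y) i.
Proof.
set ps := rcons _ _ => iN; have sz : i < size ps by rewrite size_rcons size_map size_enum_ord.
apply/rowP => c; rewrite mxE /= nth_flatten_const ?size_map //.
  by rewrite (nth_map 0%R) // (nth_map ord0) ?size_enum_ord // nth_ord_enum.
by rewrite all_map; apply/allP => p _ /=; rewrite size_map size_enum_ord.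
Qed.

Lemma input_point (i : 'I_n) : pt D' (rmem m0) i = S i.
Proof.
rewrite input_row ?(ltnW (ltn_ord i)) // nth_rcons size_map size_enum_ord ltn_ord.
by rewrite (nth_map i) ?size_enum_ord // nth_ord_enum.
Qed.

Lemma input_target : pt D' (rmem m0) n = y.
Proof. by rewrite input_row // nth_rcons size_map size_enum_ord ltnn eqxx. Qed.

Lemma eucl_dist_nrm (x z : 'rV[R]_D) : eucl_dist z x = nrm (x - z).
Proof.
by rewrite -nrmN opprB /eucl_dist /nrm /sq; congr Num.sqrt; apply: eq_bigr => c _; rewrite !mxE.
Qed.

Lemma simplex_dist_le (J : 'I_k -> 'I_n) (a : 'I_k -> R) :
  (forall i, (0 <= a i)%R) -> (\sum_i a i = 1)%R ->
  (simplex_dist y (S \o J) <= nrm (\sum_i a i *: S (J i) - y))%R.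
Proof.
move=> a0 a1; rewrite -eucl_dist_nrm; apply: ge_inf.
  by exists 0%R => _ [x _ <-]; exact: sqrtr_ge0.
by eexists; first by exists a; split.
Qed.

Lemma nearest_simplex_dist_ge (v : R) :
  (forall (J : 'I_k -> 'I_n) (a : 'I_k -> R), injective J ->
     (forall i, (0 <= a i)%R) -> (\sum_i a i = 1)%R -> (v <= nrm (\sum_i a i *: S (J i) - y))%R) ->
  (v <= nearest_simplex_dist k S y)%R.
Proof.
move=> h; apply: lb_le_inf.
  exists (simplex_dist y (S \o widen_ord kn)), (widen_ord kn) => //.
  by move=> i j /(congr1 val) /= /val_inj.
move=> _ [J Ji <-]; apply: lb_le_inf.
  exists (eucl_dist y (S (J ord0))), (S (J ord0)) => //.
  exists (fun i => (i == ord0)%:R%R); split.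
  - by move=> i; rewrite ler0n.
  - by rewrite (bigD1 ord0) //= big1 ?addr0 // => i /negbTE ->.
  - by rewrite (bigD1 ord0) //= scale1r big1 ?addr0 // => i /negbTE ->; rewrite scale0r.
by move=> _ [x [a [a0 a1 ->]] <-]; rewrite eucl_dist_nrm; exact: h.
Qed.

Lemma machine_run (eps : R) : 0 < q0 -> G = (D * q0)%N -> (0 < eps)%R ->
  (k.+1%:R * k%:R * D%:R ^+ 2 <= eps * q0%:R)%R ->
  exists t m', [/\ t <= cost n main, steps w P m0 t m', halted P m' &
    exists J : 'I_k -> 'I_n, [/\ outputs m' J, injective J &
      (simplex_dist y (S \o J) <= (1 + eps) * nearest_simplex_dist k S y)%R]].
Proof.
move=> q0p GE eps0 heps.
have n1 : 1 < n by exact: leq_trans kn.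
set X := 2 ^ up_log 2 n.
have nX : n <= X by exact: up_logP.
have X1 : 1 < X by exact: leq_trans nX.
have WE : 2 ^ w = X ^ word_factor by rewrite /word_size mulnC expnM.
have bound a c : 2 * a + c <= word_factor -> n.+2 ^ a * c < 2 ^ w.
  by rewrite WE; exact: exp_word_bound.
have lt_const c : c <= word_factor -> c < 2 ^ w.
  by move=> h; rewrite -[c]mul1n -(expn0 n.+2) bound.
have lt_lin c : c + 2 <= word_factor -> n.+2 * c < 2 ^ w.
  by move=> h; rewrite -(expn1 n.+2) bound // addnC muln1.
have HE c : 0 < c -> c <= maxn 1 K -> n.+1 ^ (k' + 2 * D').+1 * c < 2 ^ w.
  move=> c0 cK; apply: (@leq_ltn_trans (n.+2 ^ (k' + 2 * D').+1 * c)).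
    by rewrite leq_mul2r leq_exp2r ?leqnSn ?orbT.
  by apply: bound; move: cK; rewrite /word_factor; lia.
have K0 : 0 < K by rewrite /num_arrays /uid0.
have HW : 8 * n.+1 < 2 ^ w.
  apply: (@leq_ltn_trans (n.+2 * 8)); first by lia.
  by apply: lt_lin; rewrite /word_factor; lia.
have HD : n.+1 * D < 2 ^ w.
  apply: (@leq_ltn_trans (n.+2 * D)); first by rewrite leq_mul2r leqnSn orbT.
  by apply: lt_lin; rewrite /word_factor; lia.
have HA : n.+1 ^ (k' + 2 * D').+1 < 2 ^ w by rewrite -[ltnLHS]muln1 HE // leq_maxl.
have HK : n.+1 ^ (k' + 2 * D').+1 * K <= 2 ^ w by rewrite ltnW // HE // leq_maxr.
have HK2 : n.+2 * K <= 2 ^ w by rewrite ltnW // lt_lin // /word_factor; lia.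
have Wq : q0 < 2 ^ w by apply: lt_const; rewrite /word_factor; lia.
have WG : G.*2 < 2 ^ w by apply: lt_const; rewrite /word_factor; lia.
have Wk : k < 2 ^ w by apply: lt_const; rewrite /word_factor; lia.
have WK : K < 2 ^ w by apply: lt_const; rewrite /word_factor; lia.
have W1 : 1 < 2 ^ w by apply: leq_ltn_trans Wk.
have Wn : n.*2 <= 2 ^ w by apply: leq_trans (ltnW HW); lia.
pose s0 : store R := Store (fun=> 0) (fun _ _ => 0) (fun=> 0%R).
have [sf [J [a [Ji Jn Jm [a0 a1] best]]]] := main_ok (rmem m0) n1 kD kn HW HD HA HK HK2 Wq WG Wk
  (s := s0) q0p GE heps (fun _ _ _ => erefl).
(* All word memory and all registers but register 0 start at 0, so the machine starts with empty
   arrays. *)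
have rel0 : represents n w K (rmem m0) s0 m0.
  by split=> // x; rewrite /= gtn_eqF // /VR addn2.
have code0 : code_at P (pc m0) P by move=> j _; rewrite add0n.
have [t [m' [le st pcE [_ _ mem _ _] _]]] := compile_sound Wn W1 n1 WK (lv := 0) rel0 sf code0.
exists t, m'; split=> //.
  by rewrite /halted /fetch pcE nth_default // size_cc.
have kK : k <= K by rewrite /num_arrays /uid0 addSn leqW // -addnA leq_addr.
exists (fun i => Ordinal (Jn i)); split.
- move=> i; have iK : i < K by exact: leq_trans (ltn_ord i) kK.
  by have := mem i 0 iK; rewrite mul0n add0n (ltn_trans iK WK) Jm => ->.
- by move=> i j [] /Ji.
apply: (le_trans (simplex_dist_le _ a0 a1)).
(* With [1 + eps] divided out, the estimate against every competitor is a lower bound for both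
   infima. *)
rewrite mulrC -ler_pdivrMr ?addr_gt0 //; apply: nearest_simplex_dist_ge => F l Fi l0 l1E.
rewrite ler_pdivrMr ?addr_gt0 // mulrC.
have := best (fun i => F i) l (inj_comp val_inj Fi) (fun i => ltn_ord (F i)) l0 l1E.
have EJ : (\sum_i a i *: pt D' (rmem m0) (J i) = \sum_i a i *: S (Ordinal (Jn i)))%R.
  by apply: eq_bigr => i _; rewrite -input_point.
have EF : (\sum_i l i *: pt D' (rmem m0) (F i) = \sum_i l i *: S (F i))%R.
  by apply: eq_bigr => i _; rewrite input_point.
by rewrite EJ EF input_target.
Qed.
End Run.

Lemma run_steps (R : realType) w (P : program) (m m' : state R) t (rs : seq 'I_(2 ^ w)) :
  steps w P m t m' -> halted P m' -> t <= size rs -> run P m rs = m'.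
Proof.
move=> st hm le; rewrite -(cat_take_drop t rs) /run foldl_cat -/(run P m _) -/(run P _ _).
by rewrite st ?size_takel // run_halted.
Qed.

(** [2 ^ (up_log 2 n - 1)] is below [n], and the missing unit is absorbed by [ln 2 <= ln n], which
    doubles the constant. *)
Lemma up_log_le_ln (R : realType) n : 1 < n ->
  ((up_log 2 n)%:R <= 2 / ln (2 : R) * ln (n%:R : R))%R.
Proof.
move=> n1; have /andP[lt _] := up_log_bounds (isT : 1 < 2) n1.
have ln2 : (0 < ln (2 : R))%R by rewrite ln_gt0 // ltr1n.
rewrite mulrAC ler_pdivlMr //.
have h1 : ((up_log 2 n).-1%:R * ln (2 : R) <= ln (n%:R : R))%R.
  rewrite mulr_natl -lnXn // ler_ln ?posrE ?exprn_gt0 ?ltr0n ?(ltnW n1) //.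
  by rewrite -natrX ler_nat ltnW.
have h2 : (ln (2 : R) <= ln (n%:R : R))%R.
  by rewrite ler_ln ?posrE ?ltr0n ?(ltnW n1) // ler_nat.
have L0 : 0 < up_log 2 n by exact: up_log2_gt0.
by rewrite -[X in (X%:R * _ <= _)%R](prednK L0) -natr1; lra.
Qed.

Local Open Scope ring_scope.

Theorem theorem6 (R : realType) (eps : R) (d k : nat)
  (eps_gt0 : 0 < eps) (k_ge2 : (2 <= k)%N) (k_le_d : (k <= d)%N) :
  exists (P : program) (b : nat),
    approximates_nearest_simplex d k eps P b /\
    runs_whp_in_O d k P b (fun n => n%:R ^+ (k - 1) * ln (n%:R : R) ^+ d).
Proof.
case: k k_ge2 k_le_d => [|[|k']] // _; case: d => // D' kd.
have kD : (k' <= D')%N by rewrite -ltnS ltnW.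
have D0 : (0 < D')%N by exact: leq_trans (ltn0Sn k') kd.
pose A : R := k'.+3%:R * k'.+2%:R * D'.+1%:R ^+ 2.
have A0 : (0 <= A) by rewrite /A !mulr_ge0 // exprn_ge0.
(* Any integer above [A / eps] makes the grid fine enough for [main_ok]. *)
pose q0 := (Num.truncn (A / eps)).+1.
have hq : (A <= eps * q0%:R).
  rewrite mulrC -ler_pdivrMr // ltW //.
  by have /andP[] := truncn_itv (divr_ge0 A0 (ltW eps_gt0)).
pose G := (D'.+1 * q0)%N.
pose c := main_program D' k' q0 G.
exists (cc (num_arrays D' k' G) c 0 0), (word_factor D' k' q0 G); split.
  move=> n S y kn _ rs.
  have [t [m' [_ st hm [J [oJ Ji le]]]]] := machine_run (q0 := q0) (G := G) S y kD kn isT erefl eps_gt0 hq.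
  exists t => /=; rewrite (run_steps st hm) ?size_mkseq //; split=> //.
  by exists J.
move=> c0; have [C costC] := @costs_main D' k' q0 G D0.
(* The same constant for every [c0]; the power of [2 / ln 2] pays for replacing [up_log 2] by
   [ln]. *)
exists (C%:R * (2 / ln 2) ^+ D'.+1) => n S y kn _.
have [t [m' [le st hm _]]] := machine_run (q0 := q0) (G := G) S y kD kn isT erefl eps_gt0 hq.
have n1 : (1 < n)%N by exact: leq_trans kn.
set T := Num.truncn _.
have tT : (t <= T)%N.
  apply: leq_trans le _; apply: leq_trans (costC n n1) _.
  have L0 := up_log_le_ln R n1.
  have l0 : (0 <= ln (n%:R : R)) by rewrite ln_ge0 // ler1n ltnW.
  have l2 : (0 <= 2 / ln (2 : R)) by rewrite divr_ge0 // ln_ge0 // ler1n.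
  rewrite /T truncn_ge_nat; last by rewrite !mulr_ge0 ?exprn_ge0.
  rewrite natrM natrM !natrX subn1 /= -mulrA ler_wpM2l // mulrCA ler_wpM2l ?exprn_ge0 //.
  by rewrite -exprMn ler_pXn2r ?nnegrE ?(mulr_ge0 l2 l0).
(* Every tuple of random words leads to a halt, so the probability is 1. *)
rewrite /prob_halt_within (@eq_card _ _ (mem predT)) ?divff.
- by rewrite gerBl invr_ge0 exprn_ge0.
- by rewrite pnatr_eq0 card_tuple card_ord -lt0n !expn_gt0.
- by move=> rs; rewrite !inE (run_steps st hm) ?size_tuple.
Qed.
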